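(* Let $\mathbb{S}$ be a Cartesian category and let $X:\mathbb{S}^{op}\to dSet$ be a diagram of dendroidal sets. If for every object $S$ of $\mathbb{S}$ the dendroidal set $X(S)$ is an inner Kan complex, then so is $\int_{\mathbb{S}}X$. Likewise, if every $X(S)$ is a strict inner Kan complex, then so is $\int_{\mathbb{S}}X$.
   Context: Operad means symmetric coloured operad in sets. Trees are finite rooted trees with a root (output) edge and a set of leaves (input edges); vertices may have any number $\ge 0$ of inputs. $\eta$ is the tree with one edge and no vertices. An edge is inner if it has a vertex at both ends; otherwise it is outer. Each tree $T$ defines an operad $\Omega(T)$ whose colours are the edges of $T$ and which is freely generated by the vertices of $T$. The category $\Omega$ has trees as objects and operad maps $\Omega(T)\to\Omega(T')$ as arrows. A dendroidal set is a functor $X:\Omega^{op}\to Set$, with $X_T=X(T)$; $dSet$ is the category of dendroidal sets and $\Omega[T]$ the representable one. The dendroidal nerve of an operad $\mathcal P$ is $N_d(\mathcal P)_T=Hom(\Omega(T),\mathcal P)$. Faces of $T$: for an inner edge $e$, the inner face $\partial_e:T/e\to T$ obtained by contracting $e$; for a vertex $v$ with exactly one inner edge attached, the outer face $\partial_v:T/v\to T$ obtained by deleting $v$ and all outer edges attached to it; if $T$ has exactly one vertex, each edge of $T$ gives an outer face $\eta\to T$. For an inner edge $e$, the inner horn $\Lambda^e[T]\subseteq\Omega[T]$ is the union of all faces except $\partial_e$. A dendroidal set $K$ is a (strict) inner Kan complex if for every tree $T$ and inner edge $e$ of $T$ the map $Hom(\Omega[T],K)\to Hom(\Lambda^e[T],K)$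 is surjective (bijective). A Cartesian category $\mathbb S$ is a category with (chosen) finite products; it is regarded as an operad via $\mathbb S(s_1,\dots,s_n;s)=\mathbb S(s_1\times\cdots\times s_n,s)$, so $N_d(\mathbb S)$ is defined. For $t\in N_d(\mathbb S)_T$ put $in(t)=\prod_{l\in leaves(T)}l^*(t)$, where $l:\eta\to T$ is the map with image the leaf $l$. If $\alpha:S\to T$ is a composition of face maps (and isomorphisms) and $t\in N_d(\mathbb S)_T$, there is a canonical arrow $in(\alpha):in(t)\to in(\alpha^*t)$ in $\mathbb S$: its component at a leaf $l$ of $S$ is the projection of $in(t)$ to the product over the leaves of $T$ lying above the edge $\alpha(l)$ (up to symmetry), followed by the operation of $\mathbb S$ that $t$ assigns to the subtree of $T$ consisting of everything above $\alpha(l)$ (the identity if $\alpha(l)$ is a leaf). A dendroidal collection is a family of sets indexed by the objects of $\Omega$; a map of dendroidal collections is a family of functions; each dendroidal set has an underlying collection. The dendroidal set $\int_{\mathbb S}X$: a dendrex of shape $T$ is a pair $(t,x)$ with $t\in N_d(\mathbb S)_T$ and $x:\Omega[T]\to\coprod_{S\in ob(\mathbb S)}X(S)$ a map of dendroidal collections such that (a) for each $r\in\Omega[T]_R$ (i.e. each arrow $r:R\to T$), $x(r)\in X(in(r^*t))_R$; and (b) for each $r\in\Omega[T]_R$ and each monomorphism (composition of faces and isomorphisms) $\alpha:U\to R$ in $\Omega$, $\alpha^*(x(r))=X(in(\alpha))(x(\alpha^*(r)))$, where $in(\alpha):in(r^*t)\to in(\alpha^*r^*t)$. A map $\beta:T'\to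 T$ acts by $\beta^*(t,x)=(\beta^*t,\,x\circ\Omega[\beta])$. *)

(* Defs.v *)
From Stdlib Require Import FunctionalExtensionality ProofIrrelevance.
From Stdlib Require Import ClassicalEpsilon.
From HB Require Import structures.
From mathcomp Require Import all_boot.

Set Implicit Arguments.
Unset Strict Implicit.
Unset Printing Implicit Defensive.

Record category := Category {
  ob :> Type;
  hom : ob -> ob -> Type;
  idc : forall a, hom a a;
  cmp : forall a b c, hom b c -> hom a b -> hom a c;
  cmp1c : forall a b (f : hom a b), cmp (idc b) f = f;
  cmpc1 : forall a b (f : hom a b), cmp f (idc a) = f;
  cmpA : forall a b c d (h : hom c d) (g : hom b c) (f : hom a b),
    cmp h (cmp g f) = cmp (cmp h g) f }.

Arguments hom {_} a b.
Arguments idc {_} a.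
Arguments cmp {_ _ _ _} g f.

Notation "g \oc f" := (cmp g f) (at level 40, left associativity).

Definition is_iso (C : category) (a b : C) (f : hom a b) : Prop :=
  exists g : hom b a, g \oc f = idc a /\ f \oc g = idc b.

Record presheaf (C : category) := Presheaf {
  pob :> C -> Type;
  pmap : forall a b : C, hom a b -> pob b -> pob a;
  pmap_id : forall (a : C) (x : pob a), pmap (idc a) x = x;
  pmap_cmp : forall (a b c : C) (g : hom b c) (f : hom a b) (x : pob c),
    pmap (g \oc f) x = pmap f (pmap g x) }.

Arguments pmap {C} p {a b} f x.

Record nattrans (C : category) (X Y : presheaf C) := NatTrans {
  nob :> forall a : C, X a -> Y a;
  nob_nat : forall (a b : C) (f : hom a b) (x : X b),
    nob (pmap X f x) = pmap Y f (nob x) }.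

Lemma nat_id_nat (C : category) (X : presheaf C) (a b : C) (f : hom a b)
  (x : X b) : pmap X f x = pmap X f x.
Proof. by []. Qed.

Definition nat_id (C : category) (X : presheaf C) : nattrans X X :=
  NatTrans (@nat_id_nat C X).

Lemma nat_cmp_nat (C : category) (X Y Z : presheaf C) (g : nattrans Y Z)
  (f : nattrans X Y) (a b : C) (u : hom a b) (x : X b) :
  g a (f a (pmap X u x)) = pmap Z u (g b (f b x)).
Proof. by rewrite !nob_nat. Qed.

Definition nat_cmp (C : category) (X Y Z : presheaf C) (g : nattrans Y Z)
  (f : nattrans X Y) : nattrans X Z :=
  NatTrans (nat_cmp_nat g f).

Definition yoneda (C : category) (c : C) : presheaf C :=
  @Presheaf C (fun a => hom a c) (fun a b f g => g \oc f)
    (fun a x => cmpc1 x) (fun a b d g f x => cmpA x g f).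

(* The coordinate-free presentation: the inputs of an operation are indexed
   by an arbitrary finite type I rather than by {1, ..., n}, and the symmetric
   group actions become the action of all bijections of finite types.  In
   [oact f], the input i of an operation is renamed to f i. *)

Record operad := Operad {
  col : Type;
  op : forall I : finType, (I -> col) -> col -> Type;
  oid : forall e : col, @op unit (fun=> e) e;
  ocomp : forall (J : finType) (I : J -> finType)
      (c : forall j, I j -> col) (d : J -> col) (e : col),
    op d e -> (forall j, op (c j) (d j)) ->
    @op {j : J & I j} (fun x => c (tag x) (tagged x)) e;
  oact : forall (I J : finType) (f : I -> J), bijective f ->
    forall (c : J -> col) (e : col), op (fun i => c (f i)) e -> op c e;
  oact_id : forall (I : finType) (bij : bijective (fun i : I => i))
      (c : I -> col) (e : col) (p : op c e), oact bij p = p;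
  oact_comp : forall (I J K : finType) (f : I -> J) (g : J -> K)
      (bf : bijective f) (bg : bijective g)
      (bgf : bijective (fun i => g (f i))) (c : K -> col) (e : col)
      (p : op (fun i => c (g (f i))) e),
    oact bgf p = oact bg (oact bf p);
  ocomp1o : forall (I : finType) (c : I -> col) (e : col) (p : op c e)
      (bij : bijective (fun x : {u : unit & I} => tagged x)),
    oact (c := c) bij (ocomp (oid e) (fun=> p)) = p;
  ocompo1 : forall (I : finType) (c : I -> col) (e : col) (p : op c e)
      (bij : bijective (fun x : {i : I & unit} => tag x)),
    oact (c := c) bij (ocomp p (fun i => oid (c i))) = p;
  ocompA : forall (J : finType) (I : J -> finType)
      (K : {j : J & I j} -> finType)
      (b : forall x, K x -> col) (c : forall j, I j -> col) (d : J -> col)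
      (e : col)
      (p : op d e) (q : forall j, op (c j) (d j))
      (r : forall x, op (b x) (c (tag x) (tagged x)))
      (bij : bijective (fun y : {j : J & {i : I j & K (Tagged I i)}} =>
         Tagged K (i := Tagged I (tag (tagged y))) (tagged (tagged y)))),
    oact (c := fun x => b (tag x) (tagged x)) bij
      (ocomp p (fun j => ocomp (q j) (fun i => r (Tagged I i))))
    = ocomp (ocomp p q) r;
  ocomp_actl : forall (J' J : finType) (f : J' -> J) (bf : bijective f)
      (I : J -> finType) (c : forall j, I j -> col) (d : J -> col) (e : col)
      (p : op (fun j => d (f j)) e) (q : forall j, op (c j) (d j))
      (bij : bijective (fun x : {j : J' & I (f j)} =>
         Tagged I (i := f (tag x)) (tagged x))),
    ocomp (oact bf p) q
    = oact (c := fun x => c (tag x) (tagged x)) bij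
        (ocomp p (fun j => q (f j)));
  ocomp_actr : forall (J : finType) (I' I : J -> finType)
      (g : forall j, I' j -> I j) (bg : forall j, bijective (g j))
      (c : forall j, I j -> col) (d : J -> col) (e : col) (p : op d e)
      (q : forall j, op (fun i => c j (g j i)) (d j))
      (bij : bijective (fun x : {j : J & I' j} =>
         Tagged I (g (tag x) (tagged x)))),
    ocomp p (fun j => oact (c := c j) (bg j) (q j))
    = oact (c := fun x => c (tag x) (tagged x)) bij (ocomp p q) }.

Arguments op o {I} c e.
Arguments oid {o} e.
Arguments ocomp {o J I c d e} p q.
Arguments oact {o I J f} bf {c e} p : rename.

Record is_operad_map (P Q : operad) (f : col P -> col Q)
    (phi : forall (I : finType) (c : I -> col P) (e : col P),
       op P c e -> op Q (fun i => f (c i)) (f e)) : Prop := IsOperadMap {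
  map_oid : forall e, phi _ _ _ (oid e) = oid (f e);
  map_ocomp : forall (J : finType) (I : J -> finType)
      (c : forall j, I j -> col P) (d : J -> col P) (e : col P)
      (p : op P d e) (q : forall j, op P (c j) (d j)),
    phi _ _ _ (ocomp p q) = ocomp (phi _ _ _ p) (fun j => phi _ _ _ (q j));
  map_oact : forall (I J : finType) (h : I -> J) (bh : bijective h)
      (c : J -> col P) (e : col P) (p : op P (fun i => c (h i)) e),
    phi _ c e (oact bh p) = oact (c := fun j => f (c j)) bh (phi _ _ _ p) }.

Record operad_map (P Q : operad) := OperadMap {
  mcol :> col P -> col Q;
  mop : forall (I : finType) (c : I -> col P) (e : col P),
    op P c e -> op Q (fun i => mcol (c i)) (mcol e);
  mopP : is_operad_map mop }.

Arguments mop {P Q} o {I c e} p.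

Lemma operad_id_subproof (P : operad) :
  @is_operad_map P P id (fun I c e p => p).
Proof. by []. Qed.

Definition operad_id (P : operad) : operad_map P P :=
  OperadMap (operad_id_subproof P).

Lemma operad_cmp_subproof (P Q R : operad) (g : operad_map Q R)
    (f : operad_map P Q) :
  @is_operad_map P R (fun c => g (f c)) (fun I c e p => mop g (mop f p)).
Proof.
case: g f => [gc go [g1 g2 g3]] [fc fo [f1 f2 f3]] /=; split => *.
- by rewrite f1 g1.
- by rewrite f2 g2.
- by rewrite f3 g3.
Qed.

Definition operad_cmp (P Q R : operad) (g : operad_map Q R)
    (f : operad_map P Q) : operad_map P R :=
  OperadMap (operad_cmp_subproof g f).

Lemma operad_cmp1f (P Q : operad) (f : operad_map P Q) :
  operad_cmp (operad_id Q) f = f.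
Proof. by case: f => fc fo fP; congr OperadMap; apply: proof_irrelevance. Qed.

Lemma operad_cmpf1 (P Q : operad) (f : operad_map P Q) :
  operad_cmp f (operad_id P) = f.
Proof. by case: f => fc fo fP; congr OperadMap; apply: proof_irrelevance. Qed.

Lemma operad_cmpA (P Q R S : operad) (h : operad_map R S)
    (g : operad_map Q R) (f : operad_map P Q) :
  operad_cmp h (operad_cmp g f) = operad_cmp (operad_cmp h g) f.
Proof. by congr OperadMap; apply: proof_irrelevance. Qed.

Definition tree_down (E V : finType) (out : V -> E) (below : E -> option V)
    (x : E) : E :=
  if below x is Some v then out v else x.

(* [out v] is the output edge of the vertex v; [below x] is the vertex of
   which the edge x is an input, or None when x is the root.  Repeatedly
   passing from an edge to the output of the vertex below it must lead to the
   root. *)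
Record tree := Tree {
  edge : finType;
  vert : finType;
  root : edge;
  out : vert -> edge;
  below : edge -> option vert;
  out_inj : injective out;
  below_root : forall x, (below x == None) = (x == root);
  down_root : forall x, fconnect (tree_down out below) x root }.

Arguments out {t} v.
Arguments below {t} x.
Arguments root {t}.

Definition down (T : tree) : edge T -> edge T := tree_down out below.

(* [above x y]: y lies above x; every edge lies above itself. *)
Definition above (T : tree) (x y : edge T) : bool := fconnect (@down T) y x.

Definition is_leaf (T : tree) (x : edge T) : bool :=
  ~~ [exists v : vert T, out v == x].

Definition inner (T : tree) (x : edge T) : bool :=
  ~~ is_leaf x && isSome (below x).

Definition leaves (T : tree) : finType := {x : edge T | is_leaf x}.

Definition leaves_above (T : tree) (x : edge T) : finType :=
  {y : edge T | is_leaf y && above x y}.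

Definition inputs (T : tree) (v : vert T) : finType :=
  {x : edge T | below x == Some v}.

Definition inner_edge (T : tree) : finType := {x : edge T | inner x}.

(* An edge is the output of at most one vertex, so the free operad on the
   vertices of T has at most one operation with given inputs and output; its
   sets of operations are therefore given by a proposition.  The lemma
   Omega_free below shows that the resulting operad is the free one. *)
Inductive Omega_op (T : tree) :
    forall I : finType, (I -> edge T) -> edge T -> Prop :=
| Omega_id (e : edge T) : @Omega_op T unit (fun=> e) e
| Omega_vert (v : vert T) :
    @Omega_op T (inputs v) (fun x => val x) (out v)
| Omega_comp (J : finType) (I : J -> finType) (c : forall j, I j -> edge T)
    (d : J -> edge T) (e : edge T) :
    @Omega_op T J d e -> (forall j, @Omega_op T (I j) (c j) (d j)) ->
    @Omega_op T {j : J & I j} (fun x => c (tag x) (tagged x)) e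
| Omega_act (I J : finType) (f : I -> J) (c : J -> edge T) (e : edge T) :
    bijective f -> @Omega_op T I (fun i => c (f i)) e -> @Omega_op T J c e.

Definition Omega_operad (T : tree) : operad :=
  @Operad (edge T) (@Omega_op T) (@Omega_id T)
    (fun J I c d e => @Omega_comp T J I c d e)
    (fun I J f bf c e => @Omega_act T I J f c e bf)
    (fun _ _ _ _ _ => proof_irrelevance _ _ _)
    (fun _ _ _ _ _ _ _ _ _ _ _ => proof_irrelevance _ _ _)
    (fun _ _ _ _ _ => proof_irrelevance _ _ _)
    (fun _ _ _ _ _ => proof_irrelevance _ _ _)
    (fun _ _ _ _ _ _ _ _ _ _ _ => proof_irrelevance _ _ _)
    (fun _ _ _ _ _ _ _ _ _ _ _ => proof_irrelevance _ _ _)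
    (fun _ _ _ _ _ _ _ _ _ _ _ => proof_irrelevance _ _ _).

Lemma down_below (T : tree) (x : edge T) (v : vert T) :
  below x = Some v -> down x = out v.
Proof. by rewrite /down /tree_down => ->. Qed.

Lemma down_rootE (T : tree) : down (@root T) = root.
Proof.
by rewrite /down /tree_down; have /eqP -> : below (@root T) == None
  by rewrite below_root.
Qed.

Lemma iter_down_root (T : tree) (n : nat) :
  iter n (@down T) root = root.
Proof. by elim: n => //= n ->; apply: down_rootE. Qed.

Lemma reach_root (T : tree) (x : edge T) :
  exists n, iter n (@down T) x = root.
Proof.
by exists (findex (@down T) x root); apply: iter_findex; apply: down_root.
Qed.

Lemma down_cycle (T : tree) (x : edge T) (n : nat) :
  iter n.+1 (@down T) x = x -> x = root.
Proof.
move=> fx; have [k rk] := reach_root x.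
have fm m : iter (m * n.+1) (@down T) x = x.
  by elim: m => // m IH; rewrite mulSn iterD IH.
by rewrite -(fm k) mulnS addnC iterD rk iter_down_root.
Qed.

Lemma below_outN (T : tree) (v : vert T) : below (out v) != Some v.
Proof.
apply/eqP => bv; have /(down_cycle (n := 0)) rv : down (out v) = out v
  by apply: down_below.
by have := below_root (out v); rewrite bv rv eqxx.
Qed.

Lemma above_refl (T : tree) (x : edge T) : above x x.
Proof. exact: connect0. Qed.

Lemma above_trans (T : tree) (y x z : edge T) :
  above x y -> above y z -> above x z.
Proof. by move=> xy yz; apply: connect_trans yz xy. Qed.

Lemma above_anti (T : tree) (x y : edge T) : above x y -> above y x -> x = y.
Proof.
move=> /iter_findex; set n := findex _ _ _ => nyx.
move=> /iter_findex; set m := findex _ _ _ => mxy.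
case: n nyx => [|n] nyx; first by [].
have /down_cycle ry : iter (m + n).+1 (@down T) y = y.
  by rewrite -addnS iterD nyx.
by rewrite -nyx ry iter_down_root.
Qed.

Lemma above_iter (T : tree) (n : nat) (x : edge T) :
  above (iter n (@down T) x) x.
Proof. exact: fconnect_iter. Qed.

Lemma above_below (T : tree) (v : vert T) (x y : edge T) :
  below x = Some v -> above x y -> above (out v) y.
Proof.
move=> bx; apply: above_trans; rewrite -(down_below bx); exact: above_iter 1 x.
Qed.

Lemma above_outN (T : tree) (v : vert T) (x : edge T) :
  below x = Some v -> above x (out v) = false.
Proof.
move=> bx; apply/negP => xv.
have xE : out v = x.
  by apply: above_anti xv; apply: above_below bx (above_refl x).
by have := below_outN v; rewrite xE bx eqxx.
Qed.

Lemma siblings_disjoint (T : tree) (v : vert T) (x y z : edge T) :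
  below x = Some v -> below y = Some v -> above x z -> above y z -> x = y.
Proof.
move=> bx by_ /iter_findex; set n := findex _ _ _ => nx.
move=> /iter_findex; set m := findex _ _ _ => my.
wlog le : x y n m bx by_ nx my / n <= m.
  by move=> W; case/orP: (leq_total n m) => le;
    [exact: (W x y n m) | symmetry; exact: (W y x m n)].
move: my; rewrite -(subnK le) iterD nx; case: (m - n) => [//|k].
rewrite iterSr (down_below bx) => ky; have := above_outN by_.
by rewrite -ky above_iter.
Qed.

Lemma isSome_below (T : tree) (x : edge T) : isSome (below x) = (x != root).
Proof. by rewrite -below_root; case: (below x). Qed.

Lemma inputsP (T : tree) (v : vert T) (x : inputs v) : below (val x) = Some v.
Proof. exact/eqP/(valP x). Qed.

Lemma leafPn (T : tree) (x : edge T) :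
  reflect (exists v : vert T, out v = x) (~~ is_leaf x).
Proof. by rewrite negbK; apply: (iffP existsP) => -[v /eqP]; exists v => //; apply/eqP. Qed.

Lemma Omega_op_relabel (T : tree) (I J : finType) (c : I -> edge T)
    (d : J -> edge T) (e : edge T) :
  injective c -> injective d ->
  (forall i, exists j, d j = c i) -> (forall j, exists i, c i = d j) ->
  Omega_op c e -> Omega_op d e.
Proof.
move=> ic id_ cd dc co.
have cd' i : {j | d j = c i} by apply: constructive_indefinite_description.
have dc' j : {i | c i = d j} by apply: constructive_indefinite_description.
pose f i := sval (cd' i); pose g j := sval (dc' j).
have fE i : d (f i) = c i by rewrite /f; case: (cd' i).
have gE j : c (g j) = d j by rewrite /g; case: (dc' j).
apply: (@Omega_act T I J f).
  by exists g => x; [apply: ic; rewrite gE fE | apply: id_; rewrite fE gE].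
by have -> : (fun i => d (f i)) = c by apply: functional_extensionality.
Qed.

Definition Omega_set (T : tree) (A : {set edge T}) (e : edge T) : Prop :=
  @Omega_op T {x : edge T | x \in A} (fun x => val x) e.

Lemma Omega_set1 (T : tree) (e : edge T) : Omega_set [set e] e.
Proof.
have e1 : e \in [set e] by rewrite inE.
apply: Omega_op_relabel (Omega_id e) => //=; first by do 2!case.
- exact: val_inj.
- by move=> _; exists (exist _ e e1).
- by case=> x /= /set1P ->; exists tt.
Qed.

Lemma Omega_graft (T : tree) (J : finType) (d : J -> edge T)
    (A : J -> {set edge T}) (K : finType) (b : K -> edge T) (e : edge T) :
  Omega_op d e -> (forall j, Omega_set (A j) (d j)) ->
  (forall j j' x, x \in A j -> x \in A j' -> j = j') ->
  injective b -> (forall x, (exists k, b k = x) <-> exists j, x \in A j) ->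
  Omega_op b e.
Proof.
move=> od oA dis ib Ab; apply: Omega_op_relabel (Omega_comp od oA) => //.
- case=> [j [x xA]] [j' [x' xA']] /= xx'; subst x'.
  have jj' := dis _ _ _ xA xA'; subst j'.
  by rewrite (bool_irrelevance xA xA').
- by case=> j [x xA] /=; apply/Ab; exists j.
- move=> k; have /Ab [j kA] : exists k', b k' = b k by exists k.
  by exists (Tagged (fun j => {x | x \in A j}) (exist _ (b k) kA)).
Qed.

Lemma Omega_op_above (T : tree) (I : finType) (c : I -> edge T) (e : edge T) :
  Omega_op c e -> forall i, above e (c i).
Proof.
elim=> [{}e _|v [x /= /eqP bx]|J K b d {}e _ IH _ IH' [j k] /=
  |J K f d {}e [g fg gf] _ IH j].
- exact: above_refl.
- exact: above_below bx (above_refl x).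
- exact: above_trans (IH j) (IH' j k).
- by rewrite -[j]gf; apply: IH.
Qed.

Lemma above_cases (T : tree) (e y : edge T) : above e y ->
  y = e \/ exists v x, [/\ out v = e, below x = Some v & above x y].
Proof.
move=> /iter_findex; elim: (findex _ _ _) => [|n IH]; first by left.
rewrite iterS; set z := iter n _ y in IH *.
case bz: (below z) => [v|].
  by rewrite (down_below bz) => <-; right; exists v, z; split=> //;
    apply: above_iter.
by rewrite {1}/down /tree_down bz => /IH.
Qed.

Lemma above_leaf (T : tree) (e y : edge T) : is_leaf e -> above e y -> y = e.
Proof.
move=> le /above_cases [//|[v [x [ve _ _]]]].
by case/negP: le; apply/existsP; exists v; apply/eqP.
Qed.

Lemma above_out_inputs (T : tree) (v : vert T) (y : edge T) :
  above (out v) y -> y <> out v -> exists x : inputs v, above (val x) y.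
Proof.
move=> vy yv; case: (above_cases vy) => [//|[u [x [/out_inj uv bx xy]]]].
subst u; have ix : below x == Some v by apply/eqP.
by exists (exist _ x ix).
Qed.

Lemma Omega_op_crown (T : tree) (e : edge T) :
  @Omega_op T (leaves_above e) (fun x => val x) e.
Proof.
have [n] := ubnP #|[set x | above e x]|; elim: n e => // n IH e le_n.
case lf : (is_leaf e).
  apply: Omega_op_relabel (Omega_id e) => //=; first by do 2!case.
  - exact: val_inj.
  - have e1 : is_leaf e && above e e by rewrite lf above_refl.
    by move=> _; exists (exist _ e e1).
  - by case=> x /= /andP[lx ex]; exists tt; rewrite (above_leaf lf ex).
have /leafPn [v ve] := negbT lf; subst e.
apply: (Omega_graft (A := fun x : inputs v => [set y | is_leaf y && above (val x) y])
  (Omega_vert v)) => [x|||].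
- have bx := inputsP x.
  have pr : [set y | above (val x) y] \proper [set y | above (out v) y].
    apply/properP; split.
      by apply/subsetP => y; rewrite !inE; apply: above_below.
    by exists (out v); rewrite inE ?above_refl ?above_outN.
  apply: Omega_op_relabel (IH (val x) (leq_trans (proper_card pr) _)) => //.
  + exact: val_inj.
  + exact: val_inj.
  + case=> y /= yx; have yA : y \in [set y | is_leaf y && above (val x) y].
      by rewrite inE.
    by exists (exist _ y yA).
  + case=> y yA /=; have yx : is_leaf y && above (val x) y.
      by rewrite inE in yA.
    by exists (exist _ y yx).
- move=> x x' y; rewrite !inE => /andP[_ xy] /andP[_ xy']; apply: val_inj.
  exact: siblings_disjoint (inputsP x) (inputsP x') xy xy'.
- exact: val_inj.
- move=> y; split=> [[[z /= /andP[lz vz]] <-]|[x]].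
  + have [zv|x xz] := above_out_inputs vz; first by rewrite zv lf in lz.
    by exists x; rewrite inE lz.
  + rewrite inE => /andP[ly xy].
    have vy : is_leaf y && above (out v) y.
      by rewrite ly /=; apply: above_below (inputsP x) xy.
    by exists (exist _ y vy).
Qed.

(* The operation given by the part of T above the edge e. *)
Definition crown (T : tree) (e : edge T) :
  @op (Omega_operad T) (leaves_above e) (fun x => val x) e :=
  Omega_op_crown e.

Lemma inj_surj_bij (A B : Type) (f : A -> B) :
  injective f -> (forall b, exists a, f a = b) -> bijective f.
Proof.
move=> fi fs; pose g b := sval (constructive_indefinite_description _ (fs b)).
have gK b : f (g b) = b by rewrite /g; case: constructive_indefinite_description.
by exists g => // a; apply: fi; rewrite gK.
Qed.

Lemma tag_map_bij (J' J : finType) (f : J' -> J) (I : J -> finType) :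
  bijective f ->
  bijective (fun x : {j : J' & I (f j)} =>
    Tagged I (i := f (tag x)) (tagged x)).
Proof.
move=> bf; have fi := bij_inj bf; apply: inj_surj_bij.
- move=> [j i] [j' i'] /= E.
  have jj' : j = j' by apply: fi; apply: (congr1 tag E).
  by subst j'; move: (inj_pair2 _ _ _ _ _ E) => /= ->.
- case: bf => g fK gK [j]; case: _ / (gK j) => i.
  by exists (existT _ (g j) i).
Qed.

Lemma tagged_map_bij (J : finType) (I' I : J -> finType)
    (g : forall j, I' j -> I j) :
  (forall j, bijective (g j)) ->
  bijective (fun x : {j : J & I' j} => Tagged I (g (tag x) (tagged x))).
Proof.
move=> bg; apply: inj_surj_bij.
- move=> [j i] [j' i'] /= E.
  have jj' : j = j' by apply: (congr1 tag E).
  subst j'; move: (inj_pair2 _ _ _ _ _ E) => /= /(bij_inj (bg j)) -> //.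
- case=> j i; have [h _ hK] := bg j.
  by exists (existT _ j (h i)); rewrite /= hK.
Qed.

Lemma tag_assoc_bij (J : finType) (I : J -> finType)
    (K : {j : J & I j} -> finType) :
  bijective (fun y : {j : J & {i : I j & K (Tagged I i)}} =>
    Tagged K (i := Tagged I (tag (tagged y))) (tagged (tagged y))).
Proof.
exists (fun x : {x : {j : J & I j} & K x} =>
  match x with
  | existT (existT j i) k => Tagged (fun j => {i : I j & K (Tagged I i)})
      (Tagged (fun i => K (Tagged I i)) k)
  end).
- by case=> [j [i k]].
- by case=> [[j i] k].
Qed.

Lemma tagged_unit_bij (I : finType) :
  bijective (fun x : {u : unit & I} => tagged x).
Proof.
by exists (fun i => Tagged (fun _ : unit => I) (i := tt) i) => // -[[] i].
Qed.

Lemma tag_unit_bij (I : finType) :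
  bijective (fun x : {i : I & unit} => tag x).
Proof.
by exists (fun i => Tagged (fun _ : I => unit) (i := i) tt) => // -[i []].
Qed.

Inductive subtree (T : tree) : edge T -> Type :=
| SubLeaf (e : edge T) : subtree e
| SubNode (v : vert T) (s : forall x : inputs v, subtree (val x)) :
    subtree (out v).

Fixpoint st_pos (T : tree) (e : edge T) (t : subtree e) : finType :=
  match t with
  | SubLeaf _ => unit
  | SubNode v s => {x : inputs v & st_pos (s x)}
  end.

Fixpoint st_col (T : tree) (e : edge T) (t : subtree e) :
    st_pos t -> edge T :=
  match t with
  | SubLeaf e => fun=> e
  | SubNode v s => fun z => st_col (tagged z)
  end.

Fixpoint st_op (T : tree) (P : operad) (f : edge T -> col P)
    (p : forall v, op P (fun x : inputs v => f (val x)) (f (out v)))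
    (e : edge T) (t : subtree e) :
    op P (fun z : st_pos t => f (st_col z)) (f e) :=
  match t with
  | SubLeaf e => oid (f e)
  | SubNode v s => ocomp (c := fun x z => f (st_col z)) (p v)
                     (fun x => st_op p (s x))
  end.

Lemma st_above (T : tree) (e : edge T) (t : subtree e) (z : st_pos t) :
  above e (st_col z).
Proof.
elim: t z => [{}e _|v s IH [x z]] /=; first exact: above_refl.
exact: above_below (inputsP x) (IH x z).
Qed.

Lemma st_col_inj (T : tree) (e : edge T) (t : subtree e) :
  injective (@st_col T e t).
Proof.
elim: t => [{}e [] []|v s IH [x z] [x' z']] //= E.
have xx' : x = x'.
  apply: val_inj; apply: siblings_disjoint (inputsP x) (inputsP x') _ _.
    exact: st_above z.
  by rewrite E; apply: st_above.
by subst x'; rewrite (IH x _ _ E).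
Qed.

Lemma subtree_case (T : tree) (e : edge T) (t : subtree e) :
  t = SubLeaf e \/
  exists v (ve : out v = e) (s : forall x : inputs v, subtree (val x)),
    t = eq_rect (out v) (@subtree T) (SubNode s) e ve.
Proof. by case: t => [{}e|v s]; [left | right; exists v, erefl, s]. Qed.

Lemma st_uniq (T : tree) (e : edge T) (t t' : subtree e) :
  (forall x, (exists z : st_pos t, st_col z = x) <->
             (exists z : st_pos t', st_col z = x)) -> t = t'.
Proof.
elim: t t' => [{}e|v s IH] t'; case: (subtree_case t').
- by move=> ->.
- move=> [v [ve [s]]]; subst e => /= -> im.
  have /im [[x z] /= xz] : exists z : st_pos (SubLeaf (out v)), st_col z = out v.
    by exists tt.
  by have := st_above z; rewrite xz above_outN // inputsP.
- move=> -> im.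
  have /im [[x z] /= xz] : exists z : st_pos (SubLeaf (out v)), st_col z = out v.
    by exists tt.
  by have := st_above z; rewrite xz above_outN // inputsP.
- move=> [v' [ve [s']]]; have vv' := out_inj ve; subst v'.
  rewrite (proof_irrelevance _ ve erefl) /= => -> im; congr SubNode.
  apply: functional_extensionality_dep => x; apply: IH => y.
  split=> -[z zy].
  + have /im [[x' z'] /= zy'] : exists z : st_pos (SubNode s), st_col z = y.
      by exists (existT _ x z).
    have xx' : x = x'; last by subst x'; exists z'.
    apply: val_inj; apply: siblings_disjoint (inputsP x) (inputsP x') _ _.
      exact: st_above z.
    by rewrite zy -zy'; apply: st_above.
  + have /im [[x' z'] /= zy'] : exists z : st_pos (SubNode s'), st_col z = y.
      by exists (existT _ x z).
    have xx' : x = x'; last by subst x'; exists z'.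
    apply: val_inj; apply: siblings_disjoint (inputsP x) (inputsP x') _ _.
      exact: st_above z.
    by rewrite zy -zy'; apply: st_above.
Qed.

Definition recol (T : tree) (P : operad) (f : edge T -> col P) (I : finType)
    (c c' : I -> edge T) (E : c' = c) (e : col P)
    (q : op P (fun i => f (c i)) e) : op P (fun i => f (c' i)) e :=
  eq_rect_r (fun b : I -> edge T => op P (fun i => f (b i)) e) q E.

(* q is the value on the operation (c, e) of the map given by f and p. *)
Definition free_graph (T : tree) (P : operad) (f : edge T -> col P)
    (p : forall v, op P (fun x : inputs v => f (val x)) (f (out v)))
    (I : finType) (c : I -> edge T) (e : edge T)
    (q : op P (fun i => f (c i)) (f e)) : Prop :=
  exists (t : subtree e) (h : st_pos t -> I) (bh : bijective h)
         (E : (fun z => c (h z)) = @st_col T e t),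
    q = oact (c := fun i => f (c i)) bh (recol E (st_op p t)).

Lemma free_graph_fun (T : tree) (P : operad) (f : edge T -> col P)
    (p : forall v, op P (fun x : inputs v => f (val x)) (f (out v)))
    (I : finType) (c : I -> edge T) (e : edge T)
    (q q' : op P (fun i => f (c i)) (f e)) :
  free_graph p q -> free_graph p q' -> q = q'.
Proof.
move=> [t [h [bh [E ->]]]] [t' [h' [bh' [E' ->]]]].
have [g hK gK] := bh; have [g' hK' gK'] := bh'.
have cE z : c (h z) = st_col z by rewrite -E.
have cE' z : c (h' z) = st_col z by rewrite -E'.
have ci : injective c.
  by move=> i j; rewrite -[i]gK -[j]gK !cE => /st_col_inj ->.
have tt' : t = t'.
  apply: st_uniq => x; split=> -[z <-].
    by exists (g' (h z)); rewrite -cE' gK' cE.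
  by exists (g (h' z)); rewrite -cE gK cE'.
subst t'; have hh' : h = h'.
  by apply: functional_extensionality => z; apply: ci; rewrite cE cE'.
subst h'; rewrite (proof_irrelevance _ bh' bh).
by rewrite (proof_irrelevance _ E' E).
Qed.

Lemma free_graph_id (T : tree) (P : operad) (f : edge T -> col P)
    (p : forall v, op P (fun x : inputs v => f (val x)) (f (out v)))
    (e : edge T) :
  free_graph p (c := fun _ : unit => e) (oid (f e)).
Proof.
have b : bijective (fun u : unit => u) by exists id.
exists (SubLeaf e), (fun u => u), b, erefl.
by rewrite oact_id.
Qed.

Lemma free_graph_vert (T : tree) (P : operad) (f : edge T -> col P)
    (p : forall v, op P (fun x : inputs v => f (val x)) (f (out v)))
    (v : vert T) :
  free_graph p (c := fun x : inputs v => val x) (p v).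
Proof.
exists (SubNode (fun x : inputs v => SubLeaf (val x))).
exists (fun x => tag x), (tag_unit_bij (inputs v)), erefl.
by rewrite /recol /eq_rect_r /= ocompo1.
Qed.

Lemma free_graph_act (T : tree) (P : operad) (f : edge T -> col P)
    (p : forall v, op P (fun x : inputs v => f (val x)) (f (out v)))
    (I J : finType) (g : I -> J) (bg : bijective g) (c : J -> edge T)
    (e : edge T) (q : op P (fun i => f (c (g i))) (f e)) :
  free_graph p (c := fun i => c (g i)) q ->
  free_graph p (c := c) (oact (c := fun j => f (c j)) bg q).
Proof.
move=> [t [h [bh [E ->]]]].
have bgh : bijective (fun z => g (h z)) := bij_comp bg bh.
exists t, (fun z => g (h z)), bgh, E.
by rewrite (oact_comp (c := fun j => f (c j)) bh bg bgh).
Qed.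

Lemma ocomp_recol (T : tree) (P : operad) (f : edge T -> col P)
    (J : finType) (I : J -> finType) (c c' : forall j, I j -> edge T)
    (E : forall j, c' j = c j) (d : J -> col P) (e : col P) (p : op P d e)
    (q : forall j, op P (fun i => f (c j i)) (d j))
    (E' : (fun x : {j : J & I j} => c' (tag x) (tagged x))
          = (fun x => c (tag x) (tagged x))) :
  ocomp (c := fun j i => f (c' j i)) p (fun j => recol (E j) (q j))
  = recol (I := {j : J & I j}) E'
      (ocomp (c := fun j i => f (c j i)) p q).
Proof.
have cc' : c' = c by apply: functional_extensionality_dep.
subst c'; rewrite (proof_irrelevance _ E' erefl) /recol /eq_rect_r /=.
congr ocomp; apply: functional_extensionality_dep => j.
by rewrite (proof_irrelevance _ (E j) erefl).
Qed.

Lemma free_graph_node (T : tree) (P : operad) (f : edge T -> col P)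
    (p : forall v, op P (fun x : inputs v => f (val x)) (f (out v)))
    (v : vert T) (I : inputs v -> finType) (c : forall x, I x -> edge T)
    (q : forall x, op P (fun i => f (c x i)) (f (val x))) :
  (forall x, free_graph p (q x)) ->
  free_graph p (c := fun y : {x : inputs v & I x} => c (tag y) (tagged y))
    (ocomp (c := fun x i => f (c x i)) (p v) q).
Proof.
move=> qG.
have [t tP] : exists t : forall x : inputs v, subtree (val x), forall x,
   exists (h : st_pos (t x) -> I x) (bh : bijective h)
     (E : (fun z => c x (h z)) = @st_col T (val x) (t x)),
    q x = oact (c := fun i => f (c x i)) bh (recol E (st_op p (t x))).
  exists (fun x => sval (constructive_indefinite_description _ (qG x))) => x.
  by case: constructive_indefinite_description.
have [h hP] : exists h : forall x, st_pos (t x) -> I x, forall x,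
   exists (bh : bijective (h x))
     (E : (fun z => c x (h x z)) = @st_col T (val x) (t x)),
    q x = oact (c := fun i => f (c x i)) bh (recol E (st_op p (t x))).
  exists (fun x => sval (constructive_indefinite_description _ (tP x))) => x.
  by case: constructive_indefinite_description.
have bh x : bijective (h x) by case: (hP x).
have E x : (fun z => c x (h x z)) = @st_col T (val x) (t x).
  by have [_ [Ex _]] := hP x.
have qE : q = fun x =>
    oact (c := fun i => f (c x i)) (bh x) (recol (E x) (st_op p (t x))).
  apply: functional_extensionality_dep => x; case: (hP x) => [b [Ex ->]].
  by rewrite (proof_irrelevance _ (bh x) b) (proof_irrelevance _ (E x) Ex).
have E' : (fun y : {x : inputs v & st_pos (t x)} =>
    c (tag y) (h (tag y) (tagged y))) = @st_col T _ (SubNode t).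
  by apply: functional_extensionality => -[x z] /=; rewrite -E.
exists (SubNode t), (fun y => Tagged I (h (tag y) (tagged y))).
exists (tagged_map_bij bh), E'; rewrite qE.
rewrite (ocomp_actr (c := fun x i => f (c x i)) bh _ _ (tagged_map_bij bh)).
congr oact.
exact: (@ocomp_recol T P f (inputs v) (fun x => st_pos (t x))
  (fun x => @st_col T _ (t x)) (fun x z => c x (h x z)) E).
Qed.

Record packed (T : tree) (P : operad) (f : edge T -> col P) (e : edge T) :=
  Packed {
    pk_I : finType;
    pk_c : pk_I -> edge T;
    pk_op : op P (fun i => f (pk_c i)) (f e) }.

Lemma oact_idE (P : operad) (I : finType) (g : I -> I) (bg : bijective g)
    (c : I -> col P) (e : col P) (H : c = (fun i => c (g i))) (q : op P c e) :
  (fun i => i) = g ->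
  oact (c := c) bg (eq_rect c (fun b => op P b e) q (fun i => c (g i)) H) = q.
Proof.
move=> gE; subst g; rewrite (proof_irrelevance _ H erefl) /=.
exact: oact_id.
Qed.

Lemma free_graph_unit (T : tree) (P : operad) (f : edge T -> col P)
    (p : forall v, op P (fun x : inputs v => f (val x)) (f (out v)))
    (e : edge T) (K : unit -> packed f e) :
  (forall u, free_graph p (pk_op (K u))) ->
  free_graph p
    (c := fun x : {u : unit & pk_I (K u)} => @pk_c _ _ _ _ (K (tag x)) (tagged x))
    (ocomp (c := fun u i => f (@pk_c _ _ _ _ (K u) i)) (oid (f e))
       (fun u => pk_op (K u))).
Proof.
have -> : K = (fun=> K tt) by apply: functional_extensionality => -[].
move: (K tt) => [I c q] /= /(_ tt).
set r := ocomp _ _ => qG.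
pose b0 (i : I) : {u : unit & I} := Tagged (fun _ : unit => I) (i := tt) i.
have bi : bijective b0.
  by exists (fun x : {u : unit & I} => tagged x) => // -[[] i].
suff -> : r = oact (J := {u : unit & I}) (c := fun x => f (c (tagged x))) bi q.
  exact (@free_graph_act T P f p I {u : unit & I} b0 bi
    (fun x => c (tagged x)) e q qG).
rewrite -[in RHS](ocomp1o q (tagged_unit_bij I)) -/r.
have bid : bijective (fun x : {u : unit & I} => b0 (tagged x)).
  by exists id => -[[] i].
rewrite -(oact_comp (J := I) (K := {u : unit & I})
  (c := fun x => f (c (tagged x))) (tagged_unit_bij I) bi bid).
apply: esym; apply: (@oact_idE P {u : unit & I} _ bid
  (fun x => f (c (tagged x))) (f e) erefl).
by apply: functional_extensionality => -[[] i].
Qed.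

Lemma free_graph_graft (T : tree) (P : operad) (f : edge T -> col P)
    (p : forall v, op P (fun x : inputs v => f (val x)) (f (out v)))
    (e : edge T) (t : subtree e) (I : st_pos t -> finType)
    (c : forall z, I z -> edge T)
    (q : forall z, op P (fun i => f (c z i)) (f (st_col z))) :
  (forall z, free_graph p (q z)) ->
  free_graph p (c := fun x : {z : st_pos t & I z} => c (tag x) (tagged x))
    (ocomp (c := fun z i => f (c z i)) (st_op p t) q).
Proof.
elim: t I c q => [{}e|v s IH] I c q qG.
  exact: (@free_graph_unit T P f p e (fun u => Packed (@q u))).
rewrite /= -(ocompA (c := fun x z => f (st_col z)) (b := fun z i => f (c z i))
  (p v) (fun x => st_op p (s x)) q (@tag_assoc_bij _ _ I)).
refine (@free_graph_act T P f p _ _ _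
  (@tag_assoc_bij (inputs v) (fun x => st_pos (s x)) I)
  (fun x => c (tag x) (tagged x)) (out v) _ _).
apply: (@free_graph_node T P f p v
  (fun x => {z : st_pos (s x) & I (existT _ x z)})
  (fun x y => c (existT _ x (tag y)) (tagged y))) => x.
exact: (IH x (fun z => I (existT _ x z)) (fun z => c (existT _ x z))
  (fun z => q (existT _ x z))).
Qed.

Lemma free_graph_graft_recol (T : tree) (P : operad) (f : edge T -> col P)
    (p : forall v, op P (fun x : inputs v => f (val x)) (f (out v)))
    (e : edge T) (t : subtree e) (I : st_pos t -> finType)
    (c : forall z, I z -> edge T) (g : st_pos t -> edge T)
    (E : g = @st_col T e t) (q : forall z, op P (fun i => f (c z i)) (f (g z))) :
  (forall z, free_graph p (q z)) ->
  free_graph p (c := fun x : {z : st_pos t & I z} => c (tag x) (tagged x))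
    (ocomp (c := fun z i => f (c z i)) (d := fun z => f (g z))
      (recol E (st_op p t)) q).
Proof. by subst g; apply: free_graph_graft. Qed.

Lemma free_graph_comp (T : tree) (P : operad) (f : edge T -> col P)
    (p : forall v, op P (fun x : inputs v => f (val x)) (f (out v)))
    (J : finType) (I : J -> finType) (c : forall j, I j -> edge T)
    (d : J -> edge T) (e : edge T) (q : op P (fun j => f (d j)) (f e))
    (r : forall j, op P (fun i => f (c j i)) (f (d j))) :
  free_graph p q -> (forall j, free_graph p (r j)) ->
  free_graph p (c := fun x : {j : J & I j} => c (tag x) (tagged x))
    (ocomp (c := fun j i => f (c j i)) q r).
Proof.
move=> [t [h [bh [E ->]]]] rG.
rewrite (ocomp_actl bh (c := fun j i => f (c j i)) (d := fun j => f (d j))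
  _ _ (tag_map_bij I bh)).
refine (@free_graph_act T P f p _ _ _ (tag_map_bij I bh)
  (fun x => c (tag x) (tagged x)) e _ _).
exact (@free_graph_graft_recol T P f p e t (fun z => I (h z))
  (fun z => c (h z)) (fun z => d (h z)) E (fun z => r (h z))
  (fun z => rG (h z))).
Qed.

Lemma free_graph_ex (T : tree) (P : operad) (f : edge T -> col P)
    (p : forall v, op P (fun x : inputs v => f (val x)) (f (out v)))
    (I : finType) (c : I -> edge T) (e : edge T) :
  Omega_op c e -> exists q : op P (fun i => f (c i)) (f e), free_graph p q.
Proof.
elim=> [{}e|v|J K b d {}e _ [q qG] _ IH|J K g d {}e bg _ [q qG]].
- by exists (oid (f e)); apply: free_graph_id.
- by exists (p v); apply: free_graph_vert.
- exists (ocomp (c := fun j k => f (b j k)) q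
    (fun j => sval (constructive_indefinite_description _ (IH j)))).
  apply: (free_graph_comp (c := b)) => // j.
  by case: constructive_indefinite_description.
- exists (oact (c := fun j => f (d j)) bg q).
  exact: (@free_graph_act T P f p J K g bg d e q).
Qed.

Definition free_val (T : tree) (P : operad) (f : edge T -> col P)
    (p : forall v, op P (fun x : inputs v => f (val x)) (f (out v)))
    (I : finType) (c : I -> edge T) (e : edge T)
    (o : op (Omega_operad T) c e) : op P (fun i => f (c i)) (f e) :=
  sval (constructive_indefinite_description _ (free_graph_ex p o)).

Lemma free_valP (T : tree) (P : operad) (f : edge T -> col P)
    (p : forall v, op P (fun x : inputs v => f (val x)) (f (out v)))
    (I : finType) (c : I -> edge T) (e : edge T)
    (o : op (Omega_operad T) c e) : free_graph p (free_val p o).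
Proof. by rewrite /free_val; case: constructive_indefinite_description. Qed.

Lemma Omega_free (T : tree) (P : operad) (f : edge T -> col P)
    (p : forall v, op P (fun x : inputs v => f (val x)) (f (out v))) :
  exists! phi : (forall (I : finType) (c : I -> edge T) (e : edge T),
      op (Omega_operad T) c e -> op P (fun i => f (c i)) (f e)),
    @is_operad_map (Omega_operad T) P f phi /\
    forall v, phi (inputs v) (fun x => val x) (out v) (Omega_vert v) = p v.
Proof.
exists (free_val p); split.
  split; last first.
    move=> v; apply: free_graph_fun (free_graph_vert p v).
    exact: free_valP.
  split.
  - move=> e; apply: free_graph_fun (free_graph_id p e).
    exact: free_valP.
  - move=> J I c d e q r; apply: free_graph_fun; first exact: free_valP.
    by apply: (free_graph_comp (c := c) (d := d)) => [|j]; apply: free_valP.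
  - move=> I J h bh c e q; apply: free_graph_fun; first exact: free_valP.
    by apply: (@free_graph_act T P f p I J h bh c e); apply: free_valP.
move=> psi [[pid pcomp pact] pvert].
apply: functional_extensionality_dep => I.
apply: functional_extensionality_dep => c.
apply: functional_extensionality_dep => e.
apply: functional_extensionality => o.
apply: (free_graph_fun (free_valP p o)).
suff: forall o' : @Omega_op T I c e, free_graph p (psi I c e o') by apply.
elim: {1}o => {I c e o} [e|v|J I c d e o IH o' IH'|I J h c e bh o IH] w.
- rewrite (proof_irrelevance _ w (Omega_id e)).
  by rewrite [psi _ _ _ _]pid; apply: free_graph_id.
- rewrite (proof_irrelevance _ w (Omega_vert v)) pvert.
  exact: free_graph_vert.
- rewrite (proof_irrelevance _ w (Omega_comp o o')).
  rewrite [psi _ _ _ _](pcomp J I c d e o o').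
  by apply: (free_graph_comp (c := c) (d := d)) => [|j]; [apply: IH | apply: IH'].
- rewrite (proof_irrelevance _ w (Omega_act bh o)).
  rewrite [psi _ _ _ _](pact I J h bh c e o).
  exact: (@free_graph_act T P f p I J h bh c e).
Qed.

Definition Omega : category :=
  @Category tree (fun S T => operad_map (Omega_operad S) (Omega_operad T))
    (fun T => operad_id (Omega_operad T))
    (fun R S T g f => operad_cmp g f)
    (fun S T f => operad_cmp1f f) (fun S T f => operad_cmpf1 f)
    (fun Q R S T h g f => operad_cmpA h g f).

Lemma Omega_map_op (S T : tree) (f : edge S -> edge T) :
  (forall v : vert S,
     @Omega_op T (inputs v) (fun x => f (val x)) (f (out v))) ->
  forall (I : finType) (c : I -> edge S) (e : edge S),
    Omega_op c e -> Omega_op (fun i => f (c i)) (f e).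
Proof.
move=> fv I c e; elim=> [{}e|v|J K b d {}e _ IH _ IH'|J K g d {}e bg _ IH].
- exact: Omega_id.
- exact: fv.
- exact: Omega_comp (fun j k => f (b j k)) (fun j => f (d j)) (f e) IH IH'.
- exact: Omega_act bg IH.
Qed.

Lemma Omega_map_subproof (S T : tree) (f : edge S -> edge T)
  (fv : forall v : vert S,
     @Omega_op T (inputs v) (fun x => f (val x)) (f (out v))) :
  @is_operad_map (Omega_operad S) (Omega_operad T) f (Omega_map_op fv).
Proof. by split=> *; exact: (proof_irrelevance (Omega_op _ _)). Qed.

Definition Omega_map (S T : tree) (f : edge S -> edge T)
    (fv : forall v : vert S,
       @Omega_op T (inputs v) (fun x => f (val x)) (f (out v))) :
  @hom Omega S T := OperadMap (Omega_map_subproof fv).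

Lemma subtree_connected (T : tree) (E : finType) (i : E -> edge T)
    (d : E -> E) (r : E) :
  (forall x, x <> r -> above (i (d x)) (i x) /\ i (d x) <> i x) ->
  forall x, fconnect d x r.
Proof.
move=> dP x; have [n] := ubnP #|[set y | above y (i x)]|.
elim: n x => // n IH x le_n; case: (eqVneq x r) => [->|/eqP xr].
  exact: connect0.
have [up ne] := dP x xr; apply: connect_trans (fconnect1 d x) (IH _ _).
rewrite ltnS in le_n; apply: leq_trans le_n; apply: proper_card.
apply/properP; split.
  by apply/subsetP => y; rewrite !inE => /above_trans; apply.
exists (i x); first by rewrite inE above_refl.
by rewrite inE; apply/negP => dn; apply: ne; apply: above_anti.
Qed.

(* The inner face T/e: the vertex on top of e is merged into the vertex below
   e, so that its inputs become inputs of the latter. *)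

Definition inner_edge_set (T : tree) (e : inner_edge T) : finType :=
  {x : edge T | x != val e}.

Definition inner_vert_set (T : tree) (e : inner_edge T) : finType :=
  {v : vert T | out v != val e}.

Definition inner_out (T : tree) (e : inner_edge T) (v : inner_vert_set e) :
  inner_edge_set e := exist _ (out (val v)) (valP v).

Definition inner_below (T : tree) (e : inner_edge T) (x : inner_edge_set e) :
    option (inner_vert_set e) :=
  obind insub (if down (val x) == val e then below (val e)
               else below (val x)).

Lemma innerP (T : tree) (e : edge T) : inner e ->
  exists v w, [/\ below e = Some v, out w = e & v != w].
Proof.
case/andP=> /leafPn [w we]; case be: (below e) => [v|//] _; exists v, w.
split=> //; apply/eqP => vw; have := below_outN w.
by rewrite we be vw eqxx.
Qed.

Lemma inner_rootN (T : tree) (e : edge T) : inner e -> root != e.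
Proof. by case/andP=> _; rewrite isSome_below eq_sym. Qed.

Definition inner_root (T : tree) (e : inner_edge T) : inner_edge_set e :=
  exist _ root (inner_rootN (valP e)).

Lemma inner_out_inj (T : tree) (e : inner_edge T) :
  injective (@inner_out T e).
Proof. by move=> v w /(congr1 val) /= /out_inj /val_inj. Qed.

Lemma inner_belowE (T : tree) (e : inner_edge T) (x : inner_edge_set e) :
  omap val (inner_below x) =
  if down (val x) == val e then below (val e) else below (val x).
Proof.
have [v [w [be we vw]]] := innerP (valP e).
rewrite /inner_below; case: ifP => [_|/negbT].
  by rewrite be /= insubT // -we; apply: contraNneq vw => /out_inj ->.
by case bx: (below (val x)) => [u|//]; rewrite (down_below bx) /= => uP; rewrite insubT.
Qed.

Lemma inner_below_root (T : tree) (e : inner_edge T) (x : inner_edge_set e) :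
  (inner_below x == None) = (x == inner_root e).
Proof.
rewrite -(inj_eq val_inj) /= -below_root.
have := inner_belowE x; case: ifP => [/eqP dx|_].
  have [v [w [be _ _]]] := innerP (valP e).
  rewrite be; case: (inner_below x) => //= u _.
  case bx: (below (val x)) => [//|].
  have /eqP[] : val x != val e := valP x.
  by move: dx; rewrite /down /tree_down bx.
by case: (inner_below x) => [u|] /= <-.
Qed.

Lemma inner_down (T : tree) (e : inner_edge T) (x : inner_edge_set e) :
  val (tree_down (@inner_out T e) (@inner_below T e) x) =
  if down (val x) == val e then down (val e) else down (val x).
Proof.
rewrite {1}/tree_down; have := inner_belowE x.
case: ifP => [/eqP dx|_]; case: (inner_below x) => [u|] /= bE.
- by rewrite (down_below (esym bE)).
- by have /innerP [v [w [be _ _]]] := valP e; rewrite /= -bE in be.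
- by rewrite (down_below (esym bE)).
- by rewrite /down /tree_down -bE.
Qed.

Lemma above_down (T : tree) (x : edge T) :
  x <> root -> above (down x) x /\ down x <> x.
Proof.
move=> xr; split; first exact: above_iter 1 x.
by move=> /(@down_cycle T x 0).
Qed.

Lemma inner_down_root (T : tree) (e : inner_edge T) (x : inner_edge_set e) :
  fconnect (tree_down (@inner_out T e) (@inner_below T e)) x (inner_root e).
Proof.
move: x; apply: (subtree_connected (i := fun x => val x)) => x xr.
have xr' : val x <> root by move=> xE; apply: xr; apply: val_inj.
have [up ne] := above_down xr'; rewrite inner_down.
case: ifP => [/eqP dx|//].
have er : val e <> root by apply/eqP; rewrite eq_sym inner_rootN // (valP e).
have [up' ne'] := above_down er; rewrite dx in up ne.
split; first exact: above_trans up' up.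
by move=> dE; rewrite dE in up'; apply: ne; apply: above_anti.
Qed.

Definition inner_face (T : tree) (e : inner_edge T) : tree :=
  Tree (@inner_out_inj T e) (@inner_below_root T e) (@inner_down_root T e).

Lemma inner_face_vert (T : tree) (e : inner_edge T)
    (v : vert (inner_face e)) :
  @Omega_op T (inputs v) (fun x => val (val x)) (val (out v)).
Proof.
pose A (x : inputs (val v)) : {set edge T} :=
  if val x == val e then [set y | (down y == val e) && (y != val e)]
  else [set val x].
have [u [w [be we uw]]] := innerP (valP e).
have wP y : (down y == val e) && (y != val e) = (below y == Some w).
  case by_: (below y) => [u'|].
    rewrite (down_below by_) -we (inj_eq (@out_inj T)) [RHS](inj_eq Some_inj).
    case: eqP => //= u'w; subst u'; apply/eqP => yE.
    by have := below_outN w; rewrite -yE by_ eqxx.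
  by rewrite /down /tree_down by_; case: eqP.
apply: (Omega_graft (A := A) (Omega_vert (val v))) => [x|x x' y||y].
- rewrite /A; case: eqP => [->|_]; last exact: Omega_set1.
  rewrite -we /Omega_set; apply: Omega_op_relabel (Omega_vert w) => //=.
  + exact: val_inj.
  + exact: val_inj.
  + case=> y /= yw; have yA : y \in [set y | (down y == out w) && (y != out w)].
      by rewrite inE we wP.
    by exists (exist _ y yA).
  + case=> y yA /=; have yw : below y == Some w.
      by rewrite inE we wP in yA.
    by exists (exist _ y yw).
- have xv := inputsP x; have xv' := inputsP x'.
  have wv : val x = val e -> sval v <> w.
    move=> xe vw; move: uw; rewrite -vw.
    by rewrite xe be in xv; case: xv => ->; rewrite eqxx.
  have wv' : val x' = val e -> sval v <> w.
    move=> xe vw; move: uw; rewrite -vw.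
    by rewrite xe be in xv'; case: xv' => ->; rewrite eqxx.
  rewrite /A; case: eqP => xe; case: eqP => xe'; rewrite !inE ?wP.
  + by move=> _ _; apply: val_inj; rewrite xe xe'.
  + move=> /eqP yw /eqP yx; rewrite yx xv' in yw; case: yw => yw.
    by case: (wv xe).
  + move=> /eqP yx /eqP yw; rewrite yx xv in yw; case: yw => yw.
    by case: (wv' xe').
  + by move=> /eqP -> /eqP /val_inj.
- by move=> x y /val_inj /val_inj.
- split=> [[[x xv] /= <-]|[x]].
  + have xv_ : inner_below x = Some v by apply/eqP.
    have := inner_belowE x; rewrite xv_ /=; case: ifP => [dx|nd] bv.
    * have ev : below (val e) == Some (val v) by rewrite -bv.
      exists (exist _ (val e) ev); rewrite /A /= eqxx inE dx; exact: valP x.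
    * have xv' : below (val x) == Some (val v) by rewrite -bv.
      exists (exist _ (val x) xv'); rewrite /A /= ifN ?inE //; exact: valP x.
  + have xv := inputsP x; rewrite /A; case: eqP => [xe|/eqP xe].
      rewrite inE => /andP[dy ye].
      pose y' : inner_edge_set e := exist _ y ye.
      have yv : @below (inner_face e) y' == Some v.
        apply/eqP/(inj_omap val_inj); rewrite [LHS]inner_belowE /= dy.
        exact: etrans (congr1 below (esym xe)) xv.
      by exists (exist _ y' yv).
    rewrite inE => /eqP ->.
    pose y' : inner_edge_set e := exist _ (val x) xe.
    have yv : @below (inner_face e) y' == Some v.
      apply/eqP/(inj_omap val_inj); rewrite [LHS]inner_belowE /=.
      by rewrite (down_below xv) ifN //; apply: (valP v).
    by exists (exist _ y' yv).
Qed.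

Definition inner_face_map (T : tree) (e : inner_edge T) :
  @hom Omega (inner_face e) T :=
  @Omega_map (inner_face e) T (fun x => val x) (@inner_face_vert T e).

Definition attached (T : tree) (v : vert T) (x : edge T) : bool :=
  (x == out v) || (below x == Some v).

Definition outer_vertex (T : tree) : finType :=
  {v : vert T | #|[set x | attached v x && inner x]| == 1}.

Definition outer_edge_set (T : tree) (v : outer_vertex T) : finType :=
  {x : edge T | ~~ (attached (val v) x && ~~ inner x)}.

Definition outer_vert_set (T : tree) (v : outer_vertex T) : finType :=
  {u : vert T | u != val v}.

Lemma outer_out_subproof (T : tree) (v : outer_vertex T)
    (u : outer_vert_set v) :
  ~~ (attached (val v) (out (val u)) && ~~ inner (out (val u))).
Proof.
have /= uv := valP u; rewrite /attached (inj_eq (@out_inj T)) (negbTE uv) /=.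
case: eqP => //= bu; rewrite negbK /inner bu andbT.
by apply/leafPn; exists (val u).
Qed.

Definition outer_out (T : tree) (v : outer_vertex T) (u : outer_vert_set v) :
    outer_edge_set v :=
  exist _ (out (val u)) (outer_out_subproof u).

Definition outer_below (T : tree) (v : outer_vertex T)
    (x : outer_edge_set v) : option (outer_vert_set v) :=
  obind insub (below (val x)).

Lemma attached_inner_exists (T : tree) (v : outer_vertex T) :
  exists x : outer_edge_set v, attached (val v) (val x) && inner (val x).
Proof.
have /cards1P [x xE] : #|[set x | attached (val v) x && inner x]| == 1
  := valP v.
have : x \in [set x | attached (val v) x && inner x] by rewrite xE inE.
rewrite inE => xP; have xk : ~~ (attached (val v) x && ~~ inner x).
  by case/andP: xP => -> ->.
by exists (exist _ x xk).
Qed.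

(* The inner edge attached to v, as an edge of T/v. *)
Definition attached_inner (T : tree) (v : outer_vertex T) : outer_edge_set v :=
  xchoose (attached_inner_exists v).

(* The root of T if it is not deleted, the inner edge attached to v if it
   is. *)
Definition outer_root (T : tree) (v : outer_vertex T) : outer_edge_set v :=
  insubd (attached_inner v) (@root T).

Lemma attached_innerP (T : tree) (v : outer_vertex T) (x : outer_edge_set v) :
  (attached (val v) (val x) && inner (val x)) = (x == attached_inner v).
Proof.
have /cards1P [y yE] : #|[set x | attached (val v) x && inner x]| == 1
  := valP v.
have aP := xchooseP (attached_inner_exists v).
have inP (z : edge T) : (attached (val v) z && inner z) = (z == y).
  by move/setP/(_ z): yE; rewrite !inE.
rewrite inP -(inj_eq val_inj); congr (_ == _); apply/eqP.
by rewrite eq_sym -inP.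
Qed.

Lemma outer_belowE (T : tree) (v : outer_vertex T) (x : outer_edge_set v) :
  omap val (outer_below x) =
  if below (val x) == Some (val v) then None else below (val x).
Proof.
rewrite /outer_below; case: (below (val x)) => //= u.
rewrite (inj_eq Some_inj); case: ifPn => [/eqP ->|uv].
  by rewrite insubF ?eqxx.
by rewrite insubT.
Qed.

Lemma root_innerN (T : tree) : inner (@root T) = false.
Proof. by rewrite /inner isSome_below eqxx andbF. Qed.

Lemma below_rootE (T : tree) : below (@root T) = None.
Proof. by apply/eqP; rewrite below_root. Qed.

Lemma outer_below_root (T : tree) (v : outer_vertex T)
    (x : outer_edge_set v) :
  (outer_below x == None) = (x == outer_root v).
Proof.
have -> : (outer_below x == None) = (omap val (outer_below x) == None).
  by case: outer_below.
rewrite outer_belowE; case: (below (val x) =P Some (val v)) => bx.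
- have ai : attached (val v) (val x) && inner (val x).
    have xk : ~~ (attached (val v) (val x) && ~~ inner (val x)) := valP x.
    by move: xk; rewrite /attached bx eqxx orbT /= negbK.
  have xE : x = attached_inner v by apply/eqP; rewrite -attached_innerP.
  suff rv : ~~ ~~ (attached (val v) root && ~~ inner (@root T)).
    by rewrite /outer_root /insubd insubF ?(negbTE rv) //= -xE !eqxx.
  rewrite negbK root_innerN andbT /attached; apply/orP; left; rewrite eq_sym.
  have ok : ~~ (attached (val v) (out (val v)) && ~~ inner (out (val v))) ->
      False.
    move=> ok; pose y : outer_edge_set v := exist _ (out (val v)) ok.
    have yE : y == attached_inner v.
      rewrite -attached_innerP /= /attached eqxx /=.
      by move: (ok); rewrite /attached eqxx /= negbK.
    have := below_outN (val v); rewrite -[out _]/(val y) (eqP yE) -xE.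
    by rewrite bx eqxx.
  have : ~~ inner (out (val v)).
    by apply/negP => iv; apply: ok; rewrite iv andbF.
  rewrite /inner negb_and negbK isSome_below negbK => /orP[|//].
  have : ~~ is_leaf (out (val v)) by apply/leafPn; exists (val v).
  by move=> /negbTE ->.
- rewrite below_root -(inj_eq val_inj) /outer_root /insubd.
  case: insubP => [y _ -> //|]; rewrite negbK => /andP[rv _] /=.
  rewrite /attached below_rootE orbF in rv.
  have ai := attached_innerP (attached_inner v); rewrite eqxx in ai.
  apply/eqP/eqP => [xr|/val_inj xE].
    have xk : ~~ (attached (val v) (val x) && ~~ inner (val x)) := valP x.
    by move: xk; rewrite (xr : val x = root) /attached rv root_innerN.
  move: ai; rewrite -xE /attached; move/eqP/negbTE: bx => ->.
  rewrite orbF => /andP[/eqP xv _].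
  exact: etrans xv (esym (eqP rv)).
Qed.

Lemma outer_out_inj (T : tree) (v : outer_vertex T) :
  injective (@outer_out T v).
Proof. by move=> u w /(congr1 val) /= /out_inj /val_inj. Qed.

Lemma outer_down_root (T : tree) (v : outer_vertex T) (x : outer_edge_set v) :
  fconnect (tree_down (@outer_out T v) (@outer_below T v)) x (outer_root v).
Proof.
move: x; apply: (subtree_connected (i := fun x => val x)) => x xr.
have : outer_below x != None by rewrite outer_below_root; apply/eqP.
have := outer_belowE x; rewrite /tree_down.
case: (outer_below x) => [u|//] /=; case: ifP => // _ bx _.
rewrite -(down_below (esym bx)); apply: above_down => rx.
by rewrite rx below_rootE in bx.
Qed.

Definition outer_face (T : tree) (v : outer_vertex T) : tree :=
  Tree (@outer_out_inj T v) (@outer_below_root T v) (@outer_down_root T v).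

Lemma outer_face_vert (T : tree) (v : outer_vertex T)
    (u : vert (outer_face v)) :
  @Omega_op T (inputs u) (fun x => val (val x)) (val (out u)).
Proof.
have uv : val u != val v := valP u.
apply: Omega_op_relabel (Omega_vert (val u)) => /=.
- exact: val_inj.
- by move=> x y /val_inj /val_inj.
- move=> x; have bx := inputsP x.
  have xk : ~~ (attached (val v) (val x) && ~~ inner (val x)).
    rewrite /attached bx (inj_eq Some_inj) (negbTE uv) orbF.
    apply/negP => /andP[/eqP xE]; rewrite /inner bx andbT => /negP[].
    by apply/leafPn; exists (val v).
  pose x' : outer_edge_set v := exist _ (val x) xk.
  have xu : @below (outer_face v) x' == Some u.
    apply/eqP/(inj_omap val_inj); rewrite [LHS]outer_belowE /= bx.
    by rewrite (inj_eq Some_inj) ifN.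
  by exists (exist _ x' xu).
- case=> x /= xu; have xu' : outer_below x = Some u by apply/eqP.
  have := outer_belowE x; rewrite xu' /=; case: ifP => // _ /esym/eqP bx.
  by exists (exist _ (val x) bx).
Qed.

Definition outer_face_map (T : tree) (v : outer_vertex T) :
  @hom Omega (outer_face v) T :=
  @Omega_map (outer_face v) T (fun x => val x) (@outer_face_vert T v).

Definition void_edge (v : void) : unit := match v with end.

Lemma void_edge_inj : injective void_edge. Proof. by case. Qed.

Lemma eta_below_root (x : unit) : ((None : option void) == None) = (x == tt).
Proof. by case: x. Qed.

Lemma eta_down_root (x : unit) :
  fconnect (tree_down void_edge (fun=> None)) x tt.
Proof. by case: x; apply: connect0. Qed.

Definition eta : tree := Tree void_edge_inj eta_below_root eta_down_root.

Lemma eta_vert (T : tree) (x : edge T) (v : vert eta) :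
  @Omega_op T (inputs v) (fun=> x) x.
Proof. by case: v. Qed.

Definition edge_map (T : tree) (x : edge T) : @hom Omega eta T :=
  @Omega_map eta T (fun=> x) (eta_vert x).

(* The third kind only exists when T has exactly one vertex. *)
Inductive face (T : tree) : Type :=
| InnerFace of inner_edge T
| OuterFace of outer_vertex T
| EdgeFace of #|vert T| = 1 & edge T.

Definition face_tree (T : tree) (f : face T) : tree :=
  match f with
  | InnerFace e => inner_face e
  | OuterFace v => outer_face v
  | EdgeFace _ _ => eta
  end.

Definition face_map (T : tree) (f : face T) : @hom Omega (face_tree f) T :=
  match f with
  | InnerFace e => inner_face_map e
  | OuterFace v => outer_face_map v
  | EdgeFace _ x => edge_map x
  end.

Inductive face_mono : forall S T : tree, @hom Omega S T -> Prop :=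
| mono_face (T : tree) (f : face T) : face_mono (face_map f)
| mono_iso (S T : tree) (f : @hom Omega S T) : is_iso f -> face_mono f
| mono_cmp (R S T : tree) (g : @hom Omega S T) (f : @hom Omega R S) :
    face_mono g -> face_mono f -> face_mono (g \oc f).

Definition dset : Type := presheaf Omega.

Definition representable (T : tree) : dset := yoneda (T : Omega).

Definition in_horn (T : tree) (e : inner_edge T) (R : Omega)
    (r : @hom Omega R T) : Prop :=
  exists (f : face T) (s : @hom Omega R (face_tree f)),
    f <> InnerFace e /\ r = face_map f \oc s.

Lemma in_horn_cmp (T : tree) (e : inner_edge T) (Q R : Omega)
    (q : @hom Omega Q R) (r : @hom Omega R T) :
  in_horn e r -> in_horn e (r \oc q).
Proof.
by case=> f [s [fe ->]]; exists f, (s \oc q); split=> //; rewrite cmpA.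
Qed.

Lemma sig_eq (A : Type) (P : A -> Prop) (x y : {a | P a}) :
  sval x = sval y -> x = y.
Proof.
case: x y => [x xP] [y yP] /= xy; subst y.
by congr exist; apply: proof_irrelevance.
Qed.

Definition horn_map (T : tree) (e : inner_edge T) (Q R : Omega)
    (q : hom Q R) (r : {r : @hom Omega R T | in_horn e r}) :
  {r : @hom Omega Q T | in_horn e r} :=
  exist _ (sval r \oc q) (in_horn_cmp q (svalP r)).

Lemma horn_map_id (T : tree) (e : inner_edge T) (R : Omega)
  (r : {r : @hom Omega R T | in_horn e r}) : horn_map (idc R) r = r.
Proof. by apply: sig_eq; apply: cmpc1. Qed.

Lemma horn_map_cmp (T : tree) (e : inner_edge T) (P Q R : Omega)
    (q : hom Q R) (p : hom P Q) (r : {r : @hom Omega R T | in_horn e r}) :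
  horn_map (q \oc p) r = horn_map p (horn_map q r).
Proof. by apply: sig_eq; apply: cmpA. Qed.

(* The union of the images of all faces of T except the one at e. *)
Definition inner_horn (T : tree) (e : inner_edge T) : dset :=
  @Presheaf Omega (fun R => {r : @hom Omega R T | in_horn e r})
    (@horn_map T e) (@horn_map_id T e) (@horn_map_cmp T e).

Lemma horn_incl_nat (T : tree) (e : inner_edge T) (Q R : Omega)
    (q : hom Q R) (r : inner_horn e R) :
  sval (pmap (inner_horn e) q r) = pmap (representable T) q (sval r).
Proof. by []. Qed.

Definition horn_incl (T : tree) (e : inner_edge T) :
    nattrans (inner_horn e) (representable T) :=
  @NatTrans Omega (inner_horn e) (representable T) (fun R r => sval r)
    (@horn_incl_nat T e).

Definition horn_restriction (K : dset) (T : tree) (e : inner_edge T)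
    (x : nattrans (representable T) K) : nattrans (inner_horn e) K :=
  nat_cmp x (horn_incl e).

Definition surjective (A B : Type) (f : A -> B) : Prop :=
  forall b, exists a, f a = b.

Definition inner_Kan (K : dset) : Prop :=
  forall (T : tree) (e : inner_edge T), surjective (@horn_restriction K T e).

Definition strict_inner_Kan (K : dset) : Prop :=
  forall (T : tree) (e : inner_edge T),
    injective (@horn_restriction K T e) /\
    surjective (@horn_restriction K T e).

Definition nerve (P : operad) : dset :=
  @Presheaf Omega (fun T => operad_map (Omega_operad T) P)
    (fun R T r t => operad_cmp t r)
    (fun T t => operad_cmpf1 t)
    (fun Q R T r q t => operad_cmpA t r q).

(* A product is chosen for every family of objects indexed by a finite type;
   on the type 'I_n this is the n-fold product s_1 x ... x s_n. *)
Record cartesian := Cartesian {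
  ccat :> category;
  cprod : forall I : finType, (I -> ccat) -> ccat;
  cproj : forall (I : finType) (s : I -> ccat) (i : I), hom (cprod s) (s i);
  cpair : forall (I : finType) (s : I -> ccat) (a : ccat),
    (forall i, hom a (s i)) -> hom a (cprod s);
  cproj_pair : forall (I : finType) (s : I -> ccat) (a : ccat)
      (f : forall i, hom a (s i)) (i : I),
    cproj s i \oc cpair f = f i;
  cpair_uniq : forall (I : finType) (s : I -> ccat) (a : ccat)
      (f g : hom a (cprod s)),
    (forall i, cproj s i \oc f = cproj s i \oc g) -> f = g }.

Arguments cprod {_ I} s.
Arguments cproj {_ I} s i.
Arguments cpair {_ I s a} f.

Definition cart_act (S : cartesian) (I J : finType) (f : I -> J)
    (bf : bijective f) (c : J -> S) (e : S)
    (p : hom (cprod (fun i => c (f i))) e) : hom (cprod c) e :=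
  p \oc cpair (fun i => cproj c (f i)).

Definition cart_comp (S : cartesian) (J : finType) (I : J -> finType)
    (c : forall j, I j -> S) (d : J -> S) (e : S)
    (p : hom (cprod d) e) (q : forall j, hom (cprod (c j)) (d j)) :
    hom (cprod (fun x : {j : J & I j} => c (tag x) (tagged x))) e :=
  p \oc cpair (fun j => q j \oc cpair (fun i =>
    cproj (fun x : {j : J & I j} => c (tag x) (tagged x)) (Tagged I i))).

Lemma cpair_cmp (S : cartesian) (I : finType) (s : I -> S) (a b : S)
    (f : forall i, hom b (s i)) (g : hom a b) :
  cpair f \oc g = cpair (fun i => f i \oc g).
Proof. by apply: cpair_uniq => i; rewrite cmpA !cproj_pair. Qed.

Lemma cpair_proj (S : cartesian) (I : finType) (s : I -> S) :
  cpair (cproj s) = idc (cprod s).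
Proof. by apply: cpair_uniq => i; rewrite cproj_pair cmpc1. Qed.

Lemma cpair_ext (S : cartesian) (I : finType) (s : I -> S) (a : S)
    (f g : forall i, hom a (s i)) :
  (forall i, f i = g i) -> cpair f = cpair g.
Proof. by move=> fg; apply: cpair_uniq => i; rewrite !cproj_pair. Qed.

Lemma cproj_act (S : cartesian) (I J : finType) (f : I -> J) (c : J -> S)
    (i : I) :
  cproj (fun i => c (f i)) i \oc cpair (fun i => cproj c (f i))
  = cproj c (f i).
Proof. exact: cproj_pair. Qed.

Lemma cart_act_id (S : cartesian) (I : finType)
    (bij : bijective (fun i : I => i)) (c : I -> S) (e : S)
    (p : hom (cprod c) e) :
  cart_act bij p = p.
Proof. by rewrite /cart_act (cpair_proj c) cmpc1. Qed.

Lemma cart_act_comp (S : cartesian) (I J K : finType) (f : I -> J)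
    (g : J -> K) (bf : bijective f) (bg : bijective g)
    (bgf : bijective (fun i => g (f i))) (c : K -> S) (e : S)
    (p : hom (cprod (fun i => c (g (f i)))) e) :
  cart_act bgf p = cart_act bg (cart_act bf p).
Proof.
rewrite /cart_act -cmpA cpair_cmp.
by congr cmp; apply: cpair_ext => i; rewrite cproj_pair.
Qed.

Lemma cart_comp1o (S : cartesian) (I : finType) (c : I -> S) (e : S)
    (p : hom (cprod c) e)
    (bij : bijective (fun x : {u : unit & I} => tagged x)) :
  cart_act (c := c) bij (cart_comp (cproj (fun=> e) tt) (fun=> p)) = p.
Proof.
rewrite /cart_act /cart_comp cproj_pair -cmpA cpair_cmp.
rewrite -[RHS]cmpc1 -cpair_proj; congr cmp; apply: cpair_ext => i.
exact (@cproj_act S {u : unit & I} I (fun x => tagged x) c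
  (Tagged (fun=> I) i)).
Qed.

Lemma cart_compo1 (S : cartesian) (I : finType) (c : I -> S) (e : S)
    (p : hom (cprod c) e)
    (bij : bijective (fun x : {i : I & unit} => tag x)) :
  cart_act (c := c) bij (cart_comp p (fun i => cproj (fun=> c i) tt)) = p.
Proof.
rewrite /cart_act /cart_comp -cmpA cpair_cmp.
rewrite -[RHS]cmpc1 -cpair_proj; congr cmp; apply: cpair_ext => i.
rewrite cproj_pair.
exact (@cproj_act S {i : I & unit} I (fun x => tag x) c
  (Tagged (fun=> unit) tt)).
Qed.

Lemma cart_compA (S : cartesian) (J : finType) (I : J -> finType)
    (K : {j : J & I j} -> finType)
    (b : forall x, K x -> S) (c : forall j, I j -> S) (d : J -> S) (e : S)
    (p : hom (cprod d) e) (q : forall j, hom (cprod (c j)) (d j))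
    (r : forall x, hom (cprod (b x)) (c (tag x) (tagged x)))
    (bij : bijective (fun y : {j : J & {i : I j & K (Tagged I i)}} =>
       Tagged K (i := Tagged I (tag (tagged y))) (tagged (tagged y)))) :
  cart_act (c := fun x => b (tag x) (tagged x)) bij
    (cart_comp p (fun j => cart_comp (q j) (fun i => r (Tagged I i))))
  = cart_comp (cart_comp p q) r.
Proof.
rewrite /cart_act /cart_comp.
rewrite -!cmpA !cpair_cmp; congr cmp; apply: cpair_ext => j.
rewrite -!cmpA !cpair_cmp; congr cmp; apply: cpair_ext => i.
refine (etrans _ (esym (@cproj_pair S {j : J & I j}
  (fun x => c (tag x) (tagged x)) _ _ (Tagged I i)))).
rewrite -!cmpA !cpair_cmp /=; congr cmp; apply: cpair_ext => k.
pose Ki j := fun i : I j => K (Tagged I i).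
refine (etrans (@cproj_pair S {i : I j & K (Tagged I i)}
  (fun x => b (Tagged I (tag x)) (tagged x)) _ _ (Tagged (Ki j) k)) _).
exact (@cproj_act S {j : J & {i : I j & K (Tagged I i)}}
  {x : {j : J & I j} & K x}
  (fun y => Tagged K (i := Tagged I (tag (tagged y))) (tagged (tagged y)))
  (fun x => b (tag x) (tagged x))
  (Tagged (fun j => {i : I j & Ki j i}) (Tagged (Ki j) k))).
Qed.

Lemma cart_comp_actl (S : cartesian) (J' J : finType) (f : J' -> J)
    (bf : bijective f) (I : J -> finType) (c : forall j, I j -> S)
    (d : J -> S) (e : S) (p : hom (cprod (fun j => d (f j))) e)
    (q : forall j, hom (cprod (c j)) (d j))
    (bij : bijective (fun x : {j : J' & I (f j)} =>
       Tagged I (i := f (tag x)) (tagged x))) :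
  cart_comp (cart_act bf p) q
  = cart_act (c := fun x => c (tag x) (tagged x)) bij
      (cart_comp p (fun j => q (f j))).
Proof.
rewrite /cart_act /cart_comp.
rewrite -!cmpA !cpair_cmp; congr cmp; apply: cpair_ext => j.
rewrite cproj_pair -!cmpA !cpair_cmp; congr cmp; apply: cpair_ext => i.
apply: esym; exact (@cproj_act S {j : J' & I (f j)} {j : J & I j}
  (fun x => Tagged I (i := f (tag x)) (tagged x))
  (fun x => c (tag x) (tagged x)) (Tagged (fun j => I (f j)) i)).
Qed.

Lemma cart_comp_actr (S : cartesian) (J : finType) (I' I : J -> finType)
    (g : forall j, I' j -> I j) (bg : forall j, bijective (g j))
    (c : forall j, I j -> S) (d : J -> S) (e : S) (p : hom (cprod d) e)
    (q : forall j, hom (cprod (fun i => c j (g j i))) (d j))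
    (bij : bijective (fun x : {j : J & I' j} =>
       Tagged I (g (tag x) (tagged x)))) :
  cart_comp p (fun j => cart_act (c := c j) (bg j) (q j))
  = cart_act (c := fun x => c (tag x) (tagged x)) bij (cart_comp p q).
Proof.
rewrite /cart_act /cart_comp.
rewrite -!cmpA !cpair_cmp; congr cmp; apply: cpair_ext => j.
rewrite -!cmpA !cpair_cmp; congr cmp; apply: cpair_ext => i.
rewrite cproj_pair; apply: esym.
exact (@cproj_act S {j : J & I' j} {j : J & I j}
  (fun x => Tagged I (g (tag x) (tagged x)))
  (fun x => c (tag x) (tagged x)) (Tagged I' i)).
Qed.

Definition cart_operad (S : cartesian) : operad :=
  @Operad S (fun I c e => hom (cprod c) e) (fun e => cproj (fun=> e) tt)
    (@cart_comp S) (@cart_act S) (@cart_act_id S) (@cart_act_comp S)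
    (@cart_comp1o S) (@cart_compo1 S) (@cart_compA S) (@cart_comp_actl S)
    (@cart_comp_actr S).

Record diagram (S : category) := Diagram {
  dob :> S -> dset;
  dmap : forall a b : S, hom a b -> nattrans (dob b) (dob a);
  dmap_id : forall a : S, dmap (idc a) = nat_id (dob a);
  dmap_cmp : forall (a b c : S) (g : hom b c) (f : hom a b),
    dmap (g \oc f) = nat_cmp (dmap f) (dmap g) }.

Arguments dmap {_} _ {a b} f.

(* in(t); the object l^*(t) is the value of t at the colour l. *)
Definition input_obj (S : cartesian) (T : tree) (t : nerve (cart_operad S) T) :
    S :=
  cprod (fun l : leaves T => t (val l)).

Lemma leaf_of_above_subproof (T : tree) (x : edge T) (l : leaves_above x) :
  is_leaf (val l).
Proof. by have /andP[] := valP l. Qed.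

Definition leaf_of_above (T : tree) (x : edge T) (l : leaves_above x) :
    leaves T :=
  exist _ (val l) (leaf_of_above_subproof l).

(* The arrow in(t) -> in(alpha^* t).  The formula makes sense for every arrow
   alpha of Omega; it is only used for compositions of faces and
   isomorphisms. *)
Definition input_map (S : cartesian) (U T : Omega) (alpha : hom U T)
    (t : nerve (cart_operad S) T) :
    hom (input_obj t) (input_obj (pmap (nerve (cart_operad S)) alpha t)) :=
  cpair (fun l : leaves U =>
    mop t (crown (alpha (val l)))
    \oc cpair (fun m : leaves_above (alpha (val l)) =>
          cproj (fun l' : leaves T => t (val l')) (leaf_of_above m))).

Definition dcoll : Type := tree -> Type.
Definition dcoll_map (A B : dcoll) : Type := forall T, A T -> B T.
Definition coll_of (X : dset) : dcoll := fun T => X T.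
Definition coll_coprod (I : Type) (A : I -> dcoll) : dcoll :=
  fun T => {i : I & A i T}.

(* The element of the summand A i underlying an element of the coproduct. *)
Definition summand (I : Type) (A : I -> dcoll) (T : tree) (i : I)
    (y : coll_coprod A T) (yi : tag y = i) : A i T :=
  eq_rect (tag y) (fun j => A j T) (tagged y) i yi.

(* A dendrex is a pair (t, x) with x(r) in X(in(r^* t)), compatible
   with compositions of faces and isomorphisms.
   The objects in((r alpha)^* t) and in(alpha^* r^* t) are convertible. *)
Record dendrex (S : cartesian) (X : diagram S) (T : Omega) := Dendrex {
  dx_base : nerve (cart_operad S) T;
  dx_fib : dcoll_map (coll_of (representable T))
                     (coll_coprod (fun s : S => coll_of (X s)));
  dx_in : forall (R : Omega) (r : representable T R),
    tag (dx_fib r) = input_obj (pmap (nerve (cart_operad S)) r dx_base);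
  dx_mono : forall (R : Omega) (r : representable T R) (U : Omega)
      (alpha : hom U R), face_mono alpha ->
    pmap (X _) alpha (summand (dx_in r))
    = dmap X (input_map alpha (pmap (nerve (cart_operad S)) r dx_base)) U
        (summand (dx_in (pmap (representable T) alpha r))) }.

Lemma dendrex_eq (S : cartesian) (X : diagram S) (T : Omega)
    (y z : dendrex X T) :
  dx_base y = dx_base z ->
  (forall R (r : representable T R), dx_fib y r = dx_fib z r) -> y = z.
Proof.
case: y z => [t x a b] [t' x' a' b'] /= tt'; subst t' => xx'.
have xE : x = x'.
  by apply: functional_extensionality_dep => R; apply: functional_extensionality.
subst x'; have aE : a = a' by apply: proof_irrelevance.
by subst a'; congr Dendrex; apply: proof_irrelevance.
Qed.

Lemma summand_eq (I : Type) (A : I -> dcoll) (T : tree) (i : I)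
    (y z : coll_coprod A T) (yi : tag y = i) (zi : tag z = i) :
  y = z -> summand yi = summand zi.
Proof. by move=> yz; subst z; congr summand; apply: proof_irrelevance. Qed.

Lemma dendrex_map_mono (S : cartesian) (X : diagram S) (T' T : Omega)
    (beta : hom T' T) (y : dendrex X T)
    (R : Omega) (r : representable T' R) (U : Omega) (alpha : hom U R) :
  face_mono alpha ->
  pmap (X _) alpha (summand (dx_in y (beta \oc r)))
  = dmap X (input_map alpha
      (pmap (nerve (cart_operad S)) r
        (pmap (nerve (cart_operad S)) beta (dx_base y)))) U
      (summand (dx_in y (beta \oc (r \oc alpha)))).
Proof.
move=> ma; refine (etrans (dx_mono y (beta \oc r) ma) _).
apply: (congr1 (dmap X (input_map alpha
  (pmap (nerve (cart_operad S)) (beta \oc r) (dx_base y))) U)).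
refine (summand_eq (A := fun s : S => coll_of (X s)) _ _ _).
exact: (congr1 (@dx_fib S X T y U) (esym (cmpA beta r alpha))).
Qed.

Definition dendrex_map (S : cartesian) (X : diagram S) (T' T : Omega)
    (beta : hom T' T) (y : dendrex X T) : dendrex X T' :=
  @Dendrex S X T' (pmap (nerve (cart_operad S)) beta (dx_base y))
    (fun R (r : representable T' R) => dx_fib y (beta \oc r))
    (fun R r => dx_in y (beta \oc r))
    (fun R r U alpha => @dendrex_map_mono S X T' T beta y R r U alpha).

Lemma dendrex_map_id (S : cartesian) (X : diagram S) (T : Omega)
  (y : dendrex X T) : dendrex_map (idc T) y = y.
Proof.
apply: dendrex_eq => [|R r]; first exact: pmap_id.
exact: (congr1 (@dx_fib S X T y R) (cmp1c r)).
Qed.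

Lemma dendrex_map_cmp (S : cartesian) (X : diagram S) (T'' T' T : Omega)
    (g : hom T' T) (f : hom T'' T') (y : dendrex X T) :
  dendrex_map (g \oc f) y = dendrex_map f (dendrex_map g y).
Proof.
apply: dendrex_eq => [|R r]; first exact: pmap_cmp.
exact: (congr1 (@dx_fib S X T y R) (esym (cmpA g f r))).
Qed.

Definition integral (S : cartesian) (X : diagram S) : dset :=
  @Presheaf Omega (dendrex X) (@dendrex_map S X) (@dendrex_map_id S X)
    (@dendrex_map_cmp S X).

(* Main.v *)
(* A dendrex prescribes an element for every arrow R -> T, but only asks for
   compatibility with monomorphisms.  Hence the elements over degenerate arrows
   are additional data, and extending a horn at e naively leads to boundary
   problems, which an inner Kan complex need not solve: an arrow in which the
   edge e is repeated has all its proper faces prescribed.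

   Instead, insert into T an edge c just below e, and extend the given family
   to all arrows into the resulting tree in which c occurs at most once.  An
   arrow outside the horn in which c occurs is, at that occurrence, an inner
   horn filling problem with a single missing face, and every arrow outside the
   horn in which c does not occur is the missing face of exactly one such
   problem, up to unique isomorphism; the missing face has the same leaves, so
   it lies over an isomorphic object.  Filling by induction on the number of
   vertices and restricting along the inclusion of T gives the extension.

   Trees are handled as ordered sets of edges with a marked set of leaves:
   arrows are the monotone maps that reflect comparability and are cofinal on
   leaves. *)

From Stdlib Require Import FunctionalExtensionality ProofIrrelevance.
From Stdlib Require Import PropExtensionality ClassicalEpsilon.
From HB Require Import structures.
From mathcomp Require Import all_boot.
Require Import Defs.

Set Implicit Arguments.
Unset Strict Implicit.
Unset Printing Implicit Defensive.

(** * Trees as ordered sets *)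

(** The obstacle is coherence: one filler must serve an arrow, its missing face and their isomorphic
    copies, while choices are made arrow by arrow. Hence a representative is chosen from a predicate
    that is literally equal for all arrows with the same representatives. The embedding into it is
    unique, because the fibres of an arrow are finite chains and an injective endomorphism over T is
    therefore the identity. The bound of one occurrence of c keeps this consistent: with a second
    one the missing face would contain c as well and carry a filling problem of its own. Nothing is
    lost, since an arrow that factors through the inclusion of T never meets c.

    The base of the horn is a horn in the nerve of an operad. Its extension is forced, since operad
    maps out of $\Omega(T)$ are given on vertices and the corolla of each vertex lies in the horn.

    Uniqueness requires no choices, so no c is inserted into T: dendrices with the same horn agree
    on arrows that hit e by induction on vertices, and any other arrow is a restriction of one that
    hits e. *)

Lemma above_comparable (T : tree) (x y z : edge T) :
  above x z -> above y z -> above x y \/ above y x.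
Proof.
move=> /iter_findex; set n := findex _ _ _ => <- /iter_findex.
set m := findex _ _ _ => <-.
have iter_above a b : b <= a -> above (iter a (@down T) z) (iter b (@down T) z).
  by move=> ba; rewrite -(subnK ba) iterD above_iter.
by case/orP: (leq_total n m) => /iter_above; [right | left].
Qed.

Lemma above_root (T : tree) (x : edge T) : above root x.
Proof. exact: down_root. Qed.

Lemma above_root_eq (T : tree) (x : edge T) : above x root -> x = root.
Proof. by move=> xr; apply: above_anti xr (above_root x). Qed.

Lemma above_inputs (T : tree) (v : vert T) (x : inputs v) :
  above (out v) (val x).
Proof. exact: above_below (inputsP x) (above_refl _). Qed.

Lemma inputs_antichain (T : tree) (v : vert T) (x y : inputs v) :
  above (val x) (val y) -> x = y.
Proof.
move=> xy; apply: val_inj.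
exact: siblings_disjoint (inputsP x) (inputsP y) xy (above_refl _).
Qed.

Lemma outNleaf (T : tree) (v : vert T) : is_leaf (out v) = false.
Proof. by apply/negbTE/leafPn; exists v. Qed.

Lemma tree_ind_up (T : tree) (P : edge T -> Prop) :
  (forall x, (forall y, above x y -> x <> y -> P y) -> P x) -> forall x, P x.
Proof.
move=> IH x; have [n] := ubnP #|[set z | above x z]|.
elim: n x => // n IHn x le_n; apply: IH => y xy ne; apply: IHn.
rewrite ltnS in le_n; apply: leq_trans le_n; apply: proper_card.
apply/properP; split.
  by apply/subsetP => z; rewrite !inE; apply: above_trans.
exists x; first by rewrite inE above_refl.
by rewrite inE; apply/negP => yx; apply: ne; apply: above_anti.
Qed.

(** * Operations of a tree as cuts, arrows as maps of ordered sets *)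

Definition cut (T : tree) (I : Type) (c : I -> edge T) (e : edge T) : Prop :=
  [/\ forall i, above e (c i),
      forall i j, above (c i) (c j) -> i = j &
      forall y, is_leaf y -> above e y -> exists i, above (c i) y].

Lemma Omega_op_cut (T : tree) (I : finType) (c : I -> edge T) (e : edge T) :
  Omega_op c e -> cut c e.
Proof.
elim=> [{}e|v|J K b d {}e _ [d1 d2 d3] _ IH|J K f d {}e [g fg gf] _ [d1 d2 d3]].
- by split=> [_|[] []|y _ ey] //; apply: above_refl.
- split=> [x|x y|y ly vy]; [exact: above_inputs | exact: inputs_antichain |].
  by apply: above_out_inputs => // yv; rewrite yv outNleaf in ly.
- split=> [[j k]|[j k] [j' k'] /= jk|y ly ey] /=.
  + by have [b1 _ _] := IH j; apply: above_trans (d1 j) (b1 k).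
  + have [b1 _ _] := IH j; have [b1' b2 _] := IH j'.
    have jj' : j = j'.
      case: (above_comparable (above_trans (b1 k) jk) (b1' k')) => /d2 //.
    by subst j'; congr existT; apply: b2.
  + have [j dy] := d3 y ly ey; have [_ _ /(_ y ly dy) [k ky]] := IH j.
    by exists (Tagged K k).
- split=> [j|i j|y ly ey].
  + by rewrite -[j]gf; apply: d1.
  + by rewrite -[i]gf -[j]gf => /d2 ->.
  + by have [i iy] := d3 y ly ey; exists (f i).
Qed.

(** Induction from the top of the tree. If e is not in A, it is no leaf, since a leaf can only be
    covered by itself; the elements of A are then distributed over the inputs of the vertex on e and
    the pieces are grafted. *)
Lemma Omega_set_cut (T : tree) (e : edge T) (A : {set edge T}) :
  cut (fun x : {x | x \in A} => val x) e -> Omega_set A e.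
Proof.
elim/tree_ind_up: e A => e IH A [A1 A2 A3].
have anti x y : x \in A -> y \in A -> above x y -> x = y.
  move=> xA yA xy.
  by case: (A2 (exist _ x xA) (exist _ y yA) xy).
case: (boolP (e \in A)) => eA.
  suff -> : A = [set e] by apply: Omega_set1.
  apply/setP => x; rewrite inE; apply/idP/eqP => [xA|->//].
  by symmetry; apply: anti => //; apply: (A1 (exist _ x xA)).
have Ae x : x \in A -> x <> e by move=> xA xe; rewrite -xe xA in eA.
have le : ~~ is_leaf e.
  apply/negP => le; have [[x xA] /= xe] := A3 e le (above_refl e).
  by apply: (Ae x xA); apply: above_anti xe (A1 (exist _ x xA)).
have /leafPn [v ve] := le; subst e.
apply: (Omega_graft (A := fun x : inputs v => [set y in A | above (val x) y])
  (Omega_vert v)) => [x|x x' y||y].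
- apply: IH; first exact: above_inputs.
    by move=> xv; have := above_outN (inputsP x); rewrite xv above_refl.
  split=> [[y yP]|[y yP] [z zP] /= yz|y ly xy] /=.
  + by move: yP; rewrite inE => /andP[].
  + apply: val_inj => /=; move: yP zP; rewrite !inE => /andP[yA _] /andP[zA _].
    exact: anti.
  + have [[z zA] /= zy] := A3 y ly (above_trans (above_inputs x) xy).
    have [x' xz] := above_out_inputs (A1 (exist _ z zA)) (Ae z zA).
    have xx' : x = x'.
      apply: val_inj; apply: siblings_disjoint (inputsP x) (inputsP x') xy _.
      exact: above_trans xz zy.
    have zP : z \in [set y in A | above (val x) y] by rewrite inE zA xx'.
    by exists (exist _ z zP).
- rewrite !inE => /andP[_ xy] /andP[_ xy']; apply: val_inj.
  exact: siblings_disjoint (inputsP x) (inputsP x') xy xy'.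
- exact: val_inj.
- split=> [[[z zA] /= <-]|[x]].
    have [x xz] := above_out_inputs (A1 (exist _ z zA)) (Ae z zA).
    by exists x; rewrite inE zA.
  by rewrite inE => /andP[yA _]; exists (exist _ y yA).
Qed.

Lemma cut_Omega_op (T : tree) (I : finType) (c : I -> edge T) (e : edge T) :
  cut c e -> Omega_op c e.
Proof.
move=> [c1 c2 c3]; pose A := [set x in codom c].
have cA i : c i \in A by rewrite inE codom_f.
have Ac x : x \in A -> exists i, c i = x.
  by rewrite inE => /codomP [i ->]; exists i.
apply: (@Omega_op_relabel T {x | x \in A} I (fun x => val x)).
- exact: val_inj.
- by move=> i j ij; apply: c2; rewrite ij above_refl.
- by case=> x xA; apply: Ac.
- by move=> i; exists (exist _ (c i) (cA i)).
apply: Omega_set_cut; split=> [[x xA]|[x xA] [y yA] /= xy|y ly ey] /=.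
- by have [i <-] := Ac x xA.
- apply: val_inj => /=; have [i ix] := Ac x xA; have [j jy] := Ac y yA.
  by rewrite -ix -jy (c2 i j) // ix jy.
- by have [i iy] := c3 y ly ey; exists (exist _ (c i) (cA i)).
Qed.

(** Comparability is reflected but not the order, because an arrow may identify edges of a chain.
    Cofinality is asked above the image of the root only; it follows above every edge by
    [tree_map_leaf]. *)
Definition tree_map (R T : tree) (f : edge R -> edge T) : Prop :=
  [/\ forall x y, above x y -> above (f x) (f y),
      forall x y, above (f x) (f y) -> above x y \/ above y x &
      forall y, is_leaf y -> above (f root) y ->
        exists2 z, is_leaf z & above (f z) y].

(** Incomparable edges part at some vertex, so that comparability can be tested on the inputs of a
    single vertex. *)
Lemma meet_cases (T : tree) (x y w : edge T) :
  above w x -> above w y -> (above x y \/ above y x) \/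
  exists v (a b : inputs v), [/\ a <> b, above (val a) x & above (val b) y].
Proof.
elim/tree_ind_up: w => w IH wx wy.
case: (above_cases wx) => [->|[v [a [va ba ax]]]]; first by left; left.
case: (above_cases wy) => [->|[v' [b [vb bb bY]]]]; first by left; right.
have vv' : v = v' by apply: out_inj; rewrite va vb.
subst v'; case: (eqVneq a b) => [ab|ab]; last first.
  have aP : below a == Some v by apply/eqP.
  have bP : below b == Some v by apply/eqP.
  right; exists v, (exist _ a aP), (exist _ b bP); split=> //.
  by move=> /(congr1 val) /= abE; rewrite abE eqxx in ab.
subst b; apply: (IH a) => //.
  by rewrite -va; apply: above_below ba (above_refl _).
by move=> wa; have := above_outN ba; rewrite va wa above_refl.
Qed.

Lemma hom_tree_map (R T : Omega) (r : hom R T) : tree_map r.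
Proof.
have rop (I : finType) (c : I -> edge R) e :
    Omega_op c e -> cut (fun i => r (c i)) (r e).
  by move=> o; apply: Omega_op_cut; apply: (mop r (I := I) (c := c) (e := e)).
have mono x y : above x y -> above (r x) (r y).
  move=> /iter_findex <-; elim: (findex _ _ _) => [|n IH]; first exact: above_refl.
  apply: above_trans IH; rewrite iterS; set z := iter n _ y.
  case bz: (below z) => [v|]; last by rewrite /down /tree_down bz above_refl.
  have bz' : below z == Some v by apply/eqP.
  rewrite (down_below bz); have [v1 _ _] := rop _ _ _ (Omega_vert v).
  exact: (v1 (exist _ z bz')).
split=> // [x y xy|y ly ry].
(* If x and y part at v, the images of a and b both lie below [r y], hence are comparable, although
   the inputs of v are sent to a cut. *)
- case: (meet_cases (above_root x) (above_root y)) => [//|[v [a [b [ab ax bY]]]]].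
  have [_ v2 _] := rop _ _ _ (Omega_vert v).
  case: (above_comparable (above_trans (mono _ _ ax) xy) (mono _ _ bY)) => /v2 //.
  by move=> /esym.
- have [_ _ /(_ y ly ry) [[z zP] zy]] := rop _ _ _ (Omega_op_crown root).
  by exists z => //; case/andP: (zP).
Qed.

Lemma hom_above (R T : Omega) (r : hom R T) x y :
  above x y -> above (r x) (r y).
Proof. by have [r1 _ _] := hom_tree_map r; apply: r1. Qed.

Lemma hom_comparable (R T : Omega) (r : hom R T) x y :
  above (r x) (r y) -> above x y \/ above y x.
Proof. by have [_ r2 _] := hom_tree_map r; apply: r2. Qed.

Lemma tree_map_leaf (R T : tree) (f : edge R -> edge T) x y :
  tree_map f -> is_leaf y -> above (f x) y ->
  exists z, [/\ is_leaf z, above x z & above (f z) y].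
Proof.
move=> [f1 f2 f3] ly xy.
have [z lz zy] := f3 y ly (above_trans (f1 _ _ (above_root x)) xy).
exists z; split=> //.
have [xz|zx] : above x z \/ above z x; first last.
- by rewrite (above_leaf lz zx) above_refl.
- by [].
- by case: (above_comparable xy zy) => /f2 [];
    [left | right | right | left].
Qed.

Lemma hom_leaf (R T : Omega) (r : hom R T) x y :
  is_leaf y -> above (r x) y ->
  exists z, [/\ is_leaf z, above x z & above (r z) y].
Proof. exact: tree_map_leaf (hom_tree_map r). Qed.

Lemma tree_map_vert (R T : tree) (f : edge R -> edge T) :
  tree_map f -> forall v : vert R,
    @Omega_op T (inputs v) (fun x => f (val x)) (f (out v)).
Proof.
move=> fP v; have [f1 f2 _] := fP; apply: cut_Omega_op; split.
- by move=> x; apply: f1; apply: above_inputs.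
- by move=> x y /f2 [] /inputs_antichain.
- move=> y ly vy; have [z [lz vz zy]] := tree_map_leaf fP ly vy.
  have [zv|x xz] := above_out_inputs vz; first by rewrite zv outNleaf in lz.
  by exists x; apply: above_trans zy; apply: f1.
Qed.

Definition hom_of (R T : Omega) (f : edge R -> edge T) (fP : tree_map f) :
  hom R T := Omega_map (tree_map_vert fP).

Lemma hom_eq (R T : Omega) (r s : hom R T) : (forall x, r x = s x) -> r = s.
Proof.
case: r s => [f fo fP] [g go gP] /= fg.
have E : f = g by apply: functional_extensionality.
subst g; have E : fo = go.
  apply: functional_extensionality_dep => I.
  apply: functional_extensionality_dep => c.
  apply: functional_extensionality_dep => e.
  by apply: functional_extensionality => o; apply: (proof_irrelevance (Omega_op _ _)).
by subst go; congr OperadMap; apply: proof_irrelevance.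
Qed.

Lemma hom_congr (R T : Omega) (r s : hom R T) x : r = s -> r x = s x.
Proof. by move=> ->. Qed.

Lemma hom_inj_above (R T : Omega) (r : hom R T) x y :
  injective r -> above (r x) (r y) -> above x y.
Proof.
move=> ri xy; case: (hom_comparable xy) => // yx.
by rewrite (ri _ _ (above_anti xy (hom_above r yx))) above_refl.
Qed.

(** The order conditions are inherited from q because i is injective. Cofinality is not, since F may
    have leaves that are not leaves of T. *)
Lemma hom_lift (Q F T : Omega) (i : hom F T) (q : hom Q T)
    (g : edge Q -> edge F) :
  injective i -> (forall x, i (g x) = q x) ->
  (forall y, is_leaf y -> above (g root) y ->
     exists2 z, is_leaf z & above (g z) y) ->
  exists s : hom Q F, q = i \oc s.
Proof.
move=> ii gq gl.
have gP : tree_map g.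
  split=> // x y xy.
    by apply: (hom_inj_above ii); rewrite !gq; apply: hom_above.
  by apply: (@hom_comparable _ _ q); rewrite -!gq; apply: hom_above.
by exists (hom_of gP); apply: hom_eq => x; rewrite /= gq.
Qed.

(** Non-leaf edges correspond to vertices, so this lets vertices be counted along injective
    arrows. *)
Lemma hom_nleaf (R T : Omega) (r : hom R T) x :
  injective r -> ~~ is_leaf x -> ~~ is_leaf (r x).
Proof.
move=> ri; apply: contraNN => lx.
have [z [lz xz zx]] := hom_leaf lx (above_refl _).
by rewrite (_ : x = z) //; apply: above_anti xz (hom_inj_above ri zx).
Qed.

Definition nleaf (T : tree) : {set edge T} := [set x | ~~ is_leaf x].

Lemma card_nleaf (T : tree) : #|nleaf T| = #|vert T|.
Proof.
rewrite -(card_imset predT (@out_inj T)); congr #|pred_of_set _|.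
apply/setP => x; rewrite inE; apply/leafPn/imsetP => [[v <-]|[v _ ->]].
  by exists v.
by exists v.
Qed.

Lemma inj_iso (R T : Omega) (r : hom R T) :
  injective r -> (forall y, exists x, r x = y) ->
  (forall x, is_leaf x -> is_leaf (r x)) -> is_iso r.
Proof.
move=> ri rs rl; pose g y := sval (constructive_indefinite_description _ (rs y)).
have gK y : r (g y) = y by rewrite /g; case: constructive_indefinite_description.
have Kg x : g (r x) = x by apply: ri; rewrite gK.
have gP : tree_map g.
  split=> [x y xy|x y xy|y ly gy].
  - by apply: (hom_inj_above ri); rewrite !gK.
  - by have := hom_above r xy; rewrite !gK; left.
  - by exists (r y); [apply: rl | rewrite Kg above_refl].
by exists (hom_of gP); split; apply: hom_eq => x /=.
Qed.

Lemma iso_inj (R T : Omega) (r : hom R T) : is_iso r -> injective r.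
Proof.
by case=> g [gr _] x y xy; rewrite -[x]/(idc R x) -[y]/(idc R y) -gr /= xy.
Qed.

(** * Trees from finite orders with marked leaves *)

Record is_tree_order (E : finType) (le : rel E) (L : pred E) (r0 : E) : Prop :=
  IsTreeOrder {
    to_refl : reflexive le;
    to_anti : forall x y, le x y -> le y x -> x = y;
    to_trans : forall y x z, le x y -> le y z -> le x z;
    to_least : forall x, le r0 x;
    to_chain : forall x y z, le x z -> le y z -> le x y \/ le y x;
    to_leaf : forall x y, L x -> le x y -> x = y }.

Section TreeOfOrder.

Variables (E : finType) (le : rel E) (L : pred E) (r0 : E).
Hypothesis leP : is_tree_order le L r0.

Definition oparent (x : E) : option E :=
  [pick y | [&& le y x, y != x & [forall z, (le z x && (z != x)) ==> le z y]]].

Lemma oparentP x : oparent x = None /\ x = r0 \/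
  exists y, [/\ oparent x = Some y, le y x, y <> x, x <> r0 &
    forall z, le z x -> z <> x -> le z y].
Proof.
rewrite /oparent; case: pickP => [y /and3P[yx /eqP ne /forallP yP]|none].
  right; exists y; split=> // [xr|z zx /eqP zne].
    by subst x; apply: ne; apply: (to_anti leP) yx (to_least leP y).
  by apply: (implyP (yP z)); rewrite zx zne.
left; split=> //; apply/eqP; apply: contraT => xr.
have P0 : le r0 x && (r0 != x) by rewrite (to_least leP) eq_sym.
(* Among the elements strictly below x, one with the most elements below it is the greatest, because
   they form a chain. *)
case: (@arg_maxnP _ r0 (fun y => le y x && (y != x))
  (fun y => #|[set z | le z y]|) P0) => y /andP[yx ne] ymax.
have := none y; rewrite yx ne /= => /negP[]; apply/forallP => z.
apply/implyP => zP; have zx : le z x by case/andP: zP.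
case: (to_chain leP zx yx) => // yz.
suff -> : z = y by apply: to_refl leP y.
apply/eqP; apply: contraT => zy; move: (ymax z zP) => /=.
rewrite leqNgt => /negP[]; apply: proper_card; apply/properP; split.
  by apply/subsetP => w; rewrite !inE => /(to_trans leP); apply.
exists z; rewrite !inE ?(to_refl leP) //; apply: contraNN zy => zy.
by apply/eqP; apply: (to_anti leP).
Qed.

(** An unmarked maximal element becomes the output of a vertex without inputs; the order alone would
    not tell it from a leaf. *)
Definition overt : finType := {x : E | ~~ L x}.
Definition oout (v : overt) : E := val v.
Definition obelow (x : E) : option overt := obind insub (oparent x).

Lemma oout_inj : injective oout.
Proof. exact: val_inj. Qed.

Lemma obelowE x : omap oout (obelow x) = oparent x.
Proof.
rewrite /obelow; case: (oparentP x) => [[-> _]|[y [-> yx ne _ _]]] //=.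
case: insubP => [v _ <- //|]; rewrite negbK => Ly.
by case: ne; apply: (to_leaf leP).
Qed.

Lemma obelow_root x : (obelow x == None) = (x == r0).
Proof.
have := obelowE x; case: (obelow x) => [v|] /=;
  case: (oparentP x) => [[-> ->]|[y [-> _ _ /eqP/negbTE -> _]]] //.
by rewrite !eqxx.
Qed.

Lemma odownE x : tree_down oout obelow x = odflt x (oparent x).
Proof. by rewrite /tree_down -obelowE; case: (obelow x). Qed.

Lemma le_fconnect x y : le x y -> fconnect (tree_down oout obelow) y x.
Proof.
have [n] := ubnP #|[set z | le z y]|; elim: n y => // n IH y le_n xy.
case: (eqVneq x y) => [->|ne]; first exact: connect0.
apply: connect_trans (fconnect1 _ y) (IH _ _ _); rewrite odownE.
- case: (oparentP y) => [[-> yr]|[w [-> wy wne _ wP]]] /=.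
    by subst y; case/eqP: ne; apply: (to_anti leP) xy (to_least leP x).
  rewrite ltnS in le_n; apply: leq_trans le_n; apply: proper_card.
  apply/properP; split.
    by apply/subsetP => z; rewrite !inE => /(to_trans leP); apply.
  exists y; rewrite !inE ?(to_refl leP) //; apply/negP => yw.
  by apply: wne; apply: (to_anti leP).
- case: (oparentP y) => [[-> yr]|[w [-> wy wne _ wP]]] //=.
  by apply: wP => //; apply/eqP.
Qed.

Lemma odown_root x : fconnect (tree_down oout obelow) x r0.
Proof. by apply: le_fconnect; apply: to_least leP x. Qed.

Definition tree_of_order : tree := Tree oout_inj obelow_root odown_root.

Lemma tree_of_order_above (x y : edge tree_of_order) :
  above x y = le x y.
Proof.
apply/idP/idP => [/iter_findex <-|]; last exact: le_fconnect.
elim: (findex _ _ _) => [|n IH]; first exact: (to_refl leP).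
apply: (to_trans leP) IH; rewrite iterS; set z := iter n _ y.
rewrite /down /= odownE; case: (oparentP z) => [[-> _]|[w [-> //]]] /=.
exact: (to_refl leP).
Qed.

Lemma tree_of_order_leaf (x : edge tree_of_order) : is_leaf x = L x.
Proof.
rewrite -[RHS]negbK /is_leaf; congr (~~ _); apply/existsP/idP => [[v /eqP <-]|Lx].
  exact: (valP v).
by exists (exist _ x Lx).
Qed.

End TreeOfOrder.

(** * Faces and inner horns *)

Lemma inner_face_leaf (T : tree) (e : inner_edge T) (x : edge (inner_face e)) :
  is_leaf x = is_leaf (val x).
Proof.
congr (~~ _); apply/existsP/existsP => -[v /eqP vx].
  by exists (val v); rewrite -vx.
have vP : out v != val e by rewrite vx; apply: (valP x).
by exists (exist _ v vP); apply/eqP; apply: val_inj.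
Qed.

(** Deleting a vertex at the top turns its output into a leaf. When the root vertex is deleted, its
    output is not an edge of the face and the second alternative is empty. *)
Lemma outer_face_leaf (T : tree) (v : outer_vertex T) (x : edge (outer_face v)) :
  is_leaf x = is_leaf (val x) || (val x == out (val v)).
Proof.
apply/idP/idP => [lx|].
  apply: contraLR lx; rewrite negb_or => /andP[/leafPn [u ux] xv].
  have uP : u != val v by apply: contraNneq xv => uv; rewrite -ux uv.
  by apply/leafPn; exists (exist _ u uP); apply: val_inj.
case/orP => [lx|/eqP xv]; apply/negP => /existsP [u /eqP ux].
  by case/negP: lx; apply/existsP; exists (val u); rewrite -ux.
by have /eqP[] : val u != val v := valP u; apply: out_inj; rewrite -xv -ux.
Qed.

Lemma eta_leaf (x : edge eta) : is_leaf x.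
Proof. by apply/negP => /existsP [[]]. Qed.

Lemma face_map_inj (T : tree) (f : face T) : injective (face_map f).
Proof. by case: f => [e|v|_ x] /=; [exact: val_inj | exact: val_inj | do 2!case]. Qed.

Lemma inner_nleaf (T : tree) (x : edge T) : inner x -> ~~ is_leaf x.
Proof. by case/andP. Qed.

Lemma inner_neq_root (T : tree) (x : edge T) : inner x -> x <> root.
Proof. by move=> /inner_rootN /eqP ne xr; apply: ne. Qed.

Lemma innerI (T : tree) (x : edge T) : ~~ is_leaf x -> x <> root -> inner x.
Proof. by move=> lx /eqP xr; rewrite /inner lx isSome_below. Qed.

Lemma inner_card_vert (T : tree) (e : inner_edge T) : #|vert T| <> 1.
Proof.
move=> T1; have [v [w [_ _ vw]]] := innerP (valP e).
have vE : v = w by apply: (fintype_le1P _); rewrite T1.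
by rewrite vE eqxx in vw.
Qed.

(** Outer faces delete outer edges only, and a tree with an inner edge has at least two vertices,
    hence no faces of the third kind. *)
Lemma face_hit (T : tree) (e : inner_edge T) (f : face T) :
  f <> InnerFace e -> exists x, face_map f x = val e.
Proof.
case: f => [g|v|T1 y] fe; last by case: (inner_card_vert e T1).
  have eg : val e != val g.
    by apply/eqP => /val_inj E; apply: fe; rewrite E.
  by exists (exist _ (val e) eg).
have ev : ~~ (attached (val v) (val e) && ~~ inner (val e)).
  by rewrite (valP e) andbF.
by exists (exist _ (val e) ev).
Qed.

Lemma edge_factor (Q T : Omega) (q : hom Q T) (a : edge T) :
  (exists z : edge Q, is_leaf z) -> (forall x, q x = a) ->
  exists s : hom Q eta, q = edge_map a \oc s.
Proof.
move=> [z lz] qa; apply: (@hom_lift Q eta T (edge_map a) q (fun=> tt)) => //.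
- by do 2!case.
- by case=> _ _; exists z => //; apply: above_refl.
Qed.

Lemma inner_factor (Q T : Omega) (q : hom Q T) (e : inner_edge T) :
  (forall x, q x <> val e) -> exists s : hom Q (inner_face e),
    q = inner_face_map e \oc s.
Proof.
move=> qe; have qe' x : q x != val e by apply/eqP.
apply: (@hom_lift Q (inner_face e) T (inner_face_map e) q
  (fun x => exist _ (q x) (qe' x))) => // [x y /val_inj //|y ly qy].
rewrite inner_face_leaf in ly.
have [z [lz _ zy]] := @hom_leaf Q T q root _ ly (hom_above (inner_face_map e) qy).
by exists z => //;
  apply: (@hom_inj_above _ _ (inner_face_map e) (exist _ (q z) (qe' z)) y) =>
  // a b /val_inj.
Qed.

Lemma outer_factor (Q T : Omega) (q : hom Q T) (v : outer_vertex T) :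
  (forall x, attached (val v) (q x) -> inner (q x)) ->
  (above (q root) (out (val v)) ->
     exists2 z, is_leaf z & above (q z) (out (val v))) ->
  exists s : hom Q (outer_face v), q = outer_face_map v \oc s.
Proof.
move=> qv ql.
have qv' x : ~~ (attached (val v) (q x) && ~~ inner (q x)).
  by rewrite negb_and negbK; case: (boolP (attached _ _)) => //= /qv ->.
have vi : injective (outer_face_map v) by move=> a b /val_inj.
apply: (@hom_lift Q (outer_face v) T (outer_face_map v) q
  (fun x => exist _ (q x) (qv' x))) => // y.
rewrite outer_face_leaf => /orP[ly|/eqP yv] qy.
  have [z [lz _ zy]] := @hom_leaf Q T q root _ ly (hom_above (outer_face_map v) qy).
  by exists z => //;
    apply: (@hom_inj_above _ _ (outer_face_map v) (exist _ (q z) (qv' z)) y vi).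
have [|z lz zy] := ql; first by rewrite -yv; apply: (hom_above (outer_face_map v) qy).
by exists z => //;
  apply: (@hom_inj_above _ _ (outer_face_map v) (exist _ (q z) (qv' z)) y vi);
  rewrite [X in above _ X]yv.
Qed.

(** * Arrows outside an inner horn *)

Definition spanning (R T : tree) (r : edge R -> edge T) : Prop :=
  r root = root /\ forall z, is_leaf z -> is_leaf (r z).

Definition full (R T : tree) (e : edge T) (r : edge R -> edge T) : Prop :=
  spanning r /\ forall f, inner f -> f <> e -> exists x, r x = f.

Lemma full_not_horn (R T : Omega) (e : inner_edge T) (r : hom R T) :
  full (val e) r -> ~ in_horn e r.
Proof.
move=> [[r1 r2] r3] [f [s [fe rE]]]; case: f fe s rE => [f|u|T1 a] fe s rE.
- have [|x rx] := r3 (val f) (valP f).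
    by move=> /val_inj E; apply: fe; rewrite E.
  have /eqP[] : sval (s x : inner_edge_set f) != val f := svalP (s x).
  exact: etrans (esym (hom_congr x rE)) rx.
- pose su x : outer_edge_set u := s x.
  have sE x : sval (su x) = r x by rewrite rE.
  have suP x : ~~ (attached (val u) (r x) && ~~ inner (r x)).
    by rewrite -sE; apply: (svalP (su x)).
  have [ur|ur] := eqVneq (out (val u)) root.
    by have := suP root; rewrite r1 /attached ur eqxx root_innerN.
  have iu : inner (out (val u)) by apply: innerI; [rewrite outNleaf | apply/eqP].
  have uP : ~~ (attached (val u) (out (val u)) && ~~ inner (out (val u))).
    by rewrite iu andbF.
  pose y : edge (outer_face u) := exist _ (out (val u)) uP.
  have ly : is_leaf y by rewrite outer_face_leaf eqxx orbT.
  have sy : above (s root) y.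
    apply: (@hom_inj_above _ _ (outer_face_map u)); first by move=> ? ? /val_inj.
    by rewrite [X in above X _](sE root) r1; apply: above_root.
  have [z [lz _ zy]] := hom_leaf ly sy; have lrz := r2 z lz.
  have := hom_above (outer_face_map u) zy; rewrite [X in above X _](sE z).
  by move=> /(above_leaf lrz) E; rewrite -E outNleaf in lrz.
- by case: (inner_card_vert e T1).
Qed.

Lemma outer_face_factor (Q T : Omega) (q : hom Q T) (v : vert T) (a : edge T) :
  attached v a -> inner a ->
  (forall x, attached v x -> inner x -> x = a) ->
  (forall x, attached v (q x) -> inner (q x)) ->
  (above (q root) (out v) -> exists2 z, is_leaf z & above (q z) (out v)) ->
  exists (u : outer_vertex T) (s : hom Q (outer_face u)),
    q = outer_face_map u \oc s.
Proof.
move=> va ia aP qv ql.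
have vP : #|[set x | attached v x && inner x]| == 1.
  apply/cards1P; exists a; apply/setP => x; rewrite !inE.
  by apply/andP/eqP => [[]|-> //]; apply: aP.
exists (exist _ v vP); exact: (@outer_factor Q T q (exist _ v vP)).
Qed.

(** Each failure of fullness exhibits a face. A missed inner edge gives its inner face; a wrong root
    or a leaf sent to a non-leaf gives a vertex with one inner edge attached whose outer edges are
    avoided by r. As e itself need not be hit, the vertex w on top of e is sometimes the one to
    delete. *)
Lemma not_horn_full (R T : Omega) (e : inner_edge T) (r : hom R T) :
  ~ in_horn e r -> full (val e) r.
Proof.
move=> nh; have er := inner_neq_root (valP e).
have el := inner_nleaf (valP e).
have /leafPn [w we] := el.
have hit f : inner f -> f <> val e -> exists x, r x = f.
  move=> fi fe; case: (boolP [exists x, r x == f]) => [/existsP [x /eqP <-]|no].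
    by exists x.
  case: nh; have [x|s rs] := @inner_factor R T r (exist _ f fi).
    by move=> rx; case/negP: no; apply/existsP; exists x; apply/eqP.
  exists (InnerFace (exist _ f fi)), s; split=> // E; apply: fe.
  by case: E => <-.
have outer v a : attached v a -> inner a ->
    (forall x, attached v x -> inner x -> x = a) ->
    (forall x, attached v (r x) -> inner (r x)) ->
    (above (r root) (out v) -> exists2 z, is_leaf z & above (r z) (out v)) ->
    False.
  move=> h1 h2 h3 h4 h5; apply: nh.
  have [u [s rs]] := outer_face_factor h1 h2 h3 h4 h5.
  by exists (OuterFace u), s.
have ew : attached w (val e) by rewrite /attached we eqxx.
split=> //; split.
- apply/eqP; apply: contraT => /eqP rr.
  have ge x : above (r root) (r x) by apply: hom_above; apply: above_root.
  case: (above_cases (above_root (r root))) => [//|[v [a [vr ba ar]]]].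
  have aroot : a <> root by move=> E; rewrite E below_rootE in ba.
  have image_a x : above a (r x) := above_trans ar (ge x).
  have child x : below x = Some v -> above a x -> x = a.
    by move=> bx ax; apply: siblings_disjoint bx ba (above_refl _) ax.
  have inner_a f : inner f -> f <> val e -> above a f.
    by move=> fi fe; have [x <-] := hit f fi fe.
  (* The inner edges other than e are hit, hence lie above a. If e does too, a is the only inner
     edge at the root vertex, and that vertex is deleted. *)
  case: (boolP (above a (val e))) => ae.
    have inner_a' f : inner f -> above a f.
      by move=> fi; case: (eqVneq f (val e)) => [->//|/eqP]; apply: inner_a.
    case: (@outer v a) => [||x|x|].
    + by rewrite /attached ba eqxx orbT.
    + apply: innerI aroot; apply: contraNN el => la.
      by rewrite (above_leaf la ae).
    + rewrite /attached vr => /orP[/eqP -> /inner_neq_root //|/eqP bx ix].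
      by apply: child bx (inner_a' x ix).
    + rewrite /attached vr => /orP[/eqP rx|/eqP bx].
        by case: aroot; apply: above_root_eq; rewrite -rx.
      rewrite (child _ bx (image_a x)); apply: innerI aroot.
      apply: contraNN el => la; by rewrite (above_leaf la ae).
    + by rewrite vr => /above_root_eq.
  (* Now e stands apart from the image, and no other inner edge lies above it; the vertex w is
     deleted. *)
  have disj x : above (val e) x -> above a x -> False.
    move=> ex ax; case: (above_comparable ex ax) => [ea|]; last exact/negP.
    case: (above_cases (above_root (val e))) => [//|[v' [b [vr' bb be]]]].
    have vv' : v' = v by apply: out_inj; rewrite vr'.
    rewrite vv' in bb; have ab := child _ bb.
    have ba' : a = b.
      exact: siblings_disjoint ba bb (above_refl _) (above_trans be ea).
    by rewrite ba' be in ae.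
  have wchild x : below x = Some w -> above (val e) x.
    by rewrite -we => bx; apply: above_below bx (above_refl _).
  case: (@outer w (val e)) => //.
  + exact: (valP e).
  + move=> x; rewrite /attached we => /orP[/eqP //|/eqP bx ix].
    case: (eqVneq x (val e)) => // /eqP xe.
    by case: (disj x (wchild x bx)); apply: inner_a.
  + move=> x; rewrite /attached we => /orP[/eqP ->|/eqP bx]; first exact: (valP e).
    by case: (disj _ (wchild _ bx)).
  + by rewrite we => re; case/negP: ae; apply: above_trans ar re.
- move=> z lz; apply: contraT => /leafPn [v vz].
  have top x : above (out v) (r x) -> r x = out v.
    rewrite vz => zx; case: (hom_comparable zx) => [/(above_leaf lz) -> //|xz].
    by apply: above_anti zx; apply: hom_above.
  have vchild x : below x = Some v -> above (out v) x /\ x <> out v.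
    move=> bx; split; first exact: above_below bx (above_refl _).
    by move=> xv; have := above_outN bx; rewrite xv above_refl.
  have hitN x : inner x -> above (out v) x -> x <> out v -> x = val e.
    move=> ix vx ne; case: (eqVneq x (val e)) => // /eqP xe.
    by have [y yx] := hit x ix xe; case: ne; rewrite -yx; apply: top; rewrite yx.
  (* An inner edge strictly above [out v] is not hit, so it can only be e. If e is such an edge, w
     is deleted, otherwise v. *)
  case: (boolP (above (out v) (val e) && (val e != out v))) => [/andP[ve /eqP ne]|nve].
    case: (@outer w (val e)) => //.
    + exact: (valP e).
    + move=> x; rewrite /attached we => /orP[/eqP //|/eqP bx ix].
      apply: hitN => //.
        by apply: above_trans ve _; rewrite -we; apply: above_below bx (above_refl _).
      move=> xv; have := above_outN bx; rewrite we xv => /negP; apply.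
      exact: ve.
    + move=> x; rewrite /attached we => /orP[/eqP ->|/eqP bx]; first exact: (valP e).
      have ex : above (val e) (r x).
        by rewrite -we; apply: above_below bx (above_refl _).
      case: ne; apply: (above_anti _ ve); rewrite -(top x) //.
      exact: above_trans ve ex.
    + by move=> _; exists z => //; rewrite we -vz.
  have vr : out v <> root.
    move=> vr; case/negP: nve; rewrite vr above_root; exact/eqP.
  have iv : inner (out v) by apply: innerI vr; rewrite outNleaf.
  case: (@outer v (out v)) => //.
  + by rewrite /attached eqxx.
  + move=> x; rewrite /attached => /orP[/eqP //|/eqP bx ix].
    have [vx ne] := vchild x bx; have xe := hitN x ix vx ne.
    by case/negP: nve; rewrite -xe vx; apply/eqP.
  + move=> x; rewrite /attached => /orP[/eqP -> //|/eqP bx].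
    by have [vx ne] := vchild _ bx; rewrite (top x vx).
  + by move=> _; exists z; rewrite // vz above_refl.
Qed.

Lemma spanning_leaf_hit (R T : Omega) (r : hom R T) y :
  spanning r -> is_leaf y -> exists2 z, is_leaf z & r z = y.
Proof.
move=> [r1 r2] ly; have ry : above (r root) y by rewrite r1; apply: above_root.
have [z [lz _ zy]] := hom_leaf ly ry.
by exists z => //; rewrite (above_leaf (r2 z lz) zy).
Qed.

Lemma full_hit (R T : Omega) (e : edge T) (r : hom R T) x :
  full e r -> x <> e -> exists y, r y = x.
Proof.
move=> [rs r3] xe; have [r1 _] := rs.
case: (boolP (is_leaf x)) => [/(spanning_leaf_hit rs) [z _ <-]|lx]; first by exists z.
case: (eqVneq x root) => [->|/eqP xr]; first by exists root.
by apply: r3 => //; apply: innerI.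
Qed.

(** If R has an inner edge, an arrow outside the horn there misses at most that edge. Otherwise R is
    [eta] or a corolla, where an arrow with the wrong root or leaves is constant. *)
Lemma inj_face (U R : Omega) (m : hom U R) : injective m -> ~ is_iso m ->
  exists (f : face R) (s : hom U (face_tree f)), m = face_map f \oc s.
Proof.
move=> mi niso; case: (boolP [exists e, @inner R e]) => [/existsP [e ie]|noinner].
  pose e' : inner_edge R := exist _ e ie.
  case: (excluded_middle_informative (in_horn e' m)) => [[f [s [_ ms]]]|].
    by exists f, s.
  move=> /not_horn_full mF; have [[_ ml] _] := mF.
  case: (boolP [exists x, m x == e]) => [/existsP [x /eqP xe]|no].
    case: niso; apply: inj_iso => // y; case: (eqVneq y e) => [->|/eqP].
      by exists x.
    exact: full_hit mF.
  have [x|s ms] := @inner_factor U R m e'; last by exists (InnerFace e'), s.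
  by move=> xe; case/negP: no; apply/existsP; exists x; apply/eqP.
have lr (x : edge R) : x <> root -> is_leaf x.
  move=> xr; apply: contraR noinner => lx; apply/existsP; exists x.
  exact: innerI.
have const (a : edge R) : (exists z : edge U, is_leaf z) ->
    (forall x, m x = a) -> ~~ is_leaf (@root R) ->
    exists (f : face R) (s : hom U (face_tree f)), m = face_map f \oc s.
  move=> lz ma rl; have [s ms] := edge_factor lz ma.
  have R1 : #|vert R| = 1.
    rewrite -card_nleaf; apply/eqP/cards1P; exists root; apply/setP => x.
    rewrite !inE; apply/idP/eqP => [|-> //].
    by apply: contraNeq => /eqP /lr.
  by exists (EdgeFace R1 a), s.
case: (eqVneq (m root) root) => [mr|/eqP mr]; last first.
  have lm := lr _ mr.
  have lU : exists z : edge U, is_leaf z.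
    by have [z [lz _ _]] := hom_leaf lm (above_refl _); exists z.
  apply: (const (m root)) => // [x|].
    by apply: above_leaf lm _; apply: hom_above; apply: above_root.
  by apply/negP => lroot; apply: mr; apply: above_leaf lroot (above_root _).
case: (boolP [exists z, is_leaf z && ~~ is_leaf (m z)]) => [/existsP [z]|no].
  move=> /andP[lz lmz]; have mz : m z = root.
    by apply/eqP; apply: contraNT lmz => /eqP; apply: lr.
  apply: (const root) => [|x|]; [by exists z | | by rewrite -mz].
  rewrite -mz; congr (m _); apply: (above_leaf lz); apply: (hom_inj_above mi).
  by rewrite mz; apply: above_root.
have ml z : is_leaf z -> is_leaf (m z).
  by move=> lz; apply: contraR no => lmz; apply/existsP; exists z; rewrite lz.
case: niso; apply: inj_iso => // y; case: (eqVneq y root) => [->|/eqP /lr ly].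
  by exists root.
have ry : above (m root) y by rewrite mr; apply: above_root.
have [z [lz _ zy]] := hom_leaf ly ry.
by exists z; rewrite (above_leaf (ml z lz) zy).
Qed.

Lemma card_face (T : tree) (f : face T) : #|vert (face_tree f)| < #|vert T|.
Proof.
case: f => [e|v|E x] /=; last by rewrite card_void E.
- have [v [w [_ we _]]] := innerP (valP e).
  rewrite card_sig; apply: (@leq_trans #|predT : pred (vert T)|) => //.
  apply: proper_card; apply/properP; split; first by apply/subsetP.
  by exists w => //; rewrite inE we eqxx.
- rewrite card_sig; apply: (@leq_trans #|predT : pred (vert T)|) => //.
  apply: proper_card; apply/properP; split; first by apply/subsetP.
  by exists (val v) => //; rewrite inE eqxx.
Qed.

(** With the converse below, compositions of faces and isomorphisms become injective maps of edges.
    Splitting off faces ends because each has fewer vertices. *)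
Lemma inj_face_mono (U R : Omega) (m : hom U R) : injective m -> face_mono m.
Proof.
have [n] := ubnP #|vert R|; elim: n R m => // n IH R m le_n mi.
case: (excluded_middle_informative (is_iso m)) => [|niso]; first exact: mono_iso.
have [f [s ms]] := inj_face mi niso; rewrite ms.
apply: mono_cmp; first exact: mono_face.
apply: IH; first exact: leq_trans (card_face f) _.
by move=> x y xy; apply: mi; rewrite ms /= xy.
Qed.

Lemma face_mono_inj (U R : tree) (m : @hom Omega U R) :
  face_mono m -> injective m.
Proof.
elim=> {U R m} [T f|S T f|R S T g f _ gi _ fi].
- exact: face_map_inj.
- exact: iso_inj.
- exact: inj_comp gi fi.
Qed.

Lemma sub_tree_order (T : tree) (A : pred (edge T)) (L : pred {x | A x})
    (r0 : {x | A x}) :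
  (forall x, A x -> above (val r0) x) ->
  (forall x y, L x -> above (val x) (val y) -> x = y) ->
  is_tree_order (fun x y : {x | A x} => above (val x) (val y)) L r0.
Proof.
move=> rA LA; split => //.
- by move=> x; apply: above_refl.
- by move=> x y xy yx; apply: val_inj; apply: above_anti.
- by move=> y x z; apply: above_trans.
- by move=> x; apply: rA; apply: (valP x).
- by move=> x y z; apply: above_comparable.
Qed.

(* Dropping the input of a unary vertex whose two edges have the same image
   gives a retract of Q through which the map factors. *)
Lemma split_unary (Q R : Omega) (q : hom Q R) : ~ injective q ->
  exists (Q' : Omega) (s : hom Q' Q) (d : hom Q Q'),
    [/\ d \oc s = idc Q', q = q \oc s \oc d & #|edge Q'| < #|edge Q|].
Proof.
move=> qi; have [y [v [by_ qy]]] : exists y v, below y = Some v /\ q (out v) = q y.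
  have [x [y [xy ne qxy]]] : exists x y, [/\ above x y, x <> y & q x = q y].
    case: (excluded_middle_informative
      (exists x y, [/\ above x y, x <> y & q x = q y])) => // no.
    case: qi => x y qxy; case: (eqVneq x y) => // /eqP ne; case: no.
    have xy : above (q x) (q y) by rewrite qxy above_refl.
    case: (hom_comparable xy) => [?|?]; first by exists x, y.
    by exists y, x; split=> // yx; apply: ne.
  case: (above_cases xy) => [yx|[v [z [vx bz zy]]]]; first by case: ne.
  exists z, v; split=> //; rewrite vx; apply: above_anti; last first.
    by rewrite qxy; apply: hom_above.
  by rewrite -vx; apply: hom_above; apply: above_below bz (above_refl _).
pose p := out v.
have py : p <> y.
  by move=> E; have := above_outN by_; rewrite -E above_refl.
(* The vertex v is unary: another input z has its image above [q (out v) = q y], so z and y are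
   comparable inputs of one vertex. *)
have only_y z : below z = Some v -> z = y.
  move=> bz;
  have yz : above (q y) (q z).
    by rewrite -qy; apply: hom_above; apply: above_below bz (above_refl _).
  case: (hom_comparable yz) => [yz'|zy].
    exact: siblings_disjoint bz by_ (above_refl z) yz'.
  exact: siblings_disjoint bz by_ zy (above_refl y).
have above_p z : above p z -> z = p \/ above y z.
  case/above_cases => [|[v' [x [/out_inj vv' bx xz]]]]; first by left.
  by right; rewrite -(only_y x) // -vv'.
have above_y z : above z y -> z = y \/ above z p.
  move=> zy; case: (above_comparable zy (above_below by_ (above_refl y))).
    by right.
  case/above_p => [->|yz]; first by right; apply: above_refl.
  by left; apply: above_anti.
have py' : above p y by apply: above_below by_ (above_refl y).
pose A := fun x : edge Q => x != y.
have pA : A p by apply/eqP.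
have yr : A root by apply/eqP => E; rewrite -E below_rootE in by_.
(* If the dropped input is a leaf, the output of its vertex takes over that role. *)
pose L (x : {x | A x}) := is_leaf (val x) || (is_leaf y && (val x == p)).
have oP : is_tree_order (fun x y : {x | A x} => above (val x) (val y)) L
    (exist _ root yr).
  apply: sub_tree_order => [x _|x z]; first exact: above_root.
  case/orP => [lx|/andP[ly /eqP xp]] xz; apply: val_inj.
    by rewrite (above_leaf lx xz).
  rewrite xp in xz *; case/above_p: xz => // /(above_leaf ly) zy.
  by have := valP z; rewrite /A zy eqxx.
pose Q' := tree_of_order oP.
pose d x : {x | A x} := insubd (exist _ p pA) x.
have dE x : val (d x) = if x == y then p else x.
  by rewrite val_insubd /A; case: eqP.
have sP : @tree_map Q' Q (fun x => val x).
  split=> [x z|x z|z lz _]; rewrite ?tree_of_order_above //; first by left.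
  case: (eqVneq z y) => [zy|zy].
    exists (exist _ p pA); last by rewrite /= zy.
    by rewrite tree_of_order_leaf /L eqxx andbT -zy lz orbT.
  exists (exist _ z zy); last exact: above_refl.
  by rewrite tree_of_order_leaf /L /= lz.
have dP : @tree_map Q Q' d.
  split=> [x z|x z|z]; rewrite ?tree_of_order_above ?dE.
  - move=> xz; case: eqP => xy; case: eqP => zy; subst => //.
    + exact: above_refl.
    + exact: above_trans py' xz.
    + by case: (above_y _ xz).
  - case: eqP => xy; case: eqP => zy; subst.
    + by left; apply: above_refl.
    + by case/above_p => [->|]; [right | left].
    + by move=> xp; left; apply: above_trans xp py'.
    + by left.
  - rewrite tree_of_order_leaf => /orP[lz _|/andP[ly /eqP zp] _].
      exists (val z) => //; rewrite tree_of_order_above dE.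
      by have /negbTE -> := valP z; apply: above_refl.
    by exists y => //; rewrite tree_of_order_above dE eqxx zp above_refl.
exists Q', (hom_of sP), (hom_of dP); split.
- apply: hom_eq => x; apply: val_inj; rewrite [LHS]dE.
  by have /negbTE -> := valP x.
- by apply: hom_eq => x; rewrite /= dE; case: eqP => // ->.
- by rewrite /= card_sig; apply: (@leq_trans #|predT : pred (edge Q)|) => //;
    apply: proper_card; apply/properP; split; [apply/subsetP |
      exists y => //; rewrite inE /A eqxx].
Qed.

Lemma mono_split_factor (Q R : Omega) (q : hom Q R) :
  exists (U : Omega) (m : hom U R) (d : hom Q U) (s : hom U Q),
    [/\ injective m, d \oc s = idc U & q = m \oc d].
Proof.
have [n] := ubnP #|edge Q|; elim: n Q q => // n IH Q q le_n.
case: (excluded_middle_informative (injective q)) => [qi|].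
  by exists Q, q, (idc Q), (idc Q); split; rewrite // ?cmpc1.
move=> /split_unary [Q' [s [d [ds qE lt]]]].
have [U [m [d' [s' [mi d's' qsE]]]]] := IH Q' (q \oc s) (leq_trans lt le_n).
exists U, m, (d' \oc d), (s \oc s'); split=> //.
- by rewrite -cmpA (cmpA d) ds cmp1c.
- by rewrite qE qsE cmpA.
Qed.

Lemma inj_monic (P U R : Omega) (m : hom U R) (f g : hom P U) :
  injective m -> m \oc f = m \oc g -> f = g.
Proof.
by move=> mi fg; apply: hom_eq => x; apply: mi; apply: (hom_congr x fg).
Qed.

Lemma nattrans_eq (C : category) (X Y : presheaf C) (f g : nattrans X Y) :
  (forall a x, f a x = g a x) -> f = g.
Proof.
case: f g => [f fP] [g gP] /= fg; have E : f = g.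
  apply: functional_extensionality_dep => a.
  by apply: functional_extensionality => x.
by subst g; congr NatTrans; apply: proof_irrelevance.
Qed.

Definition yoneda_map (Y : dset) (R : Omega) (a : Y R) :
    nattrans (representable R) Y :=
  @NatTrans Omega (representable R) Y (fun U r => pmap Y r a)
    (fun U V u r => pmap_cmp r u a).

Lemma yoneda_eq (Y : dset) (R : Omega) (f : nattrans (representable R) Y) :
  f = yoneda_map (f R (idc R)).
Proof.
apply: nattrans_eq => U r; rewrite /= -nob_nat; congr (f U _).
exact: esym (cmp1c _).
Qed.

Lemma strict_fill_eq (Y : dset) (R : Omega) (e : inner_edge R) (a b : Y R) :
  strict_inner_Kan Y ->
  (forall f : face R, f <> InnerFace e ->
     pmap Y (face_map f) a = pmap Y (face_map f) b) -> a = b.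
Proof.
move=> /(_ R e) [Yi _] ab.
have /Yi E : horn_restriction e (yoneda_map a) = horn_restriction e (yoneda_map b).
  apply: nattrans_eq => U [q qh] /=; have [f [s [fe ->]]] := qh.
  by rewrite !pmap_cmp ab.
have := congr1 (fun h : nattrans (representable R) Y => h R (idc R)) E.
by rewrite /= !pmap_id.
Qed.

(* By the factorization of arrows into a split epimorphism and a
   monomorphism, a map out of a horn may be prescribed on monomorphisms. *)
Lemma horn_fill (Y : dset) (R : Omega) (e : inner_edge R)
    (P : forall U : Omega, hom U R -> Y U -> Prop) :
  inner_Kan Y ->
  (forall U (m : hom U R), injective m -> in_horn e m -> exists b, P U m b) ->
  (forall U (m : hom U R) b b', P U m b -> P U m b' -> b = b') ->
  (forall U (m : hom U R) V (a : hom V U) b, injective m -> injective a ->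
     P U m b -> P V (m \oc a) (pmap Y a b)) ->
  exists z : Y R, forall U (m : hom U R),
    injective m -> in_horn e m -> P U m (pmap Y m z).
Proof.
move=> YK Pex Puniq Pcompat.
(* Graph of the extension to all arrows: the value at q is pulled back from its monomorphic part.
   The section s serves to compare two factorizations of q. *)
pose G (Q : Omega) (q : hom Q R) (y : Y Q) :=
  exists (U : Omega) (m : hom U R) (d : hom Q U) (s : hom U Q) (b : Y U),
    [/\ injective m, d \oc s = idc U, q = m \oc d, P U m b & y = pmap Y d b].
have Gex Q (q : hom Q R) : in_horn e q -> exists y, G Q q y.
  move=> qh; have [U [m [d [s [mi ds qE]]]]] := mono_split_factor q.
  have mh : in_horn e m.
    have -> : m = q \oc s by rewrite qE -cmpA ds cmpc1.
    exact: in_horn_cmp.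
  have [b Pb] := Pex U m mi mh.
  by exists (pmap Y d b), U, m, d, s, b.
have Guniq Q (q : hom Q R) y y' : G Q q y -> G Q q y' -> y = y'.
  move=> [U [m [d [s [b [mi ds qE Pb ->]]]]]].
  move=> [U' [m' [d' [s' [b' [mi' ds' qE' Pb' ->]]]]]].
  have mE : m' \oc (d' \oc s) = m by rewrite cmpA -qE' qE -cmpA ds cmpc1.
  have ti : injective (d' \oc s).
    by move=> x x' xx'; apply: mi; rewrite -mE /= [d' _]xx'.
  have bE : b = pmap Y (d' \oc s) b'.
    by apply: Puniq Pb _; rewrite -mE; apply: Pcompat.
  rewrite bE -pmap_cmp; congr (pmap Y _ b').
  by apply: (inj_monic mi'); rewrite cmpA mE -qE.
have Gnat Q Q' (q : hom Q R) (p : hom Q' Q) y :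
    G Q q y -> G Q' (q \oc p) (pmap Y p y).
  move=> [U [m [d [s [b [mi ds qE Pb ->]]]]]].
  have [U' [m' [d' [s' [mi' ds' dpE]]]]] := mono_split_factor (d \oc p).
  exists U', (m \oc m'), d', s', (pmap Y m' b); split=> //.
  - by move=> x x' /mi /mi'.
  - by rewrite qE -cmpA dpE cmpA.
  - exact: Pcompat.
  - by rewrite -!pmap_cmp dpE.
pose h Q (q : inner_horn e Q) : Y Q :=
  sval (constructive_indefinite_description _ (Gex Q (sval q) (svalP q))).
have hP Q (q : inner_horn e Q) : G Q (sval q) (h Q q).
  by rewrite /h; case: constructive_indefinite_description.
have hnat Q' Q (p : hom Q' Q) (q : inner_horn e Q) :
    h Q' (pmap (inner_horn e) p q) = pmap Y p (h Q q).
  by apply: (Guniq Q' (sval q \oc p)); 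
    [exact: (hP _ (pmap (inner_horn e) p q)) | exact: Gnat].
have [z zE] := YK R e (NatTrans hnat).
exists (z R (idc R)) => U m mi mh.
rewrite -nob_nat (_ : pmap (representable R) m (idc R) = m); last exact: cmp1c.
have -> : z U m = h U (exist (@in_horn R e U) m mh).
  exact: (congr1 (fun f : nattrans (inner_horn e) Y =>
    f U (exist (@in_horn R e U) m mh)) zE).
have [b Pb] := Pex U m mi mh.
rewrite (_ : h U _ = b) //; apply: (Guniq U m).
  exact: (hP _ (exist (@in_horn R e U) m mh)).
by exists U, m, (idc U), (idc U), b; split; rewrite // ?cmpc1 ?pmap_id.
Qed.

(** * The arrows between input objects *)

Section InputMap.

Variable S : cartesian.
Implicit Types T R U : Omega.

Notation N := (nerve (cart_operad S)).

(** The component of [input_map] at an edge, here for every edge of T: functoriality passes through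
    edges that are not leaves. *)
Definition branch_eval T (t : N T) (x : edge T) : hom (input_obj t) (t x) :=
  mop t (crown x) \oc cpair (fun m : leaves_above x =>
    cproj (fun l : leaves T => t (val l)) (leaf_of_above m)).

(** Grafting the crowns of the inputs on o gives the crown of e, up to the bijection g of leaves;
    there is at most one operation with given inputs and output. The map t carries this equation to
    [S]. *)
Lemma branch_eval_op T (t : N T) (I : finType) (c : I -> edge T) (e : edge T)
    (o : op (Omega_operad T) c e) :
  mop t o \oc cpair (fun i => branch_eval t (c i)) = branch_eval t e.
Proof.
have [o1 o2 o3] := Omega_op_cut o.
pose J : finType := {i : I & leaves_above (c i)}.
have gP (x : J) : is_leaf (val (tagged x)) && above e (val (tagged x)).
  case: x => [i [y /= /andP[ly cy]]]; rewrite ly /=.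
  exact: above_trans (o1 i) cy.
pose g (x : J) : leaves_above e := exist _ (val (tagged x)) (gP x).
have bg : bijective g.
  apply: inj_surj_bij => [[i y] [i' y'] E|[y yP]].
    have {}E : val y = val y' := congr1 val E.
    have ii' : i = i'.
      have [/andP[_ iy] /andP[_ iy']] := (valP y, valP y').
      by rewrite -E in iy'; case: (above_comparable iy iy') => /o2.
    by subst i'; congr existT; apply: val_inj.
  have /andP[ly ey] := yP; have [i iy] := o3 y ly ey.
  have yP' : is_leaf y && above (c i) y by rewrite ly.
  by exists (existT _ i (exist _ y yP')); apply: val_inj.
have cE : crown e = @oact (Omega_operad T) J (leaves_above e) g bg
    (fun x => val x) e
    (@ocomp (Omega_operad T) I (fun i => leaves_above (c i)) (fun i y => val y)
       c e o (fun i => crown (c i))).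
  exact: (proof_irrelevance (Omega_op _ _)).
rewrite /branch_eval cE (map_oact (mopP t)) (map_ocomp (mopP t)) /=.
rewrite /cart_act /cart_comp -!cmpA !cpair_cmp; congr cmp.
apply: cpair_ext => i; rewrite -!cmpA !cpair_cmp; congr cmp.
apply: cpair_ext => y; apply: esym.
refine (etrans (@cproj_pair S J (fun x => t (val (tagged x))) _ _
  (existT _ i y)) _).
refine (etrans (@cproj_pair S (leaves_above e) (fun x => t (val x)) _ _
  (g (existT _ i y))) _).
rewrite /leaf_of_above; move: (leaf_of_above_subproof _) => p.
by move: (leaf_of_above_subproof _) => p'; rewrite (bool_irrelevance p p').
Qed.

Lemma cproj_leaf T (f : edge T -> S) (l : leaves T) (p : is_leaf (val l)) :
  cproj (fun l : leaves T => f (val l)) (exist _ (val l) p) =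
  cproj (fun l : leaves T => f (val l)) l.
Proof. by case: l p => l lP p; rewrite (bool_irrelevance p lP). Qed.

Lemma branch_eval_leaf T (t : N T) (l : leaves T) :
  branch_eval t (val l) = cproj (fun l : leaves T => t (val l)) l.
Proof.
have lP : is_leaf (val l) && above (val l) (val l).
  by rewrite (valP l) above_refl.
pose g (u : unit) : leaves_above (val l) := exist _ (val l) lP.
have bg : bijective g.
  apply: inj_surj_bij => [[] []|[y yP]] //; exists tt; apply: val_inj => /=.
  by have /andP[_ ly] := yP; rewrite (above_leaf (valP l) ly).
have cE : crown (val l) = @oact (Omega_operad T) unit (leaves_above (val l)) g
    bg (fun x => val x) (val l) (oid (val l : col (Omega_operad T))).
  exact: (proof_irrelevance (Omega_op _ _)).
rewrite /branch_eval cE (map_oact (mopP t)) (map_oid (mopP t)) /= /cart_act.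
rewrite -!cmpA cpair_cmp cproj_pair.
refine (etrans (@cproj_pair S (leaves_above (val l)) (fun x => t (val x)) _ _
  (g tt)) _).
exact: cproj_leaf.
Qed.

Lemma input_mapE U T (a : hom U T) (t : N T) :
  input_map a t = cpair (fun l : leaves U => branch_eval t (a (val l))).
Proof. by []. Qed.

Lemma input_map_branch U T (a : hom U T) (t : N T) (x : edge U) :
  branch_eval (pmap N a t) x \oc input_map a t = branch_eval t (a x).
Proof.
rewrite {1}/branch_eval -cmpA input_mapE cpair_cmp.
rewrite -[RHS](branch_eval_op t (mop a (crown x))) /=; congr cmp.
apply: cpair_ext => m.
exact: (@cproj_pair S (leaves U) (fun l => t (a (val l))) _ _ (leaf_of_above m)).
Qed.

Lemma input_map_cmp P U T (b : hom P U) (a : hom U T) (t : N T) :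
  input_map (a \oc b) t = input_map b (pmap N a t) \oc input_map a t.
Proof.
rewrite [input_map b _]input_mapE cpair_cmp [LHS]input_mapE.
by apply: cpair_ext => l; rewrite input_map_branch.
Qed.

(** A spanning arrow is bijective on leaves, so the tuple only reindexes the factors. Hence the
    condition on a dendrex can be solved in either direction along such an arrow. *)
Lemma input_map_iso U T (a : hom U T) (t : N T) :
  spanning a -> is_iso (input_map a t).
Proof.
move=> aF; have [_ al] := aF.
have la (l : leaves U) : is_leaf (a (val l)) by apply: al; apply: (valP l).
have pre (l : leaves T) : {z : leaves U | a (val z) = val l}.
  apply: constructive_indefinite_description.
  have [z lz zl] := spanning_leaf_hit aF (valP l).
  by exists (exist _ z lz).
have aE (l : leaves U) : branch_eval t (a (val l)) =
    cproj (fun l : leaves T => t (val l)) (exist _ (a (val l)) (la l)).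
  exact: branch_eval_leaf t (exist _ (a (val l)) (la l)).
pose g : hom (input_obj (pmap N a t)) (input_obj t) :=
  cpair (fun l : leaves T => eq_rect (a (val (sval (pre l))))
    (fun x => hom (input_obj (pmap N a t)) (t x))
    (cproj (fun l : leaves U => t (a (val l))) (sval (pre l))) (val l)
    (svalP (pre l))).
have gE (l : leaves U) :
    cproj (fun l : leaves T => t (val l)) (exist _ (a (val l)) (la l)) \oc g =
    cproj (fun l : leaves U => t (a (val l))) l.
  refine (etrans (@cproj_pair S (leaves T) (fun l => t (val l)) _ _
    (exist _ (a (val l)) (la l))) _).
  case: (pre _) => z /= zl.
  have zE : z = l.
    apply: val_inj.
    have zz : above (a (val z)) (a (val l)) by rewrite zl above_refl.
    case: (hom_comparable zz) => [/(above_leaf (valP z)) //|].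
    by move/(above_leaf (valP l)).
  by subst z; move: (svalP _) => E; rewrite (proof_irrelevance _ E erefl).
exists g; split.
- apply: cpair_uniq => l; rewrite cmpc1 cmpA.
  refine (etrans (congr1 (fun h => h \oc _) (@cproj_pair S (leaves T)
    (fun l => t (val l)) _ _ l)) _).
  case: (pre l) => z /= zl; case: l zl => l ll /= zl; subst l => /=.
  move: (svalP _) => E; rewrite (proof_irrelevance _ E erefl) /=.
  refine (etrans (@cproj_pair S (leaves U) (fun l => t (a (val l))) _ _ z) _).
  by rewrite (bool_irrelevance ll (la z)); exact: aE.
- apply: cpair_uniq => l; rewrite cmpc1 cmpA.
  refine (etrans (congr1 (fun h => h \oc _) (@cproj_pair S (leaves U)
    (fun l => t (a (val l))) _ _ l)) _).
  exact: etrans (congr1 (fun h => h \oc g) (aE l)) (gE l).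
Qed.

End InputMap.

(** * Inserting an edge *)

Section Insertion.

Variables (R T : Omega) (c : edge T) (r : hom R T).
Hypotheses (ic : inner c) (rF : spanning r).

(* The new edge [None] is to lie over c, below all edges of R over c. *)
Definition ins_le (x y : option (edge R)) : bool :=
  match x, y with
  | Some x, Some y => above x y
  | Some x, None => above (r x) c && (r x != c)
  | None, Some y => above c (r y)
  | None, None => true
  end.

Definition ins_leaf (x : option (edge R)) : bool :=
  if x is Some x then is_leaf x else false.

Lemma ins_order : is_tree_order ins_le ins_leaf (Some root).
Proof.
have [rr rl] := rF.
(* This is transitivity through the new edge, between an edge over something strictly below c and an
   edge over something above c. *)
have cc x : above (r x) c -> r x <> c -> forall y, above c (r y) -> above x y.
  move=> xc ne y cy; case: (hom_comparable (above_trans xc cy)) => // yx.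
  by case: ne; apply: above_anti xc (above_trans cy (hom_above r yx)).
split.
- by case=> [x|] //; apply: above_refl.
- case=> [x|] [y|] //= xy yx; first by rewrite (above_anti xy yx).
    by case/andP: xy => xc /eqP ne; case: ne; apply: above_anti.
  by case/andP: yx => xc /eqP ne; case: ne; apply: above_anti.
- move=> [y|] [x|] [z|] //=.
  + exact: above_trans.
  + move=> xy /andP[yc ne]; rewrite (above_trans (hom_above r xy) yc) /=.
    apply: contraNneq ne => xc; apply/eqP; apply: above_anti yc _.
    by rewrite -xc; apply: hom_above.
  + by move=> cy yz; apply: above_trans cy (hom_above r yz).
  + by move=> /andP[xc /eqP ne] cz; apply: cc cz.
- case=> [x|] /=; first exact: above_root.
  by rewrite rr above_root /=; apply/eqP => E; apply: (inner_neq_root ic).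
- move=> [x|] [y|] [z|] //=.
  + exact: above_comparable.
  + move=> /andP[xc _] /andP[yc _].
    case: (above_comparable xc yc) => /hom_comparable; tauto.
  + move=> xz cz; have xz' := hom_above r xz.
    case: (above_comparable xz' cz) => [xc|cx]; last by right.
    by case: (eqVneq (r x) c) => [->|ne]; [right; apply: above_refl | left; rewrite xc].
  + by move=> ->; left.
  + move=> cz yz; have yz' := hom_above r yz.
    case: (above_comparable yz' cz) => [yc|cy]; last by left.
    by case: (eqVneq (r y) c) => [->|ne]; [left; apply: above_refl | right; rewrite yc].
  + by move=> _ ->; right.
  + by left.
  + by left.
- move=> [x|] [y|] //= lx; first by move=> /(above_leaf lx) ->.
  by case/andP => /(above_leaf (rl x lx)) -> ; rewrite eqxx.
Qed.

Definition ins_tree : Omega := tree_of_order ins_order.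
Definition ins_mark : edge ins_tree := None.

Lemma ins_incl_tree_map : @tree_map R ins_tree Some.
Proof.
split=> [x y|x y|y]; rewrite ?tree_of_order_above //; first by left.
case: y => [y|]; rewrite tree_of_order_leaf //= => ly _.
by exists y; rewrite ?above_refl.
Qed.

Definition ins_incl : hom R ins_tree := hom_of ins_incl_tree_map.

Lemma ins_map_tree_map :
  @tree_map ins_tree T (fun x => if x is Some x then r x else c).
Proof.
split=> [x y|x y|y ly ry].
- rewrite tree_of_order_above; case: x y => [x|] [y|] //=.
  + exact: hom_above.
  + by case/andP.
  + by rewrite above_refl.
- rewrite !tree_of_order_above; case: x y => [x|] [y|] //=.
  + exact: hom_comparable.
  + move=> xc; case: (eqVneq (r x) c) => [->|ne].
      by right; apply: above_refl.
    by left; rewrite xc.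
  + by left.
  + by left.
- have [z lz <-] := spanning_leaf_hit rF ly.
  by exists (Some z); rewrite ?tree_of_order_leaf ?above_refl.
Qed.

Definition ins_map : hom ins_tree T := hom_of ins_map_tree_map.

Lemma ins_map_incl : ins_map \oc ins_incl = r.
Proof. exact: hom_eq. Qed.

Lemma ins_incl_inj : injective ins_incl.
Proof. by move=> x y []. Qed.

(** By [full_not_horn], R is thus the face that the horn at the new edge leaves out. *)
Lemma ins_incl_full : full ins_mark ins_incl.
Proof.
split=> [|[x|] _ //]; last by exists x.
split=> [|z lz].
- by apply: esym; apply: above_root_eq; rewrite tree_of_order_above; apply: above_root.
- by rewrite tree_of_order_leaf.
Qed.

Lemma ins_mark_inner : inner ins_mark.
Proof.
by apply: innerI; rewrite ?tree_of_order_leaf //; case: ins_incl_full => -[<-].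
Qed.

End Insertion.

(** * Extending a compatible family of elements *)

Section Families.

Variables (S : cartesian) (X : diagram S).
Notation N := (nerve (cart_operad S)).

Definition point (R : Omega) : Type := {s : S & X s R}.

(* Condition (b) in the definition of a dendrex, for an element a over u and
   an element b over the pullback of u along f. *)
Definition restricts (R : Omega) (u : N R) (U : Omega) (f : hom U R)
    (a : point R) (b : point U) : Prop :=
  exists x y, [/\ a = existT (fun s => X s R) (input_obj u) x,
    b = existT (fun s => X s U) (input_obj (pmap N f u)) y &
    pmap (X _) f x = dmap X (input_map f u) U y].

Lemma dmap_inj (s s' : S) (h : hom s s') (U : Omega) :
  is_iso h -> injective (dmap X h U).
Proof.
case=> g [_ hg] y y' yy'; have := congr1 (dmap X g U) yy'.
have gK z : dmap X g U (dmap X h U z) = z.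
  exact: (etrans (congr1 (fun f : nattrans _ (X s') => f U z)
    (esym (dmap_cmp X h g))) (etrans (congr1 (fun k => dmap X k U z) hg)
    (congr1 (fun f : nattrans _ (X s') => f U z) (dmap_id X s')))).
by rewrite !gK.
Qed.

Lemma dmap_surj (s s' : S) (h : hom s s') (U : Omega) (y : X s U) :
  is_iso h -> exists z, dmap X h U z = y.
Proof.
case=> g [gh _]; exists (dmap X g U y).
exact: (etrans (congr1 (fun f : nattrans _ (X s) => f U y)
  (esym (dmap_cmp X g h))) (etrans (congr1 (fun k => dmap X k U y) gh)
  (congr1 (fun f : nattrans _ (X s) => f U y) (dmap_id X s)))).
Qed.

Lemma dmap_input_map_cmp (R : Omega) (u : N R) (U V : Omega) (f : hom U R)
    (g : hom V U) (z : X (input_obj (pmap N (f \oc g) u)) V) :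
  dmap X (input_map (f \oc g) u) V z =
  dmap X (input_map f u) V (dmap X (input_map g (pmap N f u)) V z).
Proof.
rewrite (input_map_cmp g f u).
exact: (congr1 (fun k : nattrans _ (X (input_obj u)) => k V z)
  (dmap_cmp X (input_map g (pmap N f u)) (input_map f u))).
Qed.

(** The arrow of input objects over a spanning f is invertible and cancels. In this way the missing
    face of a filler inherits its restrictions from the filler. *)
Lemma restricts_cancel (R : Omega) (u : N R) (U V : Omega) (f : hom U R)
    (g : hom V U) a b c :
  spanning f -> restricts u f a b -> restricts u (f \oc g) a c ->
  restricts (pmap N f u) g b c.
Proof.
move=> fs [x [y [aE -> xy]]] [x' [z [aE' -> xz]]].
have {aE aE'} xx' : x = x' by rewrite aE in aE'; apply: inj_pair2 aE'.
subst x'; exists y, z; split=> //.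
apply: (dmap_inj (input_map_iso u fs)).
by rewrite nob_nat -xy -pmap_cmp xz dmap_input_map_cmp.
Qed.

Lemma restricts_ex (R : Omega) (u : N R) (U : Omega) (f : hom U R) a :
  spanning f -> tag a = input_obj u -> exists b, restricts u f a b.
Proof.
case: a => s x fs /= sE; subst s.
have [y yE] := dmap_surj (pmap (X _) f x) (input_map_iso u fs).
by exists (existT (fun s => X s U) (input_obj (pmap N f u)) y), x, y.
Qed.

Lemma restricts_uniq (R : Omega) (u : N R) (U : Omega) (f : hom U R) a b b' :
  spanning f -> restricts u f a b -> restricts u f a b' -> b = b'.
Proof.
move=> fs [x [y [aE -> xy]]] [x' [z [aE' -> xz]]].
have {aE aE'} xx' : x = x' by rewrite aE in aE'; apply: inj_pair2 aE'.
subst x'; congr existT; apply: (dmap_inj (input_map_iso u fs)).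
by rewrite -xy xz.
Qed.

Lemma restricts_tag (R : Omega) (u : N R) (U : Omega) (f : hom U R) a b :
  restricts u f a b -> tag a = input_obj u.
Proof. by case=> x [y [-> _ _]]. Qed.

(** Values form a relation and not a function, so that they can be added in stages and united over
    all stages. *)
Record is_family (T : Omega) (t : N T) (D : forall R : Omega, hom R T -> Prop)
    (xi : forall R : Omega, hom R T -> point R -> Prop) : Prop := IsFamily {
  fam_fun : forall (R : Omega) (r : hom R T) a a', xi R r a -> xi R r a' -> a = a';
  fam_dom : forall (R : Omega) (r : hom R T), D R r <-> exists a, xi R r a;
  fam_res : forall (R U : Omega) (r : hom R T) (f : hom U R) a,
    injective f -> xi R r a ->
    exists2 b, xi U (r \oc f) b & restricts (pmap N r t) f a b }.

End Families.

(** * Embeddings that omit at most the marked edge *)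

Section Embedding.

Variables (T : Omega) (c : edge T).

Definition once (R : Omega) (r : hom R T) : Prop :=
  forall x y, r x = c -> r y = c -> x = y.

(** When c occurs at most once in [R0], such a j is an isomorphism or, up to isomorphism, the inner
    face at that occurrence. *)
Record embeds (R R0 : Omega) (r : hom R T) (r0 : hom R0 T) (j : hom R R0) :
    Prop := Embeds {
  emb_inj : injective j;
  emb_over : r0 \oc j = r;
  emb_spanning : spanning j;
  emb_hit : forall x, r0 x <> c -> exists u, j u = x }.

Definition marked (R0 : Omega) (r0 : hom R0 T) : Prop :=
  exists x, r0 x = c.

(** An edge omitted by j goes to the occurrence k of c in [R1]. Images in T settle comparability,
    and a fibre of r0 either comes wholly from U or is the single occurrence of c. *)
Lemma embeds_extend (U R0 R1 : Omega) (r0 : hom R0 T) (r1 : hom R1 T)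
    (j : hom U R0) (m : hom U R1) :
  once r0 -> once r1 -> spanning r1 -> marked r1 -> embeds (r0 \oc j) r0 j ->
  injective m -> r1 \oc m = r0 \oc j -> spanning (r0 \oc j) ->
  exists p : hom R0 R1, [/\ injective p, r1 \oc p = r0, p \oc j = m &
    forall x, r0 x = c -> r1 (p x) = c].
Proof.
move=> r0c r1c r1s [k kc] [ji _ js hit] mi mE rs.
have mE' u : r1 (m u) = r0 (j u) := hom_congr u mE.
pose f x := if [pick u | j u == x] is Some u then m u else k.
have fj u : f (j u) = m u.
  rewrite /f; case: pickP => [u' /eqP /ji -> //|/(_ u)]; by rewrite eqxx.
have fP x : (exists2 u, j u = x & f x = m u) \/ r0 x = c /\ f x = k.
  rewrite /f; case: pickP => [u /eqP ux|no]; first by left; exists u.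
  right; split=> //; apply/eqP; apply: contraT => /eqP /hit [u /eqP ux].
  by rewrite no in ux.
have fr x : r1 (f x) = r0 x.
  by case: (fP x) => [[u <- ->]|[-> -> //]].
have fibre x y : r0 x = r0 y -> above x y -> above (f x) (f y).
  move=> xy le; case: (fP x) (fP y) => [[u ux ->]|[xc fx]] [[u' uy ->]|[yc fy]].
  - by apply: hom_above; apply: (hom_inj_above ji); rewrite ux uy.
  - have xc : r0 x = c by rewrite xy.
    by rewrite -fj ux (r0c _ _ xc yc) above_refl.
  - have yc : r0 y = c by rewrite -xy.
    by rewrite -(fj u') uy (r0c _ _ xc yc) above_refl.
  - by rewrite fx fy above_refl.
have fT : tree_map f.
  split=> [x y xy|x y xy|y ly fy].
  - have := hom_above r0 xy; rewrite -!fr => fxy.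
    case: (hom_comparable fxy) => // fyx; apply: (fibre _ _ _ xy).
    apply: above_anti; first exact: hom_above.
    by rewrite -!fr; apply: hom_above.
  - by have := hom_above r1 xy; rewrite !fr; apply: hom_comparable.
  - have [_ r1l] := r1s.
    have [z lz zE] := spanning_leaf_hit rs (r1l y ly).
    exists (j z); first by case: js => _; apply.
    rewrite fj; have zy : above (r1 (m z)) (r1 y) by rewrite mE' -zE above_refl.
    by case: (hom_comparable zy) => // /(above_leaf ly) ->; apply: above_refl.
have fi : injective f.
  move=> x y xy; have rxy : r0 x = r0 y by rewrite -!fr xy.
  case: (eqVneq (r0 x) c) => [xc|/eqP xc]; first by apply: r0c; rewrite -?rxy.
  have yc : r0 y <> c by rewrite -rxy.
  have [[u ux] [u' uy]] := (hit x xc, hit y yc).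
  by move: xy; rewrite -ux -uy !fj => /mi ->.
exists (hom_of fT); split=> //; try exact: hom_eq.
by move=> x xc; rewrite /= fr.
Qed.

(** The map p permutes each fibre of r, a finite chain, in order. In the induction from the top, a
    moved x has its image or its preimage strictly above it; that edge is fixed, which is absurd. *)
Lemma endo_id (R : Omega) (r : hom R T) (p : hom R R) :
  injective p -> r \oc p = r -> p = idc R.
Proof.
move=> pi pr; have [q qp pq] := injF_bij pi.
have pr' x : r (p x) = r x := hom_congr x pr.
apply: hom_eq => x /=; elim/tree_ind_up: x => x IH.
have xx : above (r (p x)) (r x) by rewrite pr' above_refl.
have [px|xp] := hom_comparable xx.
  case: (eqVneq x (p x)) => // /eqP ne.
  have lt : above x (q x) by apply: (hom_inj_above pi); rewrite pq.
  case: (eqVneq x (q x)) => [xq|/eqP nq]; first by rewrite {1}xq pq.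
  by have := IH _ lt nq; rewrite pq => E; case: nq.
case: (eqVneq x (p x)) => // /eqP ne.
by apply: pi; apply: IH.
Qed.

Lemma embeds_uniq (R R0 : Omega) (r : hom R T) (r0 : hom R0 T)
    (j j' : hom R R0) :
  once r0 -> spanning r0 -> marked r0 -> spanning r ->
  embeds r r0 j -> embeds r r0 j' -> j = j'.
Proof.
move=> o0 s0 m0 sr e e'; have re := emb_over e; subst r.
have [p [pi pr pj _]] := embeds_extend o0 o0 s0 m0 e (emb_inj e') (emb_over e') sr.
by rewrite -pj (endo_id pi pr) cmp1c.
Qed.

End Embedding.

Lemma spanning_left (P U R : Omega) (f : hom U R) (g : hom P U) :
  spanning g -> spanning (f \oc g) -> spanning f.
Proof.
move=> gs [fg1 fg2]; have [g1 _] := gs; split; first by rewrite -g1.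
by move=> z /(spanning_leaf_hit gs) [y ly <-]; apply: fg2.
Qed.

Lemma spanning_cmp (P U R : Omega) (f : hom U R) (g : hom P U) :
  spanning f -> spanning g -> spanning (f \oc g).
Proof.
by move=> [f1 f2] [g1 g2]; split=> [|z /g2 /f2 //]; rewrite -f1 -g1.
Qed.

Lemma inj_card_vert (U R : Omega) (m : hom U R) :
  injective m -> #|vert U| <= #|vert R|.
Proof.
move=> mi; rewrite -!card_nleaf -(card_imset _ mi); apply: subset_leq_card.
by apply/subsetP => y /imsetP [x]; rewrite !inE => lx ->; apply: hom_nleaf.
Qed.

Lemma noniso_card_vert (U R : Omega) (m : hom U R) :
  injective m -> ~ is_iso m -> #|vert U| < #|vert R|.
Proof.
move=> mi niso; have [f [s ms]] := inj_face mi niso.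
apply: leq_ltn_trans (card_face f); apply: (@inj_card_vert _ _ s).
by move=> x y xy; apply: mi; rewrite ms /= xy.
Qed.

Lemma iso_spanning (U R : Omega) (m : hom U R) : is_iso m -> spanning m.
Proof.
move=> [g [gm mg]].
have mgE x : m (g x) = x := hom_congr x mg.
have gmE x : g (m x) = x := hom_congr x gm.
have mi : injective m by move=> x y xy; rewrite -[x]gmE xy gmE.
have gi : injective g by move=> x y xy; rewrite -[x]mgE xy mgE.
split=> [|z lz].
  apply: esym; apply: above_anti; first exact: above_root.
  by rewrite -[X in above _ X]mgE; apply: hom_above; apply: above_root.
by apply: contraT => /(hom_nleaf gi); rewrite gmE lz.
Qed.

(** * Extension by filling horns at the marked edge *)

Section Extension.

Variables (S : cartesian) (X : diagram S) (T : Omega) (c : edge T).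
Notation N := (nerve (cart_operad S)).
(** The sieve H plays the part of the horn: arrows outside it are spanning, and removing occurrences
    of c does not bring an arrow into it. *)
Variables (t : N T) (H : forall R : Omega, hom R T -> Prop).
Variable v : forall R : Omega, hom R T -> point X R -> Prop.

Hypothesis ic : inner c.
Hypothesis H_cmp : forall (R U : Omega) (r : hom R T) (f : hom U R),
  H r -> H (r \oc f).
Hypothesis H_spanning : forall (R : Omega) (r : hom R T), ~ H r -> spanning r.
Hypothesis H_hit : forall (R U : Omega) (r : hom R T) (f : hom U R),
  ~ H r -> spanning f -> (forall x, r x <> c -> exists u, f u = x) ->
  ~ H (r \oc f).
Hypothesis XK : forall s : S, inner_Kan (X s).
Hypothesis vF : is_family t H v.

Definition special (R0 : Omega) (r0 : hom R0 T) : Prop :=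
  [/\ marked c r0, once c r0 & ~ H r0].

Definition embeddable (R R0 : Omega) (r : hom R T) (r0 : hom R0 T) : Prop :=
  exists j, embeds c r r0 j.

(** The vertices counted are those of the representative and not of R, so that an arrow and its
    missing face are reached at the same stage. *)
Definition level (n : nat) (R : Omega) (r : hom R T) : Prop :=
  once c r /\ (H r \/ exists (R0 : Omega) (r0 : hom R0 T),
    [/\ special r0, embeddable r r0 & #|vert R0| <= n]).

Lemma once_cmp (R U : Omega) (r : hom R T) (f : hom U R) :
  injective f -> once c r -> once c (r \oc f).
Proof. by move=> fi ro x y xc yc; apply: fi; apply: ro. Qed.

Lemma special_exists (R : Omega) (r : hom R T) : once c r -> ~ H r ->
  exists (R0 : Omega) (r0 : hom R0 T), special r0 /\ embeddable r r0.
Proof.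
move=> ro rH; have rs := H_spanning rH.
case: (excluded_middle_informative (marked c r)) => [rm|nm].
  exists R, r; split=> //; exists (idc R); split=> //; first exact: cmpc1.
  by move=> x _; exists x.
pose r0 := ins_map ic rs; pose j := ins_incl ic rs.
have r0j : r0 \oc j = r by apply: ins_map_incl.
exists (ins_tree ic rs), r0; split; first split.
- by exists (ins_mark ic rs).
- have uniq (x : edge (ins_tree ic rs)) : r0 x = c -> x = ins_mark ic rs.
    by case: x => // x xc; case: nm; exists x.
  by move=> x y /uniq -> /uniq ->.
- by move=> /(@H_cmp _ _ _ j); rewrite r0j.
- exists j; split=> //.
  + exact: ins_incl_inj.
  + by have [] := ins_incl_full ic rs.
  + by case=> [x|] // _; exists x.
Qed.

Lemma mark_inner (R0 : Omega) (r0 : hom R0 T) x :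
  ~ H r0 -> r0 x = c -> inner x.
Proof.
move=> /H_spanning [r1 r2] xc; apply: innerI.
  by apply/negP => /r2; rewrite xc; apply/negP/inner_nleaf.
by move=> xr; apply: (inner_neq_root ic); rewrite -xc xr.
Qed.

Lemma embeds_or_horn (U R0 : Omega) (r0 : hom R0 T) (e : inner_edge R0)
    (m : hom U R0) :
  special r0 -> r0 (val e) = c -> injective m ->
  in_horn e m \/ embeds c (r0 \oc m) r0 m.
Proof.
move=> [_ o0 H0] ec mi.
case: (excluded_middle_informative (in_horn e m)) => [|/not_horn_full mF].
  by left.
right; split=> //; first by case: mF.
by move=> x xc; apply: full_hit mF _ => xe; apply: xc; rewrite xe.
Qed.

Lemma embeds_not_H (U R0 : Omega) (r : hom U T) (r0 : hom R0 T) (j : hom U R0) :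
  special r0 -> embeds c r r0 j -> ~ H r.
Proof. by move=> [_ _ H0] [_ <- js jh]; apply: H_hit. Qed.

(* Representatives of a shape are unique up to isomorphism. *)
Lemma special_map (U R0 R1 : Omega) (r : hom U T) (r0 : hom R0 T)
    (r1 : hom R1 T) (j : hom U R0) (m : hom U R1) :
  special r0 -> special r1 -> embeds c r r0 j -> injective m ->
  r1 \oc m = r ->
  exists p : hom R0 R1, [/\ injective p, r1 \oc p = r0, p \oc j = m &
    forall x, r0 x = c -> r1 (p x) = c].
Proof.
move=> s0 s1 je mi mE; have nH := embeds_not_H s0 je.
have rE := emb_over je; rewrite -rE in mE nH je.
move: s0 s1 => [m0 o0 H0] [m1 o1 H1].
exact: (embeds_extend o0 o1 (H_spanning H1) m1 je mi mE (H_spanning nH)).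
Qed.

Lemma special_card (U R0 R1 : Omega) (r : hom U T) (r0 : hom R0 T)
    (r1 : hom R1 T) :
  special r0 -> special r1 -> embeddable r r0 -> embeddable r r1 ->
  #|vert R0| <= #|vert R1|.
Proof.
move=> s0 s1 [j je] [j' je'].
have [p [pi _ _ _]] := special_map s0 s1 je (emb_inj je') (emb_over je').
exact: inj_card_vert pi.
Qed.

(** An arrow and its missing face have the same representatives; a choice that depends on these
    alone gives both the same filler. *)
Lemma embeds_transfer (U R R0 R1 : Omega) (r : hom R T) (r0 : hom R0 T)
    (r1 : hom R1 T) (f : hom U R) (j : hom R R0) :
  special r0 -> special r1 -> injective f -> embeds c r r0 j ->
  embeds c (r \oc f) r0 (j \oc f) ->
  (embeddable r r1 <-> embeddable (r \oc f) r1).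
Proof.
move=> s0 s1 fi je jfe; split=> -[k ke].
- have [p [pi pr pj _]] := special_map s0 s1 je (emb_inj ke) (emb_over ke).
  exists (k \oc f); split.
  + exact: inj_comp (emb_inj ke) fi.
  + by rewrite cmpA (emb_over ke).
  + rewrite -pj -cmpA; apply: spanning_cmp (emb_spanning jfe).
    by apply: (spanning_left (emb_spanning je)); rewrite pj; apply: emb_spanning ke.
  + move=> x xc; have [u ux] := emb_hit ke xc; subst x.
    have [|u' u'E] := @emb_hit _ _ _ _ _ _ _ jfe (j u).
      have -> : r0 (j u) = r u := hom_congr u (emb_over je).
      by have <- : r1 (k u) = r u := hom_congr u (emb_over ke).
    by exists u'; rewrite /= (emb_inj je u'E).
- have [p [pi pr pj _]] := special_map s0 s1 jfe (emb_inj ke) (emb_over ke).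
  have ps : spanning p.
    by apply: (spanning_left (emb_spanning jfe)); rewrite pj; apply: emb_spanning ke.
  exists (p \oc j); split.
  + exact: inj_comp pi (emb_inj je).
  + by rewrite cmpA pr (emb_over je).
  + exact: spanning_cmp ps (emb_spanning je).
  + move=> x xc; have [u <-] := emb_hit ke xc.
    by exists (f u); rewrite -pj.
Qed.

(** The boundary of a filling problem belongs to earlier stages. If the comparison p of
    representatives were an isomorphism, m would miss at most the occurrence of c and so lie outside
    the horn. *)
Lemma special_horn_card (U R0 R1 : Omega) (r0 : hom R0 T) (r1 : hom R1 T)
    (e : inner_edge R0) (m : hom U R0) :
  special r0 -> special r1 -> r0 (val e) = c -> injective m -> in_horn e m ->
  embeddable (r0 \oc m) r1 -> #|vert R1| < #|vert R0|.
Proof.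
move=> s0 s1 ec mi mh [j je].
have [p [pi pr pj pc]] := special_map s1 s0 je mi (erefl _).
apply: noniso_card_vert pi _ => piso; apply: (full_not_horn _ mh).
have pm : spanning m.
  by rewrite -pj; apply: spanning_cmp (emb_spanning je); apply: iso_spanning.
split=> // f _ fe; have [q [_ pq]] := piso.
have pqE : p (q f) = f := hom_congr f pq.
have [|u uE] := @emb_hit _ _ _ _ _ _ _ je (q f); last by exists u; rewrite -pj /= uE.
move=> qc; apply: fe; case: s0 => _ o0 _; apply: o0 => //.
by rewrite -pqE; apply: pc.
Qed.

Definition fills (xi : forall R : Omega, hom R T -> point X R -> Prop)
    (R0 : Omega) (r0 : hom R0 T) (b : point X R0) : Prop :=
  tag b = input_obj (pmap N r0 t) /\
  forall (e : inner_edge R0) (U : Omega) (m : hom U R0),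
    r0 (val e) = c -> injective m -> in_horn e m ->
    exists2 a, xi U (r0 \oc m) a & restricts (pmap N r0 t) m b a.

Lemma fills_ex n xi (R0 : Omega) (r0 : hom R0 T) :
  is_family t (level n) xi -> special r0 -> #|vert R0| <= n.+1 ->
  exists b, fills xi r0 b.
Proof.
move=> xF s0 le_n; have [[x xc] o0 H0] := s0.
pose e : inner_edge R0 := exist _ x (mark_inner H0 xc).
set s := input_obj (pmap N r0 t).
(* The prescribed values live over different input objects; transported along [input_map] they form
   a horn in the one dendroidal set [X s]. *)
pose P (U : Omega) (m : hom U R0) (y : X s U) : Prop := exists a y',
  [/\ xi U (r0 \oc m) a,
    a = existT (fun s => X s U) (input_obj (pmap N m (pmap N r0 t))) y' &
    y = dmap X (input_map m (pmap N r0 t)) U y'].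
have [|U m mi mh|U m b b' [a [y [xa aE ->]]] [a' [y' [xa' aE' ->]]]
    |U m V f b mi fi [a [y [xa aE ->]]]|z zP] := @horn_fill (X s) R0 e P.
- exact: XK.
- have [|a xa] := (fam_dom xF (r0 \oc m)).1.
    split; first exact: once_cmp.
    case: (excluded_middle_informative (H (r0 \oc m))) => [|nH]; first by left.
    have [R1 [r1 [s1 je]]] := special_exists (once_cmp mi o0) nH.
    right; exists R1, r1; split=> //; rewrite -ltnS; apply: leq_trans le_n.
    exact: special_horn_card s0 s1 (xc : r0 (val e) = c) mi mh je.
  (* Restriction along the identity reveals over which object the value a lives. *)
  have idi : injective (idc U) by [].
  have [b _ ab] := fam_res xF idi xa.
  have aT := restricts_tag ab.
  case: a xa ab aT => s' y' xa _ /= sE; subst s'.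
  exists (dmap X (input_map m (pmap N r0 t)) U y').
  by exists (existT (fun s => X s U) (input_obj (pmap N m (pmap N r0 t))) y'), y'.
- have aa := fam_fun xF xa xa'; rewrite aE aE' in aa.
  by rewrite (inj_pair2 _ _ _ _ _ aa).
- have [a' xa' [y1 [y2 [aE1 aE2 yy]]]] := fam_res xF fi xa.
  have y1E : y1 = y by rewrite aE in aE1; apply: esym; apply: inj_pair2 aE1.
  subst y1; exists a', y2; split=> //; first by rewrite cmpA.
  rewrite -nob_nat (yy : pmap _ f y = _) dmap_input_map_cmp.
  by congr (dmap X _ V _).
- exists (existT (fun s => X s R0) s z); split=> // e' U m e'c mi mh.
  have ee' : e' = e by apply: val_inj; apply: o0.
  subst e'; have [a [y [xa aE zE]]] := zP U m mi mh.
  by exists a => //; exists z, y.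
Qed.

Definition representative : Type := {R0 : Omega & (hom R0 T * point X R0)%type}.

Definition is_rep (n : nat) (xi : forall R : Omega, hom R T -> point X R -> Prop)
    (R : Omega) (r : hom R T) (o : option representative) : Prop :=
  if o is Some (existT R0 (r0, b)) then
    [/\ special r0, embeddable r r0, #|vert R0| = n.+1 & fills xi r0 b]
  else False.

(** The choice by [epsilon] depends on the predicate alone, so arrows with equal predicates receive
    the same representative and the same filler. *)
Definition rep n xi (R : Omega) (r : hom R T) : option representative :=
  epsilon (inhabits None) (is_rep n xi r).

Definition extend n (xi : forall R : Omega, hom R T -> point X R -> Prop)
    (R : Omega) (r : hom R T) (a : point X R) : Prop :=
  xi R r a \/ ~ level n r /\ exists (R0 : Omega) (r0 : hom R0 T) b j,
    [/\ rep n xi r = Some (existT _ R0 (r0, b)),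
      is_rep n xi r (Some (existT _ R0 (r0, b))),
      embeds c r r0 j & restricts (pmap N r0 t) j b a].

Lemma rep_ex n xi (R : Omega) (r : hom R T) :
  is_family t (level n) xi -> level n.+1 r -> ~ level n r ->
  exists (R0 : Omega) (r0 : hom R0 T) b,
    rep n xi r = Some (existT _ R0 (r0, b)) /\
    is_rep n xi r (Some (existT _ R0 (r0, b))).
Proof.
move=> xF [ro rl] nl; have rH : ~ H r by move=> rH; apply: nl; split=> //; left.
case: rl => [//|[R0 [r0 [s0 je le_n]]]].
have lt_n : n < #|vert R0|.
  rewrite ltnNge; apply/negP => le; apply: nl; split=> //.
  by right; exists R0, r0.
have [b bF] := fills_ex xF s0 le_n.
have : exists o, is_rep n xi r o.
  exists (Some (existT _ R0 (r0, b))); split=> //.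
  by apply/eqP; rewrite eqn_leq le_n.
move/(epsilon_spec (inhabits None)); rewrite -/(rep n xi r).
by case: (rep n xi r) => [[R1 [r1 b1]]|//] oP; exists R1, r1, b1.
Qed.

Lemma level_leq n m (R : Omega) (r : hom R T) :
  n <= m -> level n r -> level m r.
Proof.
move=> nm [ro [rH|[R0 [r0 [s0 je le_n]]]]]; split=> //; first by left.
by right; exists R0, r0; split=> //; apply: leq_trans nm.
Qed.

Lemma extend_family n xi :
  is_family t (level n) xi -> is_family t (level n.+1) (@extend n xi).
Proof.
move=> xF; split.
- move=> R r a a' [xa|[nl [R0 [r0 [b [j [rE [s0 _ _ _] je ba]]]]]]].
    case=> [xa'|[nl _]]; first exact (fam_fun xF xa xa').
    by case: nl; apply/(fam_dom xF); exists a.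
  case=> [xa'|[_ [R1 [r1 [b' [j' [rE' _ je' ba']]]]]]].
    by case: nl; apply/(fam_dom xF); exists a'.
  rewrite rE in rE'; case: rE' => ER; subst R1 => Er Eb.
  have {}Er := inj_pair2 _ _ _ _ _ Er; have {}Eb := inj_pair2 _ _ _ _ _ Eb.
  subst r1 b'.
  have rs := H_spanning (embeds_not_H s0 je); case: s0 => m0 o0 H0.
  have jE := embeds_uniq o0 (H_spanning H0) m0 rs je je'; subst j'.
  exact: restricts_uniq (emb_spanning je) ba ba'.
- move=> R r; split=> [rl|[a [xa|[nl [R0 [r0 [b [j [rE [s0 e0 c0 _] je ba]]]]]]]]].
  + case: (excluded_middle_informative (level n r)) => [|nl].
      by move/(fam_dom xF) => [a xa]; exists a; left.
    have [R0 [r0 [b [rE rP]]]] := rep_ex xF rl nl.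
    have [_ [j je] _ [bT _]] := rP.
    have [a ba] := restricts_ex (emb_spanning je) bT.
    by exists a; right; split=> //; exists R0, r0, b, j.
  + by apply: level_leq (leqnSn n) _; apply/(fam_dom xF); exists a.
  + split; last by right; exists R0, r0; rewrite c0.
    rewrite -(emb_over je); apply: once_cmp (emb_inj je) _; by case: s0.
- move=> R U r f a fi [xa|[nl [R0 [r0 [b [j [rE rP je ba]]]]]]].
    by have [b xb ab] := fam_res xF fi xa; exists b => //; left.
  have rt : pmap N j (pmap N r0 t) = pmap N r t by rewrite -pmap_cmp (emb_over je).
  have jE : r0 \oc (j \oc f) = r \oc f by rewrite cmpA (emb_over je).
  have jfi : injective (j \oc f) := inj_comp (emb_inj je) fi.
  have [s0 e0 c0 [bT bF]] := rP; have [[x xc] o0 H0] := s0.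
  pose e : inner_edge R0 := exist _ x (mark_inner H0 xc).
  (* Either the composite with j lies in the horn, where the filler has prescribed values, or it
     omits at most the occurrence of c, and the same filler serves [r \oc f]. *)
  case: (embeds_or_horn (e := e) s0 xc jfi) => [jh|jfe].
    have [a' xa' ba'] := bF e U (j \oc f) xc jfi jh.
    rewrite jE in xa'; exists a'; first by left.
    by rewrite -rt; apply: restricts_cancel (emb_spanning je) ba ba'.
  rewrite jE in jfe.
  have [a' ba'] := restricts_ex (emb_spanning jfe) bT.
  exists a'; last by rewrite -rt; apply: restricts_cancel (emb_spanning je) ba ba'.
  right; split.
    move=> [_ [rH|[R1 [r1 [s1 e1 le_n]]]]]; first by case: (embeds_not_H s0 jfe).
    have je' : embeddable (r \oc f) r0 by exists (j \oc f).
    by have := leq_trans (special_card s0 s1 je' e1) le_n; rewrite c0 ltnn.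
  (* Equality of the predicates is required here, since [epsilon] need not respect mere
     equivalence. *)
  have repE : is_rep n xi (r \oc f) = is_rep n xi r.
    apply: functional_extensionality => -[[R1 [r1 b1]]|//] /=.
    apply: propositional_extensionality; split=> -[s1 e1 c1 f1]; split=> //.
      by apply/(embeds_transfer s0 s1 fi je jfe).
    by apply/(embeds_transfer s0 s1 fi je jfe).
  exists R0, r0, b, (j \oc f); split=> //; last by rewrite repE.
  by rewrite /rep repE.
Qed.

Fixpoint approx (n : nat) : forall R : Omega, hom R T -> point X R -> Prop :=
  if n is n.+1 then extend n (approx n)
  else fun R r a => once c r /\ v r a.

Lemma approx_family n : is_family t (level n) (@approx n).
Proof.
elim: n => [|n IH]; last exact: extend_family.
split=> [R r a a' [_ va] [_ va']|R r|R U r f a fi [ro va]].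
- exact (fam_fun vF va va').
- split=> [[ro [rH|[R0 [r0 [[[x xc] o0 H0] _]]]]]|[a [ro va]]].
  + by have [a va] := (fam_dom vF r).1 rH; exists a.
  (* Stage 0 adds nothing to H: the occurrence of c in a representative is inner and forces a
     vertex. *)
  + rewrite leqn0 -card_nleaf cards_eq0 => /eqP E.
    have : x \in nleaf R0 by rewrite inE; apply: inner_nleaf (mark_inner H0 xc).
    by rewrite E inE.
  + by split=> //; left; apply/(fam_dom vF); exists a.
- have [b vb ab] := fam_res vF fi va.
  by exists b => //; split=> //; apply: once_cmp.
Qed.

Lemma approx_leq n m (R : Omega) (r : hom R T) a :
  n <= m -> approx n r a -> approx m r a.
Proof. by move=> /subnK <-; elim: (m - n) => //= k IH /IH; left. Qed.

Lemma family_extension : exists xi : forall R : Omega, hom R T -> point X R -> Prop,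
  is_family t (@once T c) xi /\
  forall R (r : hom R T) a, once c r -> v r a -> xi R r a.
Proof.
exists (fun R r a => exists n, approx n r a); split; last first.
  by move=> R r a ro va; exists 0.
split.
- move=> R r a a' [n xa] [m xa'].
  apply: (fam_fun (approx_family (maxn n m))).
    exact: approx_leq (leq_maxl n m) xa.
  exact: approx_leq (leq_maxr n m) xa'.
- move=> R r; split=> [ro|[a [n xa]]].
    have [n /(fam_dom (approx_family n)) [a xa]] : exists n, level n r.
      case: (excluded_middle_informative (H r)) => [rH|nH].
        by exists 0; split=> //; left.
      have [R0 [r0 [s0 e0]]] := special_exists ro nH.
      by exists #|vert R0|; split=> //; right; exists R0, r0.
    by exists a, n.
  by have /(fam_dom (approx_family n)) [] : exists a, approx n r a by exists a.
- move=> R U r f a fi [n xa].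
  have [b xb ab] := fam_res (approx_family n) fi xa.
  by exists b => //; exists n.
Qed.

End Extension.

(** * Extending horns in nerves of operads *)

Lemma inputs_cover (T : tree) (v : vert T) (a z : edge T) :
  below z = Some v -> above a z -> a = z \/ above a (out v).
Proof.
move=> bz az; have vz := above_below bz (above_refl z).
case: (above_comparable az vz) => [|va]; first by right.
case: (eqVneq a (out v)) => [->|/eqP ne]; first by right; apply: above_refl.
have [x xa] := above_out_inputs va ne; left.
have xz : val x = z.
  exact: siblings_disjoint (inputsP x) bz (above_trans xa az) (above_refl z).
by apply: above_anti az _; rewrite -xz.
Qed.

(** * Corollas and the subtree spanned by an operation *)

Section Corolla.

Variable I : finType.

Definition cor_below (x : option I) : option unit := omap (fun=> tt) x.
Definition cor_out (_ : unit) : option I := None.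

Lemma cor_out_inj : injective cor_out. Proof. by do 2!case. Qed.

Lemma cor_below_root x : (cor_below x == None) = (x == None).
Proof. by case: x. Qed.

Lemma cor_down_root x : fconnect (tree_down cor_out cor_below) x None.
Proof. by case: x => [i|]; [apply: (fconnect1 _ (Some i)) | apply: connect0]. Qed.

Definition corolla : tree := Tree cor_out_inj cor_below_root cor_down_root.

Lemma cor_leaf (i : I) : @is_leaf corolla (Some i).
Proof. by apply/negP => /existsP [[]]. Qed.

Lemma cor_op_subproof : @cut corolla I (fun i => Some i) None.
Proof.
split=> [i|i j ij|[i|] ly _].
- exact: (above_root (T := corolla)).
- by have /above_leaf := ij; move/(_ (cor_leaf i)) => [].
- by exists i; apply: above_refl.
- by case/negP: ly; apply/existsP; exists tt.
Qed.

Definition cor_op : @Omega_op corolla I (fun i => Some i) None :=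
  cut_Omega_op cor_op_subproof.

Variables (T : tree) (c : I -> edge T) (e : edge T).

Definition cor_fun (x : option I) : edge T := if x is Some i then c i else e.

Hypothesis o : Omega_op c e.

Lemma cor_map_vert (v : vert corolla) :
  @Omega_op T (inputs v) (fun x => cor_fun (val x)) (cor_fun (out v)).
Proof.
have [o1 o2 o3] := Omega_op_cut o; case: v; apply: cut_Omega_op; split.
- by move=> [[i|] xP] //=; apply: o1.
- by move=> [[i|] xP] [[j|] yP] //= ij; apply: val_inj; rewrite /= (o2 _ _ ij).
- move=> y ly ey; have [i iy] := o3 y ly ey.
  have iP : @below corolla (Some i) == Some tt by [].
  by exists (exist _ (Some i : edge corolla) iP).
Qed.

(** An operation of T seen as an arrow, so that a horn in a nerve has a value on it. *)
Definition cor_map : @hom Omega corolla T := @Omega_map corolla T cor_fun cor_map_vert.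

End Corolla.

(* The part of T between e and its inputs c, as a tree with the same
   vertices. *)
Lemma op_subtree (T : Omega) (I : finType) (c : I -> edge T) (e : edge T) :
  Omega_op c e ->
  exists (D : Omega) (d : hom D T) (c' : I -> edge D),
    [/\ Omega_op c' root, forall i, d (c' i) = c i, d root = e,
       forall i, is_leaf (c' i) &
       forall w : vert D, exists (v : vert T) (h : inputs v -> inputs w),
         [/\ bijective h, forall i, d (val (h i)) = val i & d (out w) = out v]].
Proof.
move=> /Omega_op_cut [o1 o2 o3].
pose A := fun y : edge T => above e y && [forall i, above (c i) y ==> (y == c i)].
have AP y : reflect (above e y /\ forall i, above (c i) y -> y = c i) (A y).
  apply: (iffP andP) => -[ey /= yA]; split=> //.
    by move=> i iy; apply/eqP; apply: (implyP (forallP yA i)).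
  by apply/forallP => i; apply/implyP => /yA ->.
have eA : A e.
  by apply/AP; split=> [|i ie]; [apply: above_refl | apply: above_anti].
have cA i : A (c i) by apply/AP; split=> // j /o2 ->.
pose L (y : {y | A y}) := [exists i, val y == c i].
have oP : is_tree_order (fun y z : {y | A y} => above (val y) (val z)) L
    (exist _ e eA).
  apply: sub_tree_order => [y /AP[] //|y z /existsP [i /eqP yi]].
  rewrite yi => iz; apply: val_inj; rewrite yi; apply: esym.
  by have /AP [_] := valP z; apply.
pose D : Omega := tree_of_order oP.
pose dv (y : edge D) : edge T := val (y : {y | A y}).
have aboveD (y z : edge D) : above y z = above (dv y) (dv z).
  exact: tree_of_order_above.
have leafD (y : edge D) : is_leaf y = L y by apply: tree_of_order_leaf.
pose c' i : edge D := exist _ (c i) (cA i).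
have lc' i : is_leaf (c' i) by rewrite leafD; apply/existsP; exists i.
have dT : @tree_map D T dv.
  split=> [y z|y z|y ly ey]; rewrite -?aboveD //; first by left.
  by have [i iy] := o3 y ly ey; exists (c' i).
pose d : hom D T := hom_of dT.
exists D, d, c'; split=> //.
  apply: cut_Omega_op; split=> [i|i j|y]; rewrite ?aboveD //; first exact: o1.
    exact: o2.
  rewrite leafD => /existsP [i /eqP yi] _; exists i.
  by rewrite aboveD /dv yi above_refl.
move=> w; have lw : ~~ L (out w) by rewrite -leafD outNleaf.
have /AP [ew wA] := valP (out w : {y | A y}); rewrite -/(dv (out w)) in ew wA.
have wc i : above (c i) (dv (out w)) -> False.
  by move=> /wA E; case/negP: lw; apply/existsP; exists i; apply/eqP.
have /leafPn [v vw] : ~~ is_leaf (dv (out w)).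
  by apply/negP => lw'; have [i /wc] := o3 _ lw' ew.
have zA (z : inputs v) : A (val z).
  apply/AP; split=> [|i iz].
    by apply: above_trans ew _; rewrite -vw; apply: above_inputs.
  case: (inputs_cover (inputsP z) iz) => [//|]; by rewrite vw => /wc.
pose z' (z : inputs v) : edge D := exist _ (val z) (zA z).
have wz' z : above (out w) (z' z) by rewrite aboveD -vw; apply: above_inputs.
have wz'ne z : z' z <> out w.
  move=> E; have := above_outN (inputsP z); rewrite vw -E.
  by rewrite [dv _]/(val z) above_refl.
have sandwich (y : edge D) (z : inputs v) :
    above (out w) y -> y <> out w -> above y (z' z) -> y = z' z.
  rewrite !aboveD => wy ne yz; apply: val_inj; rewrite -/(dv y).
  case: (inputs_cover (inputsP z) yz) => [//|yv]; case: ne; apply: val_inj.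
  by apply: above_anti wy; rewrite -/(dv (out w)) -vw.
have inw (y : inputs w) : above (out w) (val y) /\ val y <> out w.
  split; first exact: above_inputs.
  by move=> E; have := above_outN (inputsP y); rewrite E above_refl.
have hP (z : inputs v) : exists y : inputs w, val y = z' z.
  have [y yz] := above_out_inputs (wz' z) (wz'ne z).
  by have [wy ne] := inw y; exists y; apply: sandwich.
pose h z := sval (constructive_indefinite_description _ (hP z)).
have hE z : val (h z) = z' z by rewrite /h; case: constructive_indefinite_description.
exists v, h; split=> [|z|//]; last by rewrite [d _]/(dv _) hE.
apply: inj_surj_bij => [z1 z2 E|y].
  apply: val_inj; have := hE z1; rewrite E hE => E'.
  by rewrite -[LHS]/(dv (z' z1)) -E'.
have [wy ne] := inw y; have [z zy] : exists z : inputs v, above (val z) (dv (val y)).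
  apply: above_out_inputs; first by rewrite vw -aboveD.
  by rewrite vw => E; apply: ne; apply: val_inj.
exists z; apply: inputs_antichain; rewrite hE aboveD.
exact: zy.
Qed.

Section NerveExtension.

Variable P : operad.
Notation NP := (nerve P).

(** Operations are packed with their colours, because the colours of two maps may agree only up to a
    proved equation. *)
Definition packed_op (I : finType) : Type :=
  {c : I -> col P & {x : col P & op P c x}}.

Definition op_value (R : Omega) (g : NP R) (I : finType) (c : I -> edge R)
    (x : edge R) (w : @Omega_op R I c x) : packed_op I :=
  existT _ (fun i => g (c i)) (existT _ (g x)
    (@mop (Omega_operad R) P g I c x w)).

Lemma op_value_irr (R : Omega) (g : NP R) (I : finType) (c c' : I -> edge R)
    (x x' : edge R) (w : Omega_op c x) (w' : Omega_op c' x') :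
  (forall i, c i = c' i) -> x = x' -> op_value g w = op_value g w'.
Proof.
move=> /functional_extensionality E E'; subst c' x'.
by rewrite (proof_irrelevance _ w w').
Qed.

Lemma op_value_corolla (R : Omega) (g : NP R) (I : finType) (c : I -> edge R)
    (x : edge R) (w : Omega_op c x) :
  op_value g w = op_value (pmap NP (cor_map w) g) (cor_op I).
Proof. exact: (op_value_irr g w (mop (cor_map w) (cor_op I))). Qed.

Lemma nerve_ext (R : Omega) (g g' : NP R) :
  (forall x, g x = g' x) ->
  (forall u : vert R, exists (I : finType) (c : I -> edge R)
     (h : I -> inputs u) (w : Omega_op c (out u)),
     [/\ bijective h, forall i, val (h i) = c i & op_value g w = op_value g' w]) ->
  g = g'.
Proof.
case: g g' => [f o oP] [f' o' oP'] /= ff'.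
have E : f = f' by apply: functional_extensionality.
subst f' => gg'; suff E : o = o'.
  by subst o'; congr OperadMap; apply: proof_irrelevance.
pose p (u : vert R) := o _ (fun x : inputs u => val x) (out u) (Omega_vert u).
have [phi [_ phiU]] := Omega_free p.
have o'p u : o' _ (fun x : inputs u => val x) (out u) (Omega_vert u) = p u.
  have [I [c [h [w [bh hc]]]]] := gg' u.
  have cE : c = fun i => val (h i).
    by apply: functional_extensionality => i; apply: esym (hc i).
  subst c => ww; have {}ww := inj_pair2 _ _ _ _ _ (inj_pair2 _ _ _ _ _ ww).
  have vE : Omega_vert u = @oact (Omega_operad R) _ _ h bh (fun x => val x) _ w.
    exact: (proof_irrelevance (Omega_op _ _)).
  rewrite /p vE (map_oact oP) (map_oact oP'); congr (oact _ _).
  exact: esym ww.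
by rewrite -(phiU o) // -(phiU o').
Qed.

Lemma repack (I : finType) (c c' : I -> col P) (x x' : col P) (q : op P c x) :
  (forall i, c i = c' i) -> x = x' ->
  exists q' : op P c' x', existT _ c' (existT _ x' q') =
    existT _ c (existT _ x q) :> packed_op I.
Proof.
by move=> /functional_extensionality E E'; subst c' x'; exists q.
Qed.

Variables (T : Omega) (e : inner_edge T).

Lemma not_spanning_horn (R : Omega) (r : hom R T) : ~ spanning r -> in_horn e r.
Proof.
move=> ns; case: (excluded_middle_informative (in_horn e r)) => //.
by move=> /not_horn_full [].
Qed.

Lemma edge_horn (x : edge T) : in_horn e (edge_map x).
Proof.
apply: not_spanning_horn => -[/= xr /(_ tt (eta_leaf tt)) /= lx]; subst x.
by apply: (inner_neq_root (valP e)); apply: above_leaf lx (above_root _).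
Qed.

Lemma vert_not_spanning (v : vert T) :
  ~ (out v = root /\ forall x : inputs v, is_leaf (val x)).
Proof.
move=> [vr vl]; have ve : above (out v) (val e) by rewrite vr; apply: above_root.
have [|x xe] := above_out_inputs ve.
  by rewrite vr; apply: inner_neq_root (valP e).
have := inner_nleaf (valP e); rewrite (above_leaf (vl x) xe).
by rewrite (vl x).
Qed.

(** A single vertex reaching from the root to leaves would leave no room for the inner edge e, so
    its corolla is not spanning. *)
Lemma vert_horn (v : vert T) : in_horn e (cor_map (Omega_vert v)).
Proof.
apply: not_spanning_horn => -[vr vl]; apply: (@vert_not_spanning v); split=> // x.
exact: (vl (Some x) (cor_leaf x)).
Qed.

Lemma nerve_horn_inj (t t' : NP T) :
  (forall (R : Omega) (r : hom R T), in_horn e r -> pmap NP r t = pmap NP r t') ->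
  t = t'.
Proof.
move=> tt'; apply: nerve_ext => [x|v].
  exact: (congr1 (fun g : NP eta => g tt) (tt' _ _ (edge_horn x))).
exists (inputs v), (fun x => val x), id, (Omega_vert v); split=> //.
  by exists id.
by rewrite (op_value_corolla t) (op_value_corolla t') tt' //; apply: vert_horn.
Qed.

Variable k : nattrans (inner_horn e) NP.

Definition horn_value (R : Omega) (r : hom R T) (rh : in_horn e r) : NP R :=
  k R (exist (@in_horn T e R) r rh).

Lemma horn_value_irr (R : Omega) (r r' : hom R T) (rh : in_horn e r)
    (rh' : in_horn e r') : r = r' -> horn_value rh = horn_value rh'.
Proof. by move=> E; subst r'; rewrite (proof_irrelevance _ rh rh'). Qed.

Lemma horn_value_cmp (R U : Omega) (r : hom R T) (f : hom U R)
    (rh : in_horn e r) (rfh : in_horn e (r \oc f)) :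
  horn_value rfh = pmap NP f (horn_value rh).
Proof.
rewrite /horn_value -nob_nat; congr (k U _); exact: sig_eq.
Qed.

Definition ext_col (x : edge T) : col P := horn_value (edge_horn x) tt.

Lemma horn_value_col (R : Omega) (r : hom R T) (rh : in_horn e r) x :
  horn_value rh x = ext_col (r x).
Proof.
have E : r \oc edge_map x = edge_map (r x) by apply: hom_eq.
rewrite /ext_col -(horn_value_irr (in_horn_cmp (edge_map x) rh) _ E).
by rewrite (horn_value_cmp rh).
Qed.

Lemma ext_vert_ex (v : vert T) :
  exists q : op P (fun x : inputs v => ext_col (val x)) (ext_col (out v)),
    existT _ (fun x : inputs v => ext_col (val x)) (existT _ (ext_col (out v)) q)
    = op_value (horn_value (vert_horn v)) (cor_op (inputs v)) :> packed_op _.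
Proof.
apply: repack => [x|]; first exact: (horn_value_col (vert_horn v) (Some x)).
exact: (horn_value_col (vert_horn v) None).
Qed.

Definition ext_vert (v : vert T) :
    op P (fun x : inputs v => ext_col (val x)) (ext_col (out v)) :=
  sval (constructive_indefinite_description _ (ext_vert_ex v)).

Lemma ext_vertP (v : vert T) :
  existT _ (fun x : inputs v => ext_col (val x))
    (existT _ (ext_col (out v)) (ext_vert v))
  = op_value (horn_value (vert_horn v)) (cor_op (inputs v)) :> packed_op _.
Proof. by rewrite /ext_vert; case: constructive_indefinite_description. Qed.

Lemma ext_ex : exists t : NP T, (forall x, t x = ext_col x) /\
  forall v, op_value t (Omega_vert v) =
    op_value (horn_value (vert_horn v)) (cor_op (inputs v)).
Proof.
have [phi [[phiP phiv] _]] := Omega_free ext_vert.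
by exists (OperadMap phiP); split=> // v; rewrite -ext_vertP /op_value /= phiv.
Qed.

(** The vertices of D are vertices of T, and t agrees with the horn on their corollas. *)
Lemma horn_value_vertexwise (t : NP T) (D : Omega) (d : hom D T) (dh : in_horn e d) :
  (forall x, t x = ext_col x) ->
  (forall v, op_value t (Omega_vert v) =
    op_value (horn_value (vert_horn v)) (cor_op (inputs v))) ->
  (forall w : vert D, exists (v : vert T) (h : inputs v -> inputs w),
    [/\ bijective h, forall i, d (val (h i)) = val i & d (out w) = out v]) ->
  horn_value dh = pmap NP d t.
Proof.
move=> tc tv dv; apply: nerve_ext => [x|w]; first by rewrite horn_value_col -tc.
have [v [h [bh dh_ dw]]] := dv w.
pose c i := val (h i).
have o : Omega_op c (out w).
  apply: Omega_op_relabel (Omega_vert w).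
  - exact: val_inj.
  - by move=> i j /val_inj /(bij_inj bh).
  - by case: bh => g gK hK i; exists (g i); rewrite /c hK.
  - by move=> i; exists (h i).
exists (inputs v), c, h, o; split=> //.
have E : d \oc cor_map o = cor_map (Omega_vert v).
  by apply: hom_eq => -[i|]; [apply: dh_ | apply: dw].
rewrite (op_value_corolla (horn_value dh)).
rewrite -(horn_value_cmp dh (in_horn_cmp (cor_map o) dh)).
rewrite (horn_value_irr _ (vert_horn v) E) -tv.
exact: (op_value_irr t (Omega_vert v) (mop d o) (fun i => esym (dh_ i)) (esym dw)).
Qed.

Lemma face_vert_not_spanning (f : face T) (u : vert (face_tree f)) :
  f <> InnerFace e ->
  ~ (face_map f (out u) = root /\ forall y : inputs u, is_leaf (face_map f (val y))).
Proof.
move=> fe [ur ul]; have [x xe] := face_hit fe.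
have ux : above (out u) x.
  by apply: (hom_inj_above (@face_map_inj T f)); rewrite ur; apply: above_root.
have [|y yx] := above_out_inputs ux.
  by move=> E; apply: (inner_neq_root (valP e)); rewrite -xe E.
have ye := hom_above (face_map f) yx; rewrite xe in ye.
by have := inner_nleaf (valP e); rewrite (above_leaf (ul y) ye) ul.
Qed.

Lemma nerve_extension : exists t : NP T,
  forall (R : Omega) (r : hom R T) (rh : in_horn e r),
    horn_value rh = pmap NP r t.
Proof.
have [t [tc tv]] := ext_ex; exists t.
have onface (f : face T) (fh : in_horn e (face_map f)) : f <> InnerFace e ->
    horn_value fh = pmap NP (face_map f) t.
  move=> fe; apply: nerve_ext => [x|u]; first by rewrite horn_value_col -tc.
  exists (inputs u), (fun x => val x), id, (Omega_vert u); split=> //.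
    by exists id.
  (* A vertex u of the face may be a composite operation of T. The subtree D that it spans is built
     from vertices of T and, because the face contains e, does not span T; so D lies in the horn and
     t is correct on it. *)
  have [D [d [c' [o' dc dr lc dV]]]] := op_subtree (mop (face_map f) (Omega_vert u)).
  have dh : in_horn e d.
    apply: not_spanning_horn => -[ds dl].
    apply: (@face_vert_not_spanning f u fe); split=> [|y]; first by rewrite -dr.
    by have := dl _ (lc y); rewrite dc.
  have E : face_map f \oc cor_map (Omega_vert u) = d \oc cor_map o'.
    by apply: hom_eq => -[i|]; [apply: esym (dc i) | apply: esym dr].
  rewrite (op_value_corolla (horn_value fh)).
  rewrite -(horn_value_cmp fh (in_horn_cmp (cor_map (Omega_vert u)) fh)).
  rewrite (horn_value_irr _ (in_horn_cmp (cor_map o') dh) E) (horn_value_cmp dh).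
  rewrite -op_value_corolla (horn_value_vertexwise dh tc tv dV).
  exact: (op_value_irr t (mop d o') (mop (face_map f) (Omega_vert u)) dc dr).
move=> R r rh; have [f [s [fe rE]]] := rh.
have fh : in_horn e (face_map f).
  by exists f, (idc _); split; rewrite // cmpc1.
rewrite (horn_value_irr rh (in_horn_cmp s fh) rE) (horn_value_cmp fh) onface //.
by rewrite -pmap_cmp -rE.
Qed.

End NerveExtension.

(** * The dendroidal set of dendrices *)

Section Integral.

Variables (S : cartesian) (X : diagram S).
Notation N := (nerve (cart_operad S)).

Lemma summand_point (R : Omega) (a : point X R) (s : S) (E : tag a = s) :
  a = existT (fun s => X s R) s (summand (A := fun s : S => coll_of (X s)) E).
Proof. by case: a E => s' x /= E; subst s'. Qed.

Lemma summand_existT (R : Omega) (a : point X R) (s : S) (E : tag a = s) x :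
  a = existT (fun s => X s R) s x ->
  summand (A := fun s : S => coll_of (X s)) E = x.
Proof.
by move=> aE; subst a; rewrite /= in E *; rewrite (proof_irrelevance _ E erefl).
Qed.

Lemma dendrex_restricts (T R U : Omega) (y : dendrex X T) (r : hom R T)
    (f : hom U R) : injective f ->
  restricts (X := X) (pmap N r (dx_base y)) f (dx_fib y r) (dx_fib y (r \oc f)).
Proof.
move=> /inj_face_mono fm; exists (summand (dx_in y r)).
exists (summand (dx_in y (pmap (representable T) f r))); split.
- exact: summand_point.
- exact: summand_point.
- exact: dx_mono fm.
Qed.

Lemma family_dendrex (T : Omega) (t : N T) xi :
  is_family (X := X) t (fun _ _ => True) xi ->
  exists2 y : dendrex X T, dx_base y = t &
    forall (R : Omega) (r : hom R T), xi R r (dx_fib y r).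
Proof.
move=> xF.
pose x (R : Omega) (r : hom R T) : point X R :=
  sval (constructive_indefinite_description _ ((fam_dom xF r).1 I)).
have xP (R : Omega) (r : hom R T) : xi R r (x R r).
  by rewrite /x; case: constructive_indefinite_description.
have xr (R U : Omega) (r : hom R T) (f : hom U R) : injective f ->
    restricts (pmap N r t) f (x R r) (x U (r \oc f)).
  move=> fi; have [b xb ab] := fam_res xF fi (xP R r).
  by rewrite (fam_fun xF (xP U (r \oc f)) xb).
have xin (R : Omega) (r : hom R T) : tag (x R r) = input_obj (pmap N r t).
  by apply: restricts_tag (xr R R r (idc R) _).
have xm (R : Omega) (r : hom R T) (U : Omega) (f : hom U R) : face_mono f ->
    pmap (X _) f (summand (A := fun s : S => coll_of (X s)) (xin R r)) =
    dmap X (input_map f (pmap N r t)) U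
      (summand (A := fun s : S => coll_of (X s)) (xin U (r \oc f))).
  move=> /face_mono_inj /(xr R U r f) [z [z' [zE zE' zz']]].
  by rewrite (summand_existT (xin R r) zE) zz'
    (summand_existT (xin U (r \oc f)) zE').
by exists (@Dendrex S X T t x xin xm).
Qed.

Lemma family_pull (T T' : Omega) (p : hom T' T) (t : N T) D xi :
  is_family (X := X) t D xi ->
  is_family (pmap N p t) (fun R r => D R (p \oc r)) (fun R r => xi R (p \oc r)).
Proof.
move=> xF; split=> [R r a a'|R r|R U r f a fi xa].
- exact (fun xa => fam_fun xF xa).
- exact: (fam_dom xF).
- have [b xb ab] := fam_res xF fi xa.
  by exists b; [rewrite cmpA | rewrite -pmap_cmp].
Qed.

Lemma dx_fib_pull (T R : Omega) (r : hom R T) (y : dendrex X T) :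
  dx_fib (pmap (integral X) r y) (idc R) = dx_fib y r.
Proof. exact: (congr1 (@dx_fib S X T y R) (cmpc1 r)). Qed.

Section Horn.

Variables (T : Omega) (e : inner_edge T).

Lemma horn_dendrex_inj (y y' : dendrex X T) :
  (forall s : S, strict_inner_Kan (X s)) ->
  (forall (R : Omega) (r : hom R T), in_horn e r ->
     pmap (integral X) r y = pmap (integral X) r y') -> y = y'.
Proof.
move=> XK yy'.
have tt' : dx_base y = dx_base y'.
  apply: (nerve_horn_inj (e := e)) => R r rh.
  exact: (congr1 (@dx_base S X R) (yy' R r rh)).
have onhorn (R : Omega) (r : hom R T) : in_horn e r -> dx_fib y r = dx_fib y' r.
  by move=> rh; rewrite -(dx_fib_pull r y) -(dx_fib_pull r y') yy'.
(* At any occurrence x of e, every face other than the one omitting x still hits e, so the induction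
   covers the whole horn and strictness gives equality. *)
have hit (R : Omega) (r : hom R T) :
    (exists x, r x = val e) -> dx_fib y r = dx_fib y' r.
  have [n] := ubnP #|vert R|; elim: n R r => // n IH R r le_n [x xe].
  case: (excluded_middle_informative (in_horn e r)) => [/onhorn //|].
  move=> /not_horn_full [[r1 r2] _].
  have ix : inner x.
    apply: innerI.
      by apply: contraTN (inner_nleaf (valP e)); rewrite -xe negbK; apply: r2.
    by move=> xr; apply: (inner_neq_root (valP e)); rewrite -xe xr.
  pose x' : inner_edge R := exist _ x ix.
  have ii : injective (idc R) by [].
  have [a [_ [aE _ _]]] := dendrex_restricts y r ii.
  have [a' [_ [aE' _ _]]] := dendrex_restricts y' r ii.
  move: a aE; rewrite tt' => a aE; rewrite aE aE'; congr existT.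
  apply: (strict_fill_eq (e := x') (XK _)) => f fx.
  have [z ze] := face_hit fx.
  have Ef : dx_fib y (r \oc face_map f) = dx_fib y' (r \oc face_map f).
    apply: IH; first exact: leq_trans (card_face f) _.
    by exists z; rewrite /= ze.
  have [b [c [bE cE bc]]] := dendrex_restricts y r (@face_map_inj R f).
  have [b' [c' [bE' cE' bc']]] := dendrex_restricts y' r (@face_map_inj R f).
  move: b c bE cE bc; rewrite tt' Ef => b c bE cE bc.
  rewrite aE in bE; rewrite aE' in bE'; rewrite cE in cE'.
  have ab : a = b := inj_pair2 _ _ _ _ _ bE.
  have ab' : a' = b' := inj_pair2 _ _ _ _ _ bE'.
  have cc' : c = c' := inj_pair2 _ _ _ _ _ cE'.
  by rewrite ab ab' bc bc' cc'.
apply: dendrex_eq => // R r.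
case: (excluded_middle_informative (in_horn e r)) => [/onhorn //|].
move=> /not_horn_full [rs _].
pose r0 := ins_map (valP e) rs; pose j := ins_incl (valP e) rs.
have r0j : r0 \oc j = r by apply: ins_map_incl.
have js : spanning j by case: (ins_incl_full (valP e) rs).
(* The insertion r0 hits e, and r is its restriction along the spanning j, along which restrictions
   are unique. *)
have ji : injective j by apply: ins_incl_inj.
have := dendrex_restricts y r0 ji; have := dendrex_restricts y' r0 ji.
rewrite tt' (hit _ r0) ?r0j; last by exists (ins_mark (valP e) rs).
by move=> h h'; apply: restricts_uniq js h' h.
Qed.

Variable k : nattrans (inner_horn e) (integral X).

Lemma horn_base_nat (U R : Omega) (f : hom U R) (r : inner_horn e R) :
  dx_base (k U (pmap (inner_horn e) f r)) = pmap N f (dx_base (k R r)).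
Proof. by rewrite nob_nat. Qed.

Definition horn_base : nattrans (inner_horn e) N :=
  @NatTrans Omega (inner_horn e) N (fun R r => dx_base (k R r)) horn_base_nat.

(** Only the value at the identity is kept; naturality recovers the others, as in [horn_fib_cmp]. *)
Definition horn_fib (R : Omega) (r : hom R T) (a : point X R) : Prop :=
  exists rh : in_horn e r, a = dx_fib (k R (exist (@in_horn T e R) r rh)) (idc R).

Lemma horn_fib_cmp (R U : Omega) (r : hom R T) (rh : in_horn e r)
    (f : hom U R) :
  horn_fib (r \oc f) (dx_fib (k R (exist (@in_horn T e R) r rh)) f).
Proof.
exists (in_horn_cmp f rh).
have -> : exist (@in_horn T e U) (r \oc f) (in_horn_cmp f rh) =
  pmap (inner_horn e) f (exist (@in_horn T e R) r rh) by apply: sig_eq.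
by rewrite nob_nat dx_fib_pull.
Qed.

Lemma horn_fib_family (t : N T) :
  (forall (R : Omega) (r : hom R T) (rh : in_horn e r),
     horn_value horn_base rh = pmap N r t) ->
  is_family t (@in_horn T e) horn_fib.
Proof.
move=> tE; split=> [R r a a' [rh ->] [rh' ->]|R r|R U r f a fi [rh ->]].
- by rewrite (proof_irrelevance _ rh rh').
- split=> [rh|[a [rh _]] //].
  by exists (dx_fib (k R (exist (@in_horn T e R) r rh)) (idc R)), rh.
- exists (dx_fib (k R (exist (@in_horn T e R) r rh)) f); first exact: horn_fib_cmp.
  have := dendrex_restricts (k R (exist (@in_horn T e R) r rh)) (idc R) fi.
  rewrite cmp1c pmap_id -[dx_base _]/(horn_value horn_base rh) tE.
  exact.
Qed.

Lemma horn_dendrex_surj :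
  (forall s : S, inner_Kan (X s)) ->
  exists y : dendrex X T, forall (R : Omega) (r : inner_horn e R),
    pmap (integral X) (sval r) y = k R r.
Proof.
move=> XK; have [t tE] := nerve_extension horn_base.
have vF := horn_fib_family tE.
have ids : spanning (idc (T : Omega)) by [].
have ie := valP e.
(* Insertion over e relative to the identity of T puts the mark c directly below e; p merges the two
   edges. *)
pose T' := ins_tree ie ids; pose p : hom T' T := ins_map ie ids.
pose i : hom T T' := ins_incl ie ids; pose c : edge T' := ins_mark ie ids.
have pi : p \oc i = idc (T : Omega) by apply: ins_map_incl.
have proot (x : edge T') : p x = root -> x = root.
  case: x => [x /= ->|/= E]; last by case: (inner_neq_root ie).
  by case: (ins_incl_full ie ids) => -[].
have pleaf (x : edge T') : is_leaf (p x) -> is_leaf x.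
  case: x => [x|] lx; rewrite tree_of_order_leaf //.
  by case/negP: (inner_nleaf ie).
have [||||||xi [xF xv]] := @family_extension S X T' c (pmap N p t)
    (fun R r => in_horn e (p \oc r)) (fun R r => horn_fib (p \oc r)).
- exact: ins_mark_inner.
- by move=> R U r f; rewrite cmpA; apply: in_horn_cmp.
- move=> R r /not_horn_full [[r1 r2] _]; split; first exact: proot.
  by move=> z /r2; apply: pleaf.
(* Fullness at e asks only for inner edges other than e, and c lies over e, so omitted occurrences
   of c do not matter. *)
- move=> R U r f /not_horn_full [rs rhit] fs hit; apply: full_not_horn.
  split; first by rewrite cmpA; apply: spanning_cmp.
  move=> g gi ge; have [x xg] := rhit g gi ge.
  have [|u ux] := hit x; last by exists u; rewrite -xg -ux.
  by move=> xc; apply: ge; rewrite -xg /= xc.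
- exact: XK.
- exact: family_pull vF.
have := family_pull i xF; rewrite -pmap_cmp pi pmap_id => xF'.
(* The inclusion i omits c, so all arrows into T belong to the domain of the extended family. *)
have ionce (R : Omega) (r : hom R T) : once c (i \oc r) by move=> x y /=.
have xF1 : is_family t (fun _ _ => True) (fun R (r : hom R T) => xi R (i \oc r)).
  split=> [R r a a'|R r|R U r f a]; last exact: fam_res xF' R U r f a.
    exact (fun xa => fam_fun xF' xa).
  by split=> // _; apply: (fam_dom xF' r).1; apply: ionce.
have [y yt yx] := family_dendrex xF1.
exists y => R [r rh] /=; apply: dendrex_eq => [|Q q].
  exact: (etrans (congr1 (pmap N r) yt) (esym (tE R r rh))).
apply: (fam_fun xF (yx Q (r \oc q))); apply: xv => //.
by rewrite cmpA pi cmp1c; apply: horn_fib_cmp.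
Qed.

End Horn.

End Integral.

Theorem theorem8p2 (S : cartesian) (X : diagram S) :
  ((forall s : S, inner_Kan (X s)) -> inner_Kan (integral X)) /\
  ((forall s : S, strict_inner_Kan (X s)) -> strict_inner_Kan (integral X)).
Proof.
have surj : (forall s : S, inner_Kan (X s)) -> inner_Kan (integral X).
  move=> XK T e k; have [y yk] := horn_dendrex_surj k XK.
  exists (yoneda_map (Y := integral X) (R := T) y).
  by apply: nattrans_eq => R r; apply: yk.
split=> // XK T e; split; last by apply: surj => s T' e'; case: (XK s T' e').
move=> f f' ff'; rewrite (yoneda_eq f) (yoneda_eq f'); congr yoneda_map.
apply: (horn_dendrex_inj (e := e) XK) => R r rh; rewrite -!nob_nat.
have -> : pmap (representable T) r (idc (T : Omega)) = r by apply: cmp1c.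
exact: (congr1 (fun h : nattrans (inner_horn e) (integral X) =>
  h R (exist (@in_horn T e R) r rh)) ff').
Qed.
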